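(* Let $D=\mathbb D$ be the unit disk in $\mathbb C$, $x_0=0$, $D_n=r_n\mathbb D$ with $0<r_n\uparrow1$ strictly, and let $h,j,\widehat D,p,F,\xi_\alpha$ be as in the context. Then: 1. The $D_n$ are connected regular domains with $0\in D_1$, $\overline{D_n}$ compact and contained in $D_{n+1}$, and $\bigcup_nD_n=D$; the relative kernel $K_{D_n}$ has a jointly continuous version on $D_n\times\partial D_n$; and for every $y\in\partial D_n$ the function $K_{D_n}(\cdot,y)$ is a minimal positive harmonic function on $D_n$. 2. For every $\alpha\in[-\pi/2,\pi/2]$ the measures $\widehat\nu_n:=j_\#(h\,\omega_0^{D_n})$ satisfy $\liminf_{n\to\infty}\widehat\nu_n(V)>0$ for every open neighborhood $V$ of $\xi_\alpha$ in $\widehat D$, and there are points $y_n\in\partial D_n$, for all sufficiently large $n$, such that $j(y_n)\to\xi_\alpha$ in $\widehat D$ and $K_{D_n}(\cdot,y_n)\to h$ locally uniformly in $D$. 3. Nevertheless, $\widehat\nu_n\Longrightarrow\lambda_F$ weakly on $\widehat D$, where $\lambda_F$ is normalized length measure on $F$, and $\lambda_F\ne\delta_{\xi_\alpha}$ for every $\xi_\alpha\in F$. 4. Positive Borel measures $\widehat\mu$ carried by $F$ that represent $h$, i.e. $h(z)=\int_F\widehat K(z,\eta)\,d\widehat\mu(\eta)$ for all $z\in D$, where $\widehat K(z,\eta)=\frac{1-|z|^2}{|p(\eta)-z|^2}$, are not unique, but all of them satisfy $p_\#\widehat\mu=\delta_1$ on the unit circle $\partial\mathbb D$.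
   Context: Harmonic means classically harmonic. $\omega_z^{D_n}$ is classical harmonic measure on the circle $\partial D_n$, and $K_{D_n}(z,y)=\frac{d\omega_z^{D_n}}{d\omega_0^{D_n}}(y)=\frac{r_n^2-|z|^2}{|y-z|^2}$. A domain is regular if for every boundary point $\zeta$ and every bounded Borel boundary function $f$ continuous at $\zeta$, the harmonic-measure integrals $\omega_x(f)$ tend to $f(\zeta)$ as $x\to\zeta$ from inside. A positive harmonic function $g$ on a domain is minimal if every harmonic $v$ with $0\le v\le g$ equals $cg$ for some $c\in[0,1]$. Put $h(z)=\frac{1-|z|^2}{|1-z|^2}$, $a(z)=\arctan\frac{\operatorname{Im}z}{1-\operatorname{Re}z}$, $j(z)=(z,a(z))$ for $z\in D$. Let $\widehat D=\overline{j(D)}\subset\overline{\mathbb D}\times[-\pi/2,\pi/2]$ and $p(z,t)=z$. Via $j$, $\widehat D$ is a compact metrizable compactification of $D$; the fibers of $p$ over points of $\partial\mathbb D\setminus\{1\}$ are singletons, and $F=p^{-1}(1)=\{1\}\times[-\pi/2,\pi/2]$. Write $\xi_\alpha=(1,\alpha)$, $\alpha\in[-\pi/2,\pi/2]$. $\Longrightarrow$ is weak convergence against continuous functions, and $p_\#,j_\#$ denote push-forwards. *)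

(* Defs.v *)
(* The complex plane is [R * R], with its product topology (the Euclidean one)
   and its product sigma-algebra (the Borel one); likewise for [R * R * R],
   which contains the compactification of the disk. *)
From HB Require Import structures.
From mathcomp Require Import all_boot all_order all_algebra.
From mathcomp Require Import all_classical all_reals all_analysis.
From mathcomp Require Import measurable_realfun.

Set Implicit Arguments.
Unset Strict Implicit.
Unset Printing Implicit Defensive.

Import Order.TTheory GRing.Theory Num.Theory.
Import numFieldNormedType.Exports.

Local Open Scope classical_set_scope.
Local Open Scope ring_scope.

Notation plane R := (R * R)%type.

Section plane.
Context {R : realType}.
Implicit Types (z y : plane R) (r : R).

(* |z|^2 for the Euclidean modulus; the norm that [R * R] carries in the
   library is the sup norm. *)
Definition sqmod z : R := z.1 ^+ 2 + z.2 ^+ 2.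

Definition origin : plane R := (0, 0).

Definition pt1 : plane R := (1, 0).

Definition disk r : set (plane R) := [set z | sqmod z < r ^+ 2].

Definition boundary (U : set (plane R)) : set (plane R) :=
  closure U `\` interior U.

Definition poisson r z y : R := (r ^+ 2 - sqmod z) / sqmod (y - z).

End plane.

Section potential_theory.
Context {R : realType}.
Implicit Types (U : set (plane R)) (u g : plane R -> R) (z : plane R).

(* The coordinate directions: [false] for the real axis, [true] for the
   imaginary axis. *)
Definition axis (i : bool) : plane R := if i then (0, 1) else (1, 0).

(* The regularity classes below are meant for open [U]. *)
Definition C1_on U u :=
  (forall z, U z -> {for z, continuous u}) /\
  (forall i z, U z -> derivable u z (axis i) /\
                      {for z, continuous ('D_(axis i) u)}).

Definition C2_on U u := C1_on U u /\ forall i, C1_on U ('D_(axis i) u).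

Definition laplacian u z : R :=
  'D_(axis false) ('D_(axis false) u) z + 'D_(axis true) ('D_(axis true) u) z.

Definition harmonic_on U u := C2_on U u /\ forall z, U z -> laplacian u z = 0.

Definition minimal_positive_harmonic U g :=
  [/\ harmonic_on U g,
      forall z, U z -> 0 < g z &
      forall v, harmonic_on U v -> (forall z, U z -> 0 <= v z <= g z) ->
        exists2 c : R, 0 <= c <= 1 & forall z, U z -> v z = c * g z].

(* Meant for bounded [U]: [mu] reproduces at [z] every solution of the
   Dirichlet problem.  When that problem is solvable, as on a disk, exactly one
   Borel probability measure on the boundary does so. *)
Definition is_harmonic_measure U z (mu : probability (plane R) R) :=
  mu (~` boundary U) = 0%E /\
  forall u, {within closure U, continuous u} -> harmonic_on U u ->
    (\int[mu]_(y in boundary U) (u y)%:E = (u z)%:E)%E.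

Definition harmonic_measure U z : probability (plane R) R :=
  get (is_harmonic_measure U z).

(* Quantifying over all families of harmonic measures, instead of using
   [harmonic_measure], gives the right notion also on bounded open sets where
   the Dirichlet problem is not solvable and [is_harmonic_measure] has several
   solutions: for instance a punctured disk is not regular. *)
Definition regular_domain U :=
  [/\ open U, connected U, U !=set0,
      forall z, U z -> exists mu, is_harmonic_measure U z mu &
      forall om : plane R -> probability (plane R) R,
        (forall z, U z -> is_harmonic_measure U z (om z)) ->
        forall (zeta : plane R) (f : plane R -> R), boundary U zeta ->
          measurable_fun (boundary U) f ->
          (exists M : R, forall y, boundary U y -> `|f y| <= M) ->
          f @ within (boundary U) (nbhs zeta) --> f zeta ->
          (\int[om x]_(y in boundary U) (f y)%:E)%E
            @[x --> within U (nbhs zeta)] --> (f zeta)%:E].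

(* [K z] is a version of the density of the harmonic measure at [z] with
   respect to the harmonic measure at the base point [x0]. *)
Definition is_relative_kernel U (x0 : plane R) (K : plane R -> plane R -> R) :=
  forall z, U z ->
    measurable_fun (boundary U) (K z) /\
    forall A, measurable A ->
      harmonic_measure U z A =
      (\int[harmonic_measure U x0]_(y in A `&` boundary U) (K z y)%:E)%E.

Definition locally_uniformly_on U (f : nat -> plane R -> R) g :=
  forall z, U z -> exists2 V, nbhs z V &
    {uniform V, f n @[n --> \oo] --> g}.

End potential_theory.

Section compactification.
Context {R : realType}.
Implicit Types (z : plane R).

Definition hfun z : R := (1 - sqmod z) / sqmod (pt1 - z).

(* The argument of the arctangent is junk, namely 0, on the line Re z = 1,
   which does not meet the open unit disk. *)
Definition jmap z : plane R * R := (z, atan (z.2 / (1 - z.1))).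

Definition Dhat : set (plane R * R) := closure (jmap @` disk 1).

Definition pproj (eta : plane R * R) : plane R := eta.1.

Definition Ffib : set (plane R * R) := Dhat `&` pproj @^-1` [set pt1].

Definition xi (alpha : R) : plane R * R := (pt1, alpha).

Definition Khat z (eta : plane R * R) : R :=
  (1 - sqmod z) / sqmod (pproj eta - z).

(* Weak convergence on [X], for measures on the ambient space that are carried
   by [X]; meant for compact [X], where continuous functions are bounded. *)
Definition weakly_converges_on (X : set (plane R * R))
    (nu : nat -> {measure set (plane R * R) -> \bar R})
    (lambda : {measure set (plane R * R) -> \bar R}) :=
  forall phi : plane R * R -> R, {within X, continuous phi} ->
    (\int[nu n]_(eta in X) (phi eta)%:E)%E @[n --> \oo] -->
    (\int[lambda]_(eta in X) (phi eta)%:E)%E.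

Definition represents_h (mu : {measure set (plane R * R) -> \bar R}) :=
  mu (~` Ffib) = 0%E /\
  forall z, disk 1 z ->
    (\int[mu]_(eta in Ffib) (Khat z eta)%:E = (hfun z)%:E)%E.

Lemma measurable_sqmod : measurable_fun setT (@sqmod R).
Proof. by apply: measurable_funD; apply: measurable_funX. Qed.

Lemma measurable_disk (r : R) : measurable (disk r).
Proof.
rewrite (_ : disk r = setT `&` @sqmod R @^-1` `]-oo, r ^+ 2[); last first.
  by apply/seteqP; split => z; rewrite /disk /= in_itv/=; [|case].
exact: measurable_sqmod.
Qed.

Lemma measurable_fun_invr : measurable_fun setT (@GRing.inv R).
Proof.
have m0 : measurable [set (0 : R)] by exact: measurable_set1.
rewrite -(setvU [set (0 : R)]); apply/measurable_funU => //.
  exact: measurableC.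
split; last exact: measurable_fun_set1.
apply: open_continuous_measurable_fun.
  by rewrite openC; exact: closed_eq.
by move=> x; rewrite inE => /= /eqP x0; exact: inv_continuous.
Qed.

Lemma measurable_hfun : measurable_fun setT hfun.
Proof.
apply: measurable_funM.
  by apply: measurable_funB => //; exact: measurable_sqmod.
apply: (measurableT_comp measurable_fun_invr).
apply: (measurableT_comp measurable_sqmod).
by apply: measurable_fun_pair => /=; exact: measurable_funB.
Qed.

Lemma measurable_jmap : measurable_fun setT jmap.
Proof.
apply: measurable_fun_pair => //=.
apply: (@measurableT_comp _ _ _ _ _ _ (@atan R)).
  by apply: continuous_measurable_fun => x; exact: continuous_atan.
apply: measurable_funM => //=.
apply: (measurableT_comp measurable_fun_invr).
exact: measurable_funB.
Qed.

Lemma measurable_xi : measurable_fun setT xi.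
Proof. exact: measurable_fun_pair. Qed.

Lemma hfun_ge0 z : disk 1 z -> (0 <= (hfun z)%:E)%E.
Proof.
rewrite /disk /= expr1n lee_fin => /ltW z1.
by rewrite divr_ge0 ?subr_ge0// addr_ge0// sqr_ge0.
Qed.

Lemma Npi2_lt_pi2 : - (pi / 2) < pi / 2 :> R.
Proof. by rewrite gtrN// divr_gt0// pi_gt0. Qed.

Section push_forward.
Variable mu : {measure set (plane R) -> \bar R}.

(* The measure h . mu on the unit disk. *)
Definition h_density (A : set (plane R)) : \bar R :=
  (\int[mu]_(z in A `&` disk 1) (hfun z)%:E)%E.

Let h_density0 : h_density set0 = 0%E.
Proof. by rewrite /h_density set0I integral_set0. Qed.

Let h_density_ge0 A : (0 <= h_density A)%E.
Proof. by apply: integral_ge0 => z [_]; exact: hfun_ge0. Qed.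

Let h_density_sigma_additive : semi_sigma_additive h_density.
Proof.
move=> /= A mA tA mUA; rewrite /h_density; apply: cvg_toP.
  apply: ereal_nondecreasing_is_cvgn => m n mn.
  apply: lee_sum_nneg_natr => // k _ _; exact: h_density_ge0.
rewrite setI_bigcupl ge0_integral_bigcup//=.
- by move=> k; apply: measurableI => //; exact: measurable_disk.
- apply: measurable_funTS; apply: measurableT_comp => //.
  exact: measurable_hfun.
- by move=> z [k _ [_]]; exact: hfun_ge0.
- exact: trivIset_setIr.
Qed.

HB.instance Definition _ := isMeasure.Build _ _ _ h_density
  h_density0 h_density_ge0 h_density_sigma_additive.

Definition j_push_h : set (plane R * R) -> \bar R := pushforward h_density jmap.

Let j_push_h0 : j_push_h set0 = 0%E.
Proof. by rewrite /j_push_h /pushforward preimage_set0 measure0. Qed.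

Let j_push_h_ge0 A : (0 <= j_push_h A)%E.
Proof. exact: h_density_ge0. Qed.

Let j_push_h_sigma_additive : semi_sigma_additive j_push_h.
Proof.
apply: (@measure_semi_sigma_additive _ _ _ (pushforward h_density jmap)).
exact: measurable_jmap.
Qed.

HB.instance Definition _ := isMeasure.Build _ _ _ j_push_h
  j_push_h0 j_push_h_ge0 j_push_h_sigma_additive.

End push_forward.

(* Normalized length on the segment {1} x [-pi/2, pi/2]. *)
Definition lambdaF : set (plane R * R) -> \bar R :=
  pushforward (uniform_prob Npi2_lt_pi2) xi.

Let lambdaF0 : lambdaF set0 = 0%E.
Proof. by rewrite /lambdaF /pushforward preimage_set0 measure0. Qed.

Let lambdaF_ge0 A : (0 <= lambdaF A)%E.
Proof. by rewrite /lambdaF /pushforward measure_ge0. Qed.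

Let lambdaF_sigma_additive : semi_sigma_additive lambdaF.
Proof.
apply: (@measure_semi_sigma_additive _ _ _
  (pushforward (uniform_prob Npi2_lt_pi2) xi)).
exact: measurable_xi.
Qed.

HB.instance Definition _ := isMeasure.Build _ _ _ lambdaF
  lambdaF0 lambdaF_ge0 lambdaF_sigma_additive.

End compactification.

(* Main.v *)
Require Import Defs.
From HB Require Import structures.
From mathcomp Require Import all_boot all_order all_algebra.
From mathcomp Require Import all_classical all_reals all_analysis.
From mathcomp Require Import measurable_realfun complex ring lra.

Set Implicit Arguments.
Unset Strict Implicit.
Unset Printing Implicit Defensive.

Import Order.TTheory GRing.Theory Num.Theory.
Import numFieldNormedType.Exports.

Local Open Scope classical_set_scope.
Local Open Scope ring_scope.

(** On the circle of radius r the Poisson kernel is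
<<
  poisson r z y = 2 Re (y / (y - z)) - 1,
>>
    so that a Poisson integral is the real part of a Cauchy integral.  Negative
    powers of y - z have second order Taylor expansions that are uniform in y,
    which makes such integrals smooth in z, with partial derivatives along the
    real and imaginary axes that differ by factors i: their Laplacian vanishes
    ([harmonic_cauchy_integral]).  Together with the total mass 1 of the kernel
    ([integral_poisson]) and its concentration near a boundary point
    ([poisson_integral_cvg]), this solves the Dirichlet problem on a disk.  The
    maximum principle ([max_principle]) shows that there is no other solution,
    hence that every harmonic function that is continuous up to the boundary is
    the Poisson integral of its boundary values ([poisson_representation]).
    Therefore the Poisson kernel times normalized arclength [sigma] is a
    harmonic measure, and it is the only one because it is determined by the
    integrals of continuous functions ([harmonic_measureE]).  Regularity of the
    disk and the formula for the relative kernel are then reformulations.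

    For minimality, let v be harmonic with 0 <= v <= poisson r _ y0.  On the
    circle of radius s < r the function v is at most
    (r ^ 2 - s ^ 2) / |y0 - y| ^ 2, which tends to 0 away from y0 as s tends to
    r, so in the Poisson representation of v on the disk of radius s all the
    mass ends up at y0 ([minimal_representation]).

    For the weak limit, write y = s e^(it).  A primitive of half of
    h(s e^(it)) is t / 2 + a(s e^(it)), and it increases from - pi / 2 to
    pi / 2 over a full turn.  Taking it as a new variable u turns
    h times harmonic measure into du / pi exactly, for every s < 1, and the
    point y becomes [moebius_curve s u] ([integral_j_push_h]).  For a fixed u
    strictly between - pi / 2 and pi / 2 this point tends to 1 while its
    argument a(y) tends to u, so dominated convergence gives the normalized
    length measure of the fibre ([j_push_h_weak_limit]).  In particular every
    neighbourhood of every point of the fibre keeps positive mass.  The points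
    of the circle of radius s that correspond to tan u = q reach the interior
    points of the fibre when q is fixed, and its two end points when q grows
    slower than 1 / (1 - s) ([approach_fibre]).  Along any of these sequences
    the Poisson kernels tend to h because the poles tend to 1
    ([locally_uniform_poisson]).

    Finally, the kernel [Khat z] is constant, equal to h z, on the fibre:
    a measure carried by the fibre represents h exactly when its mass is 1,
    and its projection is then the point mass at 1. *)

(** * Borel sets of the plane and of the product of the plane and the line *)

Section countable_base.

(** The open sets and the sigma-algebra of a product are separate structures on
    the same type; relating a topology to an arbitrary set system lets countable
    bases of measurable sets pass from the line to its products. *)
Definition countably_based (T : topologicalType) (M : set (set T)) :=
  exists B : nat -> set T, (forall n, M (B n)) /\
    forall x U, nbhs x U -> exists n, B n x /\ B n `<=` U.

Lemma countably_based_prod (T1 T2 : topologicalType) (M1 : set (set T1))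
    (M2 : set (set T2)) (M : set (set (T1 * T2))) :
  (forall A B, M1 A -> M2 B -> M (A `*` B)) ->
  countably_based M1 -> countably_based M2 -> countably_based M.
Proof.
move=> MM [B1 [mB1 b1]] [B2 [mB2 b2]].
(* the default value (0, 0) only repeats a set of the base *)
pose idx n := odflt (0%N, 0%N) (@unpickle (nat * nat)%type n).
exists (fun n => B1 (idx n).1 `*` B2 (idx n).2); split => [n|[x y] U].
  exact: MM.
case=> -[U1 U2] [/= /b1[n1 [n1x n1U]] /b2[n2 [n2y n2U]]] UU.
exists (pickle (n1, n2)); rewrite /idx pickleK /=;
  split => // -[a b] [/= na nb].
by apply: UU; split; [exact: n1U|exact: n2U].
Qed.

Lemma countably_based_open (T : topologicalType) (M : set (set T)) :
  M set0 -> (forall F : nat -> set T, (forall n,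
    M (F n)) -> M (\bigcup_n F n)) ->
  countably_based M -> forall U, open U -> M U.
Proof.
move=> M0 MU [B [mB b]] U oU.
pose F n := if `[< B n `<=` U >] then B n else set0.
rewrite (_ : U = \bigcup_n F n); last first.
  apply/seteqP; split => [x Ux|x [n _]].
    have [n [nx nU]] := b _ _ (open_nbhs_nbhs (conj oU Ux)).
    by exists n => //; rewrite /F; case: asboolP.
  by rewrite /F; case: asboolP => // nU /nU.
by apply: MU => n; rewrite /F; case: asboolP.
Qed.

Lemma countably_based_R (R : realType) :
  countably_based (@measurable _ (measurableTypeR R)).
Proof.
pose idx n := odflt (0 : rat, 0%N) (@unpickle (rat * nat)%type n).
exists (fun n => ball (ratr (idx n).1 : R) (idx n).2.+1%:R^-1);
  split => [n|x U].
  exact: measurable_ball.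
move=> /nbhs_ballP[e /= e0 eU].
have [k ke] : exists k : nat, k.+1%:R^-1 < e / 2.
  by have [k kP] := ltr_add_invr (divr_gt0 e0 (ltr0n R 2)); exists k;
    rewrite add0r in kP.
have k0 : (0 : R) < k.+1%:R^-1 by rewrite invr_gt0.
move: ke k0; set d := k.+1%:R^-1 => ke k0.
have xk : x - d < x + d by lra.
have [q] := rat_in_itvoo xk.
rewrite in_itv/= => /andP[q1 q2].
exists (pickle (q, k)); rewrite /idx pickleK /= -/d; split.
  by rewrite /ball/= ltr_norml; apply/andP; split; lra.
move=> y; rewrite /ball/= ltr_norml => /andP[y1 y2]; apply: eU.
by rewrite /ball/= ltr_norml; apply/andP; split; lra.
Qed.

Lemma open_measurable_plane (R : realType) (U : set (plane R)) :
  open U -> measurable U.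
Proof.
apply: (@countably_based_open (R * R)%type measurable) => //.
- exact: bigcupT_measurable.
- apply: (countably_based_prod _ (countably_based_R R) (countably_based_R R)).
  by move=> A B; exact: measurableX.
Qed.

Lemma open_measurable_planeR (R : realType) (U : set (plane R * R)) :
  open U -> measurable U.
Proof.
apply: (@countably_based_open (plane R * R)%type measurable) => //.
- exact: bigcupT_measurable.
- apply: (@countably_based_prod _ _ _ _ _ _ _ (countably_based_R R));
    last first.
    apply: (countably_based_prod _ (countably_based_R R) (countably_based_R R)).
    by move=> A B; exact: measurableX.
  by move=> A B; exact: measurableX.
Qed.

End countable_base.

Section borel.
Context {R : realType}.

Lemma closed_measurable_plane (U : set (plane R)) : closed U -> measurable U.
Proof.
by rewrite -openC => /open_measurable_plane/measurableC; rewrite setCK.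
Qed.

Lemma closed_measurable_planeR (U : set (plane R * R)) : closed U ->
  measurable U.
Proof.
by rewrite -openC => /open_measurable_planeR/measurableC; rewrite setCK.
Qed.

(** Replaces an open set of the subspace topology by a trace of an ambient open
    set, to which measurability of open sets applies. *)
Lemma within_preimage_open (T : topologicalType) (D : set T) (f : T ->
  R) (V : set R) :
  {within D, continuous f} -> open V ->
  exists2 W, open W & D `&` f @^-1` V = D `&` W.
Proof.
move=> cf oV.
have /open_subspaceP[W oW DW] : open (f @^-1` V : set (subspace D)).
  by move/continuousP : cf; apply.
by exists W => //; rewrite setIC -DW setIC.
Qed.

Lemma within_continuous_measurable_plane (D : set (plane R)) (f : plane R ->
  R) :
  measurable D -> {within D, continuous f} -> measurable_fun D f.
Proof.
move=> mD cf; apply: (measurability _ (RGenOpens.measurableE R)).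
move=> _ [_ [a [b ->] <-]].
have [W oW ->] := within_preimage_open cf (@interval_open R (BRight a)
  (BLeft b) isT isT).
by apply: measurableI => //; exact: open_measurable_plane.
Qed.

Lemma within_continuous_measurable_planeR (D : set (plane R * R))
    (f : plane R * R -> R) :
  measurable D -> {within D, continuous f} -> measurable_fun D f.
Proof.
move=> mD cf; apply: (measurability _ (RGenOpens.measurableE R)).
move=> _ [_ [a [b ->] <-]].
have [W oW ->] := within_preimage_open cf (@interval_open R (BRight a)
  (BLeft b) isT isT).
by apply: measurableI => //; exact: open_measurable_planeR.
Qed.

End borel.

(** * Disks and circles *)

Section plane_topology.
Context {R : realType}.
Implicit Types (z y : plane R) (r : R).

Definition circle r : set (plane R) := [set y | sqmod y = r ^+ 2].

Lemma continuous_sqmod : continuous (@sqmod R).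
Proof.
have -> : @sqmod R = (fun z => z.1 * z.1 + z.2 * z.2).
  by apply/funext => z; rewrite /sqmod !expr2.
move=> z.
by apply: cvgD; apply: cvgM; first [exact: cvg_fst|exact: cvg_snd].
Qed.

Lemma sqmod_ge0 z : 0 <= sqmod z.
Proof. by rewrite addr_ge0 ?sqr_ge0. Qed.

Lemma sqmod_gt0 z : (0 < sqmod z) = (z != 0).
Proof.
rewrite lt_def sqmod_ge0 andbT; congr negb; apply/eqP/eqP => [|->]; last first.
  by rewrite /sqmod expr0n/= addr0.
case: z => a b /eqP; rewrite /sqmod/= paddr_eq0 ?sqr_ge0// !sqrf_eq0.
by move=> /andP[/eqP -> /eqP ->].
Qed.

Lemma sqmodZ (t : R) z : sqmod (t *: z) = t ^+ 2 * sqmod z.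
Proof. by rewrite /sqmod/= !exprMn mulrDr. Qed.

Lemma open_disk r : open (disk r).
Proof.
apply: (@open_comp _ _ (@sqmod R) [set x | x < r ^+ 2]) => [z _|].
  exact: continuous_sqmod.
exact: open_lt.
Qed.

Lemma closed_disk_le r : closed [set z : plane R | sqmod z <= r ^+ 2].
Proof.
apply: (@preimage_closed _ _ (@sqmod R) [set x | x <= r ^+ 2]).
  by move=> z _; exact: continuous_sqmod.
exact: closed_le.
Qed.

Lemma cvg_scale z : t *: z @[t --> (1 : R)] --> z.
Proof.
have : t *: z @[t --> (1 : R)] --> 1 *: z.
  by apply: cvgZ; [exact: cvg_id|exact: cvg_cst].
by rewrite scale1r.
Qed.

Lemma closure_disk r : 0 < r -> closure (disk r) = [set z | sqmod z <= r ^+ 2].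
Proof.
move=> r0; apply/seteqP; split.
  rewrite [X in _ `<=` X](closure_id _).1; last exact: closed_disk_le.
  by apply: closure_subset => z /ltW.
move=> z /= zr U zU.
have /nbhs_ballP[e /= e0 eU] := @cvg_scale z _ zU.
pose d := Num.min (e / 2) (1 / 2).
have d0 : 0 < d by rewrite lt_min; apply/andP; split; lra.
have de : d < e by rewrite (@le_lt_trans _ _ (e / 2)) ?ge_min ?lexx//; lra.
have d1 : d <= 1 / 2 by rewrite ge_min lexx orbT.
(* shrinking [z] slightly moves it into the open disk *)
exists ((1 - d) *: z); split.
  rewrite /disk/= sqmodZ.
  have [z0|z0] := eqVneq (sqmod z) 0; first by rewrite z0 mulr0 exprn_gt0.
  rewrite (lt_le_trans _ zr)// -subr_gt0.
  rewrite (_ : _ - _ = sqmod z * (d * (2 - d))); last by ring.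
  have := sqmod_ge0 z; rewrite le_eqVlt eq_sym (negbTE z0)/= => zp.
  by rewrite !mulr_gt0//; lra.
by apply: eU; rewrite /ball/= opprB addrCA subrr addr0 gtr0_norm.
Qed.

Lemma boundary_disk r : 0 < r -> boundary (disk r) = circle r.
Proof.
move=> r0; rewrite /boundary closure_disk// (interior_id _).1;
  last exact: open_disk.
apply/seteqP; split => z; rewrite /disk/circle/=.
  by move=> [zr /negP]; rewrite -leNgt => rz; apply/eqP; rewrite eq_le zr.
by move=> ->; rewrite lexx ltxx.
Qed.

Lemma compact_closure_disk r : 0 < r -> compact (closure (disk r) : set
  (plane R)).
Proof.
move=> r0.
have cpt : compact ((`[-r, r] `*` `[-r, r])%classic : set (plane R)).
  by apply: compact_setX; exact: segment_compact.
apply: (subclosed_compact _ cpt); first exact: closed_closure.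
rewrite closure_disk// => -[a b]; rewrite /sqmod/= => abr.
by split => /=; rewrite in_itv/= -ler_norml -(@ler_pXn2r _ 2)// ?nnegrE ?(ltW
  r0)//
  real_normK ?num_real// (le_trans _ abr)// ?lerDl ?lerDr ?sqr_ge0.
Qed.

Lemma origin_disk r : 0 < r -> disk r (@origin R).
Proof. by move=> r0; rewrite /disk/sqmod/= expr0n/= addr0 exprn_gt0. Qed.

Lemma connected_disk r : 0 < r -> connected (disk r : set (plane R)).
Proof.
move=> r0.
rewrite (_ : disk r = \bigcup_(z in disk r) ((fun t : R => t *: z) @` `[0, 1])).
  apply: bigcup_connected.
    exists 0 => z zr; exists 0; rewrite ?scale0r//=.
    by rewrite in_itv/= lexx ler01.
  move=> z zr; apply: connected_continuous_connected.
    exact: segment_connected.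
  apply: continuous_subspaceT => t.
  by apply: cvgZ; [exact: cvg_id|exact: cvg_cst].
apply/seteqP; split => [z zr|z [y yr [t /=]]].
  by exists z => //; exists 1; rewrite ?scale1r//= in_itv/= lexx ler01.
rewrite in_itv/= => /andP[t0 t1] <-; rewrite /disk/= sqmodZ.
apply: le_lt_trans yr; rewrite -[leRHS]mul1r ler_wpM2r ?sqmod_ge0//.
by rewrite -[leRHS](expr1n _ 2) lerXn2r ?nnegrE.
Qed.

Lemma measurable_circle r : measurable (circle r).
Proof.
apply: closed_measurable_plane.
apply: (@preimage_closed _ _ (@sqmod R) [set x | x = r ^+ 2]).
  by move=> z _; exact: continuous_sqmod.
exact: closed_eq.
Qed.

Lemma disk_circle_neq r z y : disk r z -> circle r y -> y - z != 0.
Proof.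
move=> zr yr; rewrite subr_eq0; apply/eqP => yz.
by move: zr; rewrite /disk/= -yz yr ltxx.
Qed.

(** The triangle inequality |y| - |z| <= |y - z|, squared; it amounts to the
    Cauchy-Schwarz inequality. *)
Lemma sqmod_dist r z y : 0 < r -> circle r y ->
  (r - Num.sqrt (sqmod z)) ^+ 2 <= sqmod (y - z).
Proof.
move=> r0 yr; set q := Num.sqrt _.
have q2 : q ^+ 2 = sqmod z by rewrite sqr_sqrtr// sqmod_ge0.
have cs : y.1 * z.1 + y.2 * z.2 <= r * q.
  have rq0 : 0 <= r * q by rewrite mulr_ge0 ?sqrtr_ge0// ltW.
  have [|lt0] := leP 0 (y.1 * z.1 + y.2 * z.2);
    last by rewrite (le_trans (ltW lt0)).
  move=> p0; rewrite -(@ler_pXn2r _ 2)// exprMn q2 -yr /sqmod -subr_ge0.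
  rewrite (_ : _ - _ = (y.1 * z.2 - y.2 * z.1) ^+ 2) ?sqr_ge0//; by ring.
rewrite sqrrB q2 -yr -subr_ge0 /sqmod/=.
rewrite (_ : _ - _ = (r * q - (y.1 * z.1 + y.2 * z.2)) *+ 2); last by ring.
by rewrite mulrn_wge0// subr_ge0.
Qed.

Lemma sqmod_near_lt z (e : R) : 0 < e -> \forall w \near z, sqmod (w - z) < e.
Proof.
move=> e0.
have : sqmod (w - z) @[w --> z] --> sqmod (z - z).
  have wz : w - z @[w --> z] --> z - z by apply: cvgB;
    [exact: cvg_id|exact: cvg_cst].
  apply: (cvg_comp (fun w : plane R => w - z) (@sqmod R) wz).
  exact: continuous_sqmod.
by rewrite subrr {2}/sqmod expr0n/= addr0 => /cvgr_lt; apply.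
Qed.

End plane_topology.

(** * Integration against an image of a measure with a density *)

Section change_of_variables.
Context d1 d2 (T : measurableType d1) (S : measurableType d2) (R : realType).
Variables (mu : {measure set T -> \bar R}) (nu : {measure set S -> \bar R}).
Variables (J : T -> S) (D : set T) (g : T -> R).
Hypotheses (mJ : measurable_fun setT J) (mD : measurable D).
Hypotheses (mg : measurable_fun D g) (g0 : forall x, D x -> 0 <= g x).
Hypothesis nuE : forall A, measurable A ->
  nu A = (\int[mu]_(x in J @^-1` A `&` D) (g x)%:E)%E.

Let mJD E : measurable E -> measurable (J @^-1` E `&` D).
Proof. by move=> mE; apply: measurableI => //;
  rewrite -[X in measurable X]setTI; exact: mJ. Qed.

Let mgE E : measurable E -> measurable_fun (J @^-1` E `&` D) (fun x =>
  (g x)%:E).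
Proof.
move=> mE; apply/measurable_EFinP; apply: measurable_funS mg => //.
Qed.

Import HBNNSimple.

(** The formula holds by hypothesis for indicators, hence for simple functions,
    hence for increasing limits of these.  It contains at the same time the
    integral against an image measure ([g] constant) and the integral against
    a measure with a density ([J] the identity). *)
Lemma ge0_integral_transfer E (f : S -> \bar R) : measurable E ->
  (forall y, E y -> 0 <= f y)%E -> measurable_fun E f ->
  (\int[nu]_(y in E) f y = \int[mu]_(x in J @^-1` E `&` D) (f (J x) *
    (g x)%:E))%E.
Proof.
move=> mE f0 mf; pose h := nnsfun_approx mE mf.
have mJE := mJD mE.
have mhJ n : measurable_fun (J @^-1` E `&` D) (fun x => (h n (J x))%:E).
  apply/measurable_EFinP; apply: measurable_funTS.
  by apply: (measurableT_comp _ mJ); exact: measurable_funPT.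
have -> : (\int[nu]_(y in E) f y =
    lim (\int[nu]_(y in E) (EFin \o h n) y @[n --> \oo]))%E.
  have fE y : E y -> f y = lim ((EFin \o h n) y @[n --> \oo]).
    by move=> Ey; apply/esym/cvg_lim => //; exact: cvg_nnsfun_approx.
  under eq_integral => y /[!inE] /fE -> //.
  apply: monotone_convergence => //.
  - move=> n; apply/measurable_EFinP/measurable_funTS; exact: measurable_funPT.
  - by move=> n y Ey //=; rewrite lee_fin.
  - by move=> y Ey a b ab; rewrite lee_fin; exact/lefP/nd_nnsfun_approx.
have -> : (\int[mu]_(x in J @^-1` E `&` D) (f (J x) * (g x)%:E) =
    lim (\int[mu]_(x in J @^-1` E `&` D) ((h n (J x))%:E *
      (g x)%:E) @[n --> \oo]))%E.
  have fg x : (J @^-1` E `&` D) x ->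
      (f (J x) * (g x)%:E = lim ((h n (J x))%:E * (g x)%:E @[n --> \oo]))%E.
    move=> [Ex Dx]; apply/esym/cvg_lim => //; apply: cvgeZr => //.
    exact: cvg_nnsfun_approx.
  under eq_integral => x /[!inE] /fg -> //.
  apply: monotone_convergence => //.
  - by move=> n; apply: emeasurable_funM => //; exact: mgE.
  - by move=> n x [Ex Dx] /=; rewrite mule_ge0 ?lee_fin ?g0.
  - move=> x [Ex Dx] a b ab/=; rewrite lee_wpmul2r ?lee_fin ?g0//.
    exact/lefP/nd_nnsfun_approx.
suff suf n : (\int[nu]_(y in E) (EFin \o h n) y =
    \int[mu]_(x in J @^-1` E `&` D) ((h n (J x))%:E * (g x)%:E))%E.
  by under eq_fun do rewrite suf.
transitivity (\int[nu]_(x in E)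
   (\sum_(y \in range (h n)) (y * \1_(h n @^-1` [set y]) x)%:E))%E.
  by apply: eq_integral => t tE; rewrite /= fimfunE -fsumEFin.
have indich r : measurable_fun E (fun x => (r * \1_(h n @^-1` [set r]) x)%:E).
  by apply: (measurable_comp measurableT) => //; exact: measurable_funM.
rewrite ge0_integral_fsum//; last by move=> y x Ex; exact: nnfun_muleindic_ge0.
transitivity (\int[mu]_(x in J @^-1` E `&` D) (\sum_(y \in range (h n))
    ((y * \1_(h n @^-1` [set y]) (J x))%:E * (g x)%:E)))%E; last first.
  apply: eq_integral => x xE.
  rewrite -ge0_mule_fsuml => [|y]; last exact: nnfun_muleindic_ge0.
  by rewrite fsumEFin // -(fimfunE _ (J x)).
have mind y : measurable_fun (J @^-1` E `&` D)
    (fun x => (y * \1_(h n @^-1` [set y]) (J x))%:E).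
  apply: measurable_funTS.
  apply: (@measurableT_comp _ _ _ _ _ _ (fun x =>
    (y * \1_(h n @^-1` [set y]) x)%:E)) => //.
  by apply/measurable_EFinP; apply: measurable_funM => //;
    exact: measurable_indic.
rewrite ge0_integral_fsum//; last 2 first.
  - by move=> y; apply: emeasurable_funM => //; exact: mgE.
  - by move=> y x [Ey Dy]; apply: mule_ge0; [exact:
      nnfun_muleindic_ge0|rewrite lee_fin g0].
apply: eq_fsbigr => r rhn.
have r0 : 0 <= r by move: rhn; rewrite inE => -[t _ <-].
have mr : measurable (h n @^-1` [set r]) by [].
rewrite integralZl_indic_nnsfun// integral_indic// nuE; last exact: measurableI.
rewrite (_ : _ `&` D = (J @^-1` E `&` D) `&` J @^-1` (h n @^-1` [set r]));
  last first.
  by apply/seteqP; split => x /= [[]].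
rewrite integral_mkcondr.
under [RHS]eq_integral do rewrite EFinM -muleA.
rewrite ge0_integralZl//; last 2 first.
- apply: emeasurable_funM; last exact: mgE.
  apply/measurable_EFinP; apply: measurable_funTS.
  by apply: measurableT_comp => //; exact: measurable_indic.
- by move=> x [_ Dx]; rewrite mule_ge0 ?lee_fin ?g0.
congr (_ * _)%E; apply: eq_integral => x _.
rewrite patchE indicE /=; case: ifPn => [/set_mem xr|].
  by rewrite mem_set// mul1e.
by rewrite notin_setE => xr; rewrite memNset// mul0e.
Qed.

Lemma integral_transfer E (f : S -> R) : measurable E -> measurable_fun E f ->
  (\int[nu]_(y in E) (f y)%:E =
   \int[mu]_(x in J @^-1` E `&` D) (f (J x) * g x)%:E)%E.
Proof.
move=> mE mf; have mf' : measurable_fun E (EFin \o f) by exact/measurable_EFinP.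
rewrite [LHS]integralE [RHS]integralE; congr (_ - _)%E.
- rewrite ge0_integral_transfer//; last exact: measurable_funepos.
  apply: eq_integral => x /[!inE] -[_ Dx]; rewrite !funeposE /= !EFinM.
  by rewrite maxe_pMl ?lee_fin ?g0// mul0e.
- rewrite ge0_integral_transfer//; last exact: measurable_funeneg.
  apply: eq_integral => x /[!inE] -[_ Dx]; rewrite !funenegE /= -mulNr EFinM.
  by rewrite maxe_pMl ?lee_fin ?g0// mul0e.
Qed.

End change_of_variables.

(** * Bounded functions and approximate identities *)

Section bounded_functions.
Context d (T : measurableType d) (R : realType).
Variable mu : probability T R.
Implicit Types (D N : set T) (f w : T -> R).

Lemma bounded_integrable D f (M : R) : measurable D -> measurable_fun D f ->
  (forall x, D x -> `|f x| <= M) -> mu.-integrable D (EFin \o f).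
Proof.
move=> mD mf fM; apply: measurable_bounded_integrable => //.
  by rewrite (le_lt_trans (probability_le1 _ _))// ltry.
exists M; split; first exact: num_real.
by move=> x Mx y Dy; apply: (le_trans (fM _ Dy)); exact: ltW.
Qed.

Lemma fine_probability_le1 D : measurable D -> fine (mu D) <= 1.
Proof.
by move=> mD; rewrite -lee_fin fineK ?fin_num_measure// probability_le1.
Qed.

Lemma bounded_Rintegral_le D f (M : R) : measurable D -> measurable_fun D f ->
  0 <= M -> (forall x, D x -> `|f x| <= M) -> `|\int[mu]_(x in D) f x| <= M.
Proof.
move=> mD mf M0 fM; have intf := bounded_integrable mD mf fM.
rewrite (le_trans (le_normr_Rintegral mD intf))//.
rewrite (@le_trans _ _ (\int[mu]_(x in D) M))//.
  apply: le_Rintegral => //.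
  - apply: (@bounded_integrable _ _ M) => //; first exact: measurableT_comp.
    by move=> x Dx; rewrite normr_id fM.
  - by apply: (@bounded_integrable _ _ M) => // x Dx; rewrite ger0_norm.
by rewrite Rintegral_cst// ler_piMr// fine_probability_le1.
Qed.

(** The weight [w] puts little mass off [N], and [f] is close to [c] on [N]:
    pointwise, |f - c| w <= e w + M eta. *)
Lemma approximate_identity D N f w (c e eta M W : R) :
  measurable D -> measurable_fun D f -> measurable_fun D w ->
  0 <= e -> 0 <= eta -> 0 <= M ->
  (forall x, D x -> 0 <= w x <= W) ->
  (forall x, D x -> `|f x - c| <= M) ->
  (forall x, D x -> N x -> `|f x - c| <= e) ->
  (forall x, D x -> ~ N x -> w x <= eta) ->
  `|\int[mu]_(x in D) (f x * w x) - c * \int[mu]_(x in D) w x| <=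
    e * \int[mu]_(x in D) w x + M * eta.
Proof.
move=> mD mf mw e0 eta0 M0 wW fM fe weta.
have wb x : D x -> `|w x| <= W by move=> /wW /andP[w0 ?]; rewrite ger0_norm.
have mfc : measurable_fun D (fun x => f x - c) by exact: measurable_funB.
have fb x : D x -> `|f x| <= M + `|c|.
  by move=> Dx; rewrite -[f x](subrK c) (le_trans (ler_normD _ _))// lerD2r fM.
have intw : mu.-integrable D (EFin \o w) by exact: bounded_integrable wb.
have intfw : mu.-integrable D (EFin \o (fun x => f x * w x)).
  apply: (@bounded_integrable _ _ ((M + `|c|) * W)) => //.
    exact: measurable_funM.
  by move=> x Dx; rewrite normrM ler_pM// ?fb ?wb.
have intfcw : mu.-integrable D (EFin \o (fun x => (f x - c) * w x)).
  apply: (@bounded_integrable _ _ (M * W)) => //.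
    exact: measurable_funM.
  by move=> x Dx; rewrite normrM ler_pM// ?fM ?wb.
rewrite -RintegralZl// -RintegralB//; last first.
  apply: (@bounded_integrable _ _ (`|c| * W)) => //.
    exact: measurable_funM.
  by move=> x Dx; rewrite normrM ler_pM// wb.
under eq_Rintegral do rewrite -mulrBl.
rewrite (le_trans (le_normr_Rintegral mD intfcw))//.
have intew : mu.-integrable D (EFin \o (fun x => e * w x)).
  apply: (@bounded_integrable _ _ (`|e| * W)) => //.
    exact: measurable_funM.
  by move=> x Dx; rewrite normrM ler_pM// wb.
have intM : mu.-integrable D (EFin \o (fun=> M * eta)).
  by apply: (@bounded_integrable _ _ `|M * eta|).
rewrite (@le_trans _ _ (\int[mu]_(x in D) (e * w x + M * eta)))//.
  apply: le_Rintegral => //.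
  - apply: (@bounded_integrable _ _ (M * W)) => //.
      by apply: measurableT_comp => //; exact: measurable_funM.
    by move=> x Dx; rewrite normr_id normrM ler_pM// ?fM ?wb.
  - have -> : EFin \o (fun x => e * w x + M * eta) =
      ((EFin \o (fun x => e * w x)%R) \+ (EFin \o (fun=> M * eta)%R))%E by [].
    exact: integrableD.
  - move=> x Dx; have /andP[w0 _] := wW _ Dx.
    rewrite normrM (ger0_norm w0).
    have [Nx|nNx] := pselect (N x).
      rewrite (@le_trans _ _ (e * w x))//; first by rewrite ler_wpM2r// fe.
      by rewrite lerDl mulr_ge0.
    rewrite (@le_trans _ _ (M * eta))//; first by rewrite ler_pM// ?fM ?weta.
    by rewrite lerDr mulr_ge0.
rewrite RintegralD// RintegralZl// lerD2l Rintegral_cst//.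
by rewrite ler_piMr ?mulr_ge0// fine_probability_le1.
Qed.

End bounded_functions.

(** * Normalized arclength *)

Section normalized_arclength.
Context {R : realType}.

Definition circ (s t : R) : plane R := (s * cos t, s * sin t).

Lemma Npi_lt_pi : - pi < pi :> R.
Proof. by rewrite gtrN// pi_gt0. Qed.

Lemma measurable_circ (s : R) : measurable_fun setT (circ s).
Proof.
by apply: measurable_fun_pair => /=; apply: measurable_funM => //;
  apply: continuous_measurable_fun => x; [exact: continuous_cos|exact:
    continuous_sin].
Qed.

Lemma circ_circle (s t : R) : circle s (circ s t).
Proof. by rewrite /circle/sqmod/= !exprMn -mulrDr cos2Dsin2 mulr1. Qed.

(** Normalized arclength on the circle of radius [s]. *)
Definition sigma (s : R) : set (plane R) -> \bar R :=
  pushforward (uniform_prob Npi_lt_pi) (circ s).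

Section sigma_measure.
Variable s : R.

Let sigma0 : sigma s set0 = 0%E.
Proof. by rewrite /sigma /pushforward preimage_set0 measure0. Qed.

Let sigma_ge0 A : (0 <= sigma s A)%E.
Proof. by rewrite /sigma /pushforward measure_ge0. Qed.

Let sigma_sigma_additive : semi_sigma_additive (sigma s).
Proof.
apply: (@measure_semi_sigma_additive _ _ _
  (pushforward (uniform_prob Npi_lt_pi) (circ s))).
exact: measurable_circ.
Qed.

HB.instance Definition _ := isMeasure.Build _ _ _ (sigma s)
  sigma0 sigma_ge0 sigma_sigma_additive.

Let sigmaT : sigma s setT = 1%E.
Proof. by rewrite /sigma/pushforward preimage_setT probability_setT. Qed.

HB.instance Definition _ := Measure_isProbability.Build _ _ _ (sigma s) sigmaT.

End sigma_measure.

Lemma sigma_circleC (s : R) : sigma s (~` circle s) = 0%E.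
Proof.
rewrite /sigma/pushforward (_ : _ @^-1` _ = set0) ?measure0//.
by apply/seteqP; split => // t /=; apply; exact: circ_circle.
Qed.

Lemma uniform_probE (a b : R) (ab : a < b) A : measurable A ->
  uniform_prob ab A =
  (\int[lebesgue_measure]_(x in A `&` `[a, b]) ((b - a)^-1)%:E)%E.
Proof.
move=> mA; rewrite /uniform_prob integral_uniform_pdf.
apply: eq_integral => x /[!inE] -[_ /=]; rewrite in_itv/= /uniform_pdf => ->//.
Qed.

Lemma integral_sigma (s : R) (E : set (plane R)) (f : plane R -> R) :
  measurable E -> measurable_fun E f ->
  (\int[sigma s]_(y in E) (f y)%:E =
   \int[lebesgue_measure]_(t in circ s @^-1` E `&` [set` `[- pi, pi]%R])
     (f (circ s t) * (pi *+ 2)^-1)%:E)%E.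
Proof.
move=> mE mf; apply: (@integral_transfer _ _ _ _ _ lebesgue_measure
  (sigma s)) => //.
- exact: measurable_circ.
- by move=> x _; rewrite invr_ge0 mulrn_wge0// pi_ge0.
- move=> A mA; rewrite -[LHS]/(uniform_prob Npi_lt_pi (circ s @^-1` A)).
  rewrite uniform_probE ?opprK -?mulr2n//.
  by rewrite -[X in measurable X]setTI; exact: measurable_circ.
Qed.

End normalized_arclength.

Import Normc.
Local Notation Re := (@complex.Re _).
Local Notation Im := (@complex.Im _).

(** * Complex moduli *)

Section complex_modulus.
Context {R : realType}.
Implicit Types (x y : R[i]) (z w : plane R).

Definition cplx z : R[i] := Complex z.1 z.2.

Lemma normc_cplx z : normc (cplx z) = Num.sqrt (sqmod z).
Proof. by []. Qed.

Lemma cplxB z w : cplx (z - w) = cplx z - cplx w.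
Proof. by []. Qed.

Lemma cplxZ (t : R) z : cplx (t *: z) = (t%:C)%C * cplx z.
Proof.
by apply/eqP; rewrite eq_complex /= !mul0r subr0 addr0 !eqxx.
Qed.

Lemma normc_ge0 x : 0 <= normc x.
Proof. by case: x => a b /=; exact: sqrtr_ge0. Qed.

Lemma normc_triangle x y : normc (x + y) <= normc x + normc y.
Proof. exact: (@le_normcD R x y). Qed.

Lemma normc_nat (n : nat) : normc (n%:R : R[i]) = n%:R.
Proof.
have -> : (n%:R : R[i]) = (n%:R)%:C%C by rewrite rmorph_nat.
by rewrite /= expr0n/= addr0 sqrtr_sqr ger0_norm.
Qed.

Lemma normc_real (t : R) : normc (t%:C)%C = `|t|.
Proof. by rewrite /= expr0n/= addr0 sqrtr_sqr. Qed.

Lemma normcX x n : normc (x ^+ n) = normc x ^+ n.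
Proof. by elim: n => [|n IHn]; rewrite ?expr0 ?normc1// !exprS normcM IHn. Qed.

Lemma normr_Re_le x : `|Re x| <= normc x.
Proof.
by case: x => a b /=; rewrite -sqrtr_sqr ler_wsqrtr// lerDl sqr_ge0.
Qed.

End complex_modulus.

(** * Second order expansion of negative powers *)

Section taylor_remainder.
Context {R : realType}.
Implicit Types (x y d : R[i]).

(** The quotient by [d ^+ 2] of the remainder in the first order expansion in
    [d] of (a - d) ^ (- m), as a polynomial in x = 1 / (a - d) and y = 1 / a; it
    stays bounded as long as [x] and [y] do. *)
Fixpoint taylor_rest (m : nat) x y : R[i] :=
  if m is m'.+1 then x * taylor_rest m' x y + m%:R * (x * y ^+ m'.+2) else 0.

(** The hypothesis is the resolvent identity between x = 1 / (a - d) and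
    y = 1 / a. *)
Lemma taylor_restP m x y d : x - y = d * (x * y) ->
  x ^+ m - y ^+ m - m%:R * d * y ^+ m.+1 = d ^+ 2 * taylor_rest m x y.
Proof.
move=> xy; elim: m => [|m IH] /=; first by rewrite !expr0 !mul0r mulr0 subrr
  subr0.
have -> : d ^+ 2 * (x * taylor_rest m x y + m.+1%:R * (x * y ^+ m.+2)) =
    x * (d ^+ 2 * taylor_rest m x y) + m.+1%:R * d * y ^+ m.+1 * (d * (x * y)).
  by rewrite [y ^+ m.+2]exprS; ring.
rewrite -IH -xy -natr1 !exprS; apply/eqP; rewrite -subr_eq0.
rewrite [X in X == 0](_ : _ = y ^+ m * (x - y - d * (x * y))); last by ring.
by rewrite xy subrr mulr0.
Qed.

Lemma taylor_rest_bound m (M : R) : exists2 C : R, 0 <= C &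
  forall x y, normc x <= M -> normc y <= M -> normc (taylor_rest m x y) <= C.
Proof.
elim: m => [|m [C C0 IH]] /=.
  by exists 0 => [//|x y _ _]; rewrite -[leLHS]/(normc 0) [leLHS]normc0.
exists (`|M| * C + m.+1%:R * (`|M| * `|M| ^+ m.+2)).
  by rewrite addr_ge0// mulr_ge0// mulr_ge0// exprn_ge0.
move=> x y xM yM.
have xM' : normc x <= `|M| by rewrite (le_trans xM)// ler_norm.
have yM' : normc y <= `|M| by rewrite (le_trans yM)// ler_norm.
rewrite (le_trans (normc_triangle _ _))// lerD//.
  by rewrite normcM ler_pM ?normc_ge0// IH.
rewrite normcM normc_nat normcM normcX ler_wpM2l// ler_pM ?normc_ge0//.
  by rewrite exprn_ge0 ?normc_ge0.
by rewrite lerXn2r ?nnegrE ?normc_ge0.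
Qed.

End taylor_remainder.

Section quadratic_estimate.
Context {R : realType}.

(** An error term of second order gives the derivative without exchanging a
    limit and an integral. *)
Lemma is_derive_quadratic (f : plane R -> R) z v (L C d : R) : 0 < d ->
  0 <= C ->
  (forall h, `|h| < d -> `|f (h *: v + z) - f z - h * L| <= C * h ^+ 2) ->
  is_derive z v f L.
Proof.
move=> d0 C0 fC.
have fL : h^-1 *: ((f \o shift z) (h *: v) - f z) @[h --> 0^'] --> L.
  apply/cvgrPdist_le => e e0.
  have eC : 0 < e / (C + 1) by rewrite divr_gt0// ltr_wpDl.
  near=> h; have h0 : h != 0 by near: h; exact: nbhs_dnbhs_neq.
  have hd : `|h| < d.
    by near: h; exact: dnbhs0_lt.
  have he : `|h| < e / (C + 1).
    by near: h; exact: dnbhs0_lt.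
  have -> : L - h^-1 *: ((f \o shift z) (h *: v) - f z) =
            - (h^-1 * (f (h *: v + z) - f z - h * L)).
    by rewrite /= /GRing.scale/=; field.
  rewrite normrN normrM normfV.
  rewrite ler_pdivrMl ?normr_gt0// (le_trans (fC _ hd))// -real_normK
    ?num_real//.
  rewrite expr2 mulrCA ler_wpM2l// (le_trans (ler_wpM2l C0 (ltW he)))//.
  rewrite mulrCA ler_piMr ?(ltW e0)// ler_pdivrMr ?mul1r ?lerDl//.
  by rewrite ltr_wpDl.
apply: DeriveDef; first by apply/cvg_ex; exists L.
exact: cvg_lim fL.
Unshelve. all: by end_near. Qed.

Lemma normc_near_lt (z : plane R) (e : R) : 0 < e ->
  \forall w \near z, normc (cplx (w - z)) < e.
Proof.
move=> e0; have := sqmod_near_lt z (exprn_gt0 2 e0); apply: filterS => w we.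
rewrite normc_cplx -(ltr_pXn2r (n := 2)) ?nnegrE ?sqrtr_ge0 ?(ltW e0)//.
by rewrite sqr_sqrtr// sqmod_ge0.
Qed.

End quadratic_estimate.

(** * Harmonicity is local and linear *)

Section locality.
Context {R : realType}.
Implicit Types (U : set (plane R)) (u v : plane R -> R).

Lemma near_open U (P : plane R -> Prop) z : open U -> U z ->
  (forall w, U w -> P w) -> \forall w \near z, P w.
Proof.
move=> oU Uz UP; apply: (filterS UP); exact: open_nbhs_nbhs.
Qed.

Lemma continuous_eq_on U u v z : open U -> (forall w, U w -> u w = v w) ->
  U z -> {for z, continuous u} -> {for z, continuous v}.
Proof.
move=> oU uv Uz cu; have : v w @[w --> z] --> v z by
  rewrite -(uv _ Uz); apply: cvg_trans cu; apply: near_eq_cvg;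
    apply: (near_open oU Uz) => w /uv.
by [].
Qed.

Lemma derive_eq_on U u v z i : open U -> (forall w, U w -> u w = v w) ->
  U z -> 'D_i u z = 'D_i v z.
Proof. by move=> oU uv Uz; apply: near_eq_derive; exact: (near_open oU Uz). Qed.

Lemma C1_eq_on U u v : open U -> (forall w, U w -> u w = v w) ->
  C1_on U u -> C1_on U v.
Proof.
move=> oU uv [cu du]; split=> [z Uz|i z Uz].
  exact: (continuous_eq_on oU uv Uz (cu z Uz)).
have [duz cduz] := du i z Uz; split.
  by apply: near_eq_derivable duz; exact: (near_open oU Uz).
apply: (continuous_eq_on oU _ Uz cduz) => w Uw; exact: derive_eq_on oU uv Uw.
Qed.

Lemma harmonic_eq_on U u v : open U -> (forall w, U w -> u w = v w) ->
  harmonic_on U u -> harmonic_on U v.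
Proof.
move=> oU uv [[Cu CDu] lu]; split; first split.
- exact: C1_eq_on oU uv Cu.
- move=> i; apply: (C1_eq_on oU _ (CDu i)) => w Uw;
    exact: derive_eq_on oU uv Uw.
- move=> z Uz; rewrite -(lu z Uz) /laplacian.
  have uvD i w : U w -> 'D_(axis i) v w = 'D_(axis i) u w.
    by move=> Uw; apply: (derive_eq_on _ oU _ Uw) => t /uv.
  by rewrite (derive_eq_on (axis false) oU (uvD false) Uz)
    (derive_eq_on (axis true) oU (uvD true) Uz).
Qed.

Lemma derive_sub U u v i z : C1_on U u -> C1_on U v -> U z ->
  'D_(axis i) (fun w => u w - v w) z = 'D_(axis i) u z - 'D_(axis i) v z.
Proof.
move=> [_ du] [_ dv] Uz; have [duz _] := du i z Uz; have [dvz _] := dv i z Uz.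
exact: (deriveB duz dvz).
Qed.

Lemma C1_sub U u v : open U -> C1_on U u -> C1_on U v -> C1_on U (fun z =>
  u z - v z).
Proof.
move=> oU C1u C1v; have [cu du] := C1u; have [cv dv] := C1v.
split=> [z Uz|i z Uz].
  exact: (cvgB (cu z Uz) (cv z Uz)).
have [duz cduz] := du i z Uz; have [dvz cdvz] := dv i z Uz; split.
  exact: (derivableB duz dvz).
apply: (continuous_eq_on oU _ Uz (cvgB cduz cdvz)) => w Uw.
exact/esym/(derive_sub _ C1u C1v).
Qed.

Lemma harmonic_sub U u v : open U -> harmonic_on U u -> harmonic_on U v ->
  harmonic_on U (fun z => u z - v z).
Proof.
move=> oU [[Cu CDu] lu] [[Cv CDv] lv].
have DB i w : U w -> 'D_(axis i) u w - 'D_(axis i) v w =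
    'D_(axis i) (fun w => u w - v w) w by move=> Uw;
      rewrite (derive_sub _ Cu Cv).
split; first split.
- exact: C1_sub.
- by move=> i; exact: (C1_eq_on oU (DB i) (C1_sub oU (CDu i) (CDv i))).
- move=> z Uz; have -> : 0 = laplacian u z - laplacian v z by rewrite lu//
    lv// subrr.
  rewrite /laplacian opprD addrACA; congr (_ + _).
    rewrite -(derive_sub _ (CDu false) (CDv false))//;
      apply: (derive_eq_on _ oU _ Uz).
    by move=> w Uw; rewrite DB.
  rewrite -(derive_sub _ (CDu true) (CDv true))//;
    apply: (derive_eq_on _ oU _ Uz).
  by move=> w Uw; rewrite DB.
Qed.

Lemma harmonic_subset U V u : V `<=` U -> harmonic_on U u -> harmonic_on V u.
Proof.
move=> VU [[Cu CDu] lu].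
have C1s w : C1_on U w -> C1_on V w.
  by case=> cw dw; split=> [z /VU/cw//|i z /VU/dw//].
split; last by move=> z /VU; exact: lu.
by split => [|i]; [exact: (C1s _ Cu)|exact: (C1s _ (CDu i))].
Qed.

End locality.

(** * Cauchy integrals on a circle *)

Section complex_measurable.
Context d (T : measurableType d) (R : realType).
Implicit Types (D : set T) (f g : T -> R[i]).

Definition cmeasurable D f :=
  measurable_fun D (fun t => Re (f t)) /\ measurable_fun D (fun t => Im (f t)).

Lemma cmeasurable_cst D (a : R[i]) : cmeasurable D (fun=> a).
Proof. by split; exact: measurable_cst. Qed.

Lemma cmeasurableM D f g : cmeasurable D f -> cmeasurable D g ->
  cmeasurable D (fun t => f t * g t).
Proof.
move=> [mf1 mf2] [mg1 mg2]; split.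
  rewrite (_ : (fun t => Re _) = (fun t => Re (f t) * Re (g t) - Im
    (f t) * Im (g t))).
    by apply: measurable_funB; exact: measurable_funM.
  by apply/funext => t; case: (f t); case: (g t).
rewrite (_ : (fun t => Im _) = (fun t => Re (f t) * Im (g t) + Im (f t) * Re
  (g t))).
  by apply: measurable_funD; exact: measurable_funM.
by apply/funext => t; case: (f t); case: (g t).
Qed.

Lemma cmeasurableV D f : cmeasurable D f -> cmeasurable D (fun t => (f t)^-1).
Proof.
move=> [mf1 mf2].
have mn : measurable_fun D (fun t => (Re (f t) ^+ 2 + Im (f t) ^+ 2)^-1).
  apply: (measurableT_comp measurable_fun_invr).
  by apply: measurable_funD; exact: measurable_funX.
split.
  rewrite (_ : (fun t => Re _) = (fun t => Re (f t) * (Re (f t) ^+ 2 + Im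
    (f t) ^+ 2)^-1)).
    exact: measurable_funM.
  by apply/funext => t; case: (f t).
rewrite (_ : (fun t => Im _) = (fun t => - (Im (f t) * (Re (f t) ^+ 2 + Im
  (f t) ^+ 2)^-1))).
  by apply: measurableT_comp => //; exact: measurable_funM.
by apply/funext => t; case: (f t) => a b.
Qed.

Lemma cmeasurableX D f m : cmeasurable D f -> cmeasurable D (fun t => f t ^+ m).
Proof.
move=> mf; elim: m => [|m IH]; first exact: cmeasurable_cst.
rewrite (_ : (fun t => _) = (fun t => f t * f t ^+ m));
  first exact: cmeasurableM.
by apply/funext => t; rewrite exprS.
Qed.

End complex_measurable.

Section cauchy_integrals.
Context {R : realType}.
Variables (mu : probability (plane R) R) (r : R) (r0 : 0 < r).
Implicit Types (z w v : plane R) (c : plane R -> R[i]).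

Definition cauchy_kernel (m : nat) c z y : R := Re (c y * (cplx
  (y - z))^-1 ^+ m).

Definition cauchy_integral (m : nat) c z : R :=
  \int[mu]_(y in circle r) cauchy_kernel m c z y.

Definition admissible c := cmeasurable (circle r) c /\
  exists2 K : R, 0 <= K & forall y, circle r y -> normc (c y) <= K.

Lemma admissibleM a c : admissible c -> admissible (fun y => a * c y).
Proof.
move=> [mc [K K0 cK]]; split.
  by apply: cmeasurableM => //; exact: cmeasurable_cst.
exists (normc a * K); first by rewrite mulr_ge0// normc_ge0.
by move=> y yr; rewrite normcM ler_wpM2l ?normc_ge0// cK.
Qed.

Lemma cmeasurable_cplx z : cmeasurable (circle r) (fun y => cplx (y - z)).
Proof.
by split => /=; apply: measurable_funTS; apply: measurable_funB.
Qed.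

Lemma measurable_cauchy_kernel m c z : admissible c ->
  measurable_fun (circle r) (cauchy_kernel m c z).
Proof.
move=> [mc _].
have [] // : cmeasurable (circle r) (fun y => c y * (cplx (y - z))^-1 ^+ m).
apply: cmeasurableM => //; apply: cmeasurableX; apply: cmeasurableV.
exact: cmeasurable_cplx.
Qed.

Lemma disk_sqrt z : disk r z -> 0 < r - Num.sqrt (sqmod z).
Proof.
rewrite /disk/= subr_gt0 -(ltr_pXn2r (n := 2))
  ?nnegrE ?sqrtr_ge0 ?(ltW r0)// => zr.
by rewrite sqr_sqrtr// sqmod_ge0.
Qed.

Lemma normc_inv_le z y : disk r z -> circle r y ->
  normc (cplx (y - z))^-1 <= (r - Num.sqrt (sqmod z))^-1.
Proof.
move=> zr yr; have rz := disk_sqrt zr.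
have yz : r - Num.sqrt (sqmod z) <= normc (cplx (y - z)).
  rewrite normc_cplx -(ler_pXn2r (n := 2)) ?nnegrE ?sqrtr_ge0 ?(ltW rz)//.
  by rewrite sqr_sqrtr ?sqmod_ge0// sqmod_dist.
by rewrite normcV lef_pV2// posrE (lt_le_trans rz).
Qed.

Lemma cplx_neq0 z y : disk r z -> circle r y -> cplx (y - z) != 0.
Proof.
move=> zr yr; apply/eqP => e; have := disk_circle_neq zr yr.
rewrite -sqmod_gt0 => p; have : normc (cplx (y - z)) = 0.
  by rewrite e; exact: normc0.
by rewrite normc_cplx => /eqP; rewrite sqrtr_eq0 leNgt p.
Qed.

Lemma cauchy_kernel_le m c z y (K M : R) : disk r z -> circle r y ->
  normc (c y) <= K -> (r - Num.sqrt (sqmod z))^-1 <= M ->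
  `|cauchy_kernel m c z y| <= K * M ^+ m.
Proof.
move=> zr yr cK zM; rewrite (le_trans (normr_Re_le _))// normcM normcX.
rewrite ler_pM ?normc_ge0//; first by rewrite exprn_ge0 ?normc_ge0.
have yM := le_trans (normc_inv_le zr yr) zM.
by rewrite lerXn2r ?nnegrE ?normc_ge0// (le_trans (normc_ge0 _) yM).
Qed.

Lemma integrable_cauchy_kernel m c z : admissible c -> disk r z ->
  mu.-integrable (circle r) (EFin \o cauchy_kernel m c z).
Proof.
move=> ac zr; have [mc [K K0 cK]] := ac.
apply: (@bounded_integrable _ _ _ _ _ _ (K * (r - Num.sqrt (sqmod z))^-1 ^+ m)).
- exact: measurable_circle.
- exact: measurable_cauchy_kernel.
- by move=> y yr; apply: cauchy_kernel_le => //; exact: cK.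
Qed.

Lemma cauchy_integral_bound m c z : admissible c -> disk r z ->
  exists2 K : R, 0 <= K & forall a,
    `|cauchy_integral m (fun y => a * c y) z| <= normc a * K.
Proof.
move=> ac zr; have [mc [K K0 cK]] := ac.
set M := (r - Num.sqrt (sqmod z))^-1.
have M0 : 0 <= M by rewrite invr_ge0 ltW// disk_sqrt.
exists (K * M ^+ m); first by rewrite mulr_ge0// exprn_ge0.
move=> a; apply: bounded_Rintegral_le.
- exact: measurable_circle.
- by apply: measurable_cauchy_kernel; exact: admissibleM.
- by rewrite mulr_ge0 ?normc_ge0// mulr_ge0// exprn_ge0.
- move=> y yr; rewrite mulrA; apply: cauchy_kernel_le => //.
  by rewrite normcM ler_wpM2l ?normc_ge0// cK.
Qed.

(** Near [z] the moduli of [y - w] and [y - z] are bounded from below uniformly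
    in [y] on the circle, so the remainder of the expansion of the integrand is
    bounded by a multiple of |w - z| ^ 2 that can be integrated. *)
Lemma cauchy_integral_taylor m c z : admissible c -> disk r z ->
  exists2 e : R, 0 < e & exists2 C : R, 0 <= C &
  forall w, normc (cplx (w - z)) < e ->
    `|cauchy_integral m c w - cauchy_integral m c z
      - cauchy_integral m.+1 (fun y => m%:R * cplx (w - z) * c y) z|
    <= C * sqmod (w - z).
Proof.
move=> ac zr; have [mc [K K0 cK]] := ac.
set q := r - Num.sqrt (sqmod z).
have q0 : 0 < q by exact: disk_sqrt.
have [B B0 restB] := @taylor_rest_bound R m (2 / q).
exists (q / 2); first by rewrite divr_gt0.
exists (K * B); first by rewrite mulr_ge0.
move=> w wz.
have wq : Num.sqrt (sqmod w) <= Num.sqrt (sqmod z) + q / 2.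
  rewrite -!normc_cplx (_ : cplx w = cplx z + cplx (w - z)); last first.
    by rewrite cplxB addrCA subrr addr0.
  by rewrite (le_trans (normc_triangle _ _))// lerD2l ltW.
have wr : disk r w.
  rewrite /disk/= -(sqr_sqrtr (sqmod_ge0 w)) ltr_pXn2r ?nnegrE ?sqrtr_ge0
    ?(ltW r0)//.
  by rewrite (le_lt_trans wq)//; move: q0; rewrite /q; lra.
have wq' : (r - Num.sqrt (sqmod w))^-1 <= 2 / q.
  rewrite -[2 / q]invrK invf_div lef_pV2 ?posrE ?divr_gt0// ?disk_sqrt//.
  by move: wq; rewrite /q; lra.
have zq' : q^-1 <= 2 / q.
  by rewrite ler_peMl ?invr_ge0 ?(ltW q0)// ler1n.
have ac' : admissible (fun y => m%:R * cplx (w - z) * c y)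
  by exact: admissibleM.
have iw := @integrable_cauchy_kernel m c w ac wr.
have iz := @integrable_cauchy_kernel m c z ac zr.
have iz1 := @integrable_cauchy_kernel m.+1 _ z ac' zr.
have mC := measurable_circle r.
have iwz : mu.-integrable (circle r)
    (EFin \o (fun y => cauchy_kernel m c w y - cauchy_kernel m c z y)).
  exact: (integrableB mC iw iz).
rewrite /cauchy_integral -(RintegralB mC iw iz) -(RintegralB mC iwz iz1).
apply: bounded_Rintegral_le => //.
- apply: measurable_funB; last exact: measurable_cauchy_kernel.
  by apply: measurable_funB; exact: measurable_cauchy_kernel.
- by rewrite mulr_ge0 ?sqmod_ge0// mulr_ge0.
move=> y yr; set X := (cplx (y - w))^-1; set Y := (cplx (y - z))^-1.
have XY : X - Y = cplx (w - z) * (X * Y).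
  rewrite /X /Y (_ : cplx (w - z) = cplx (y - z) - cplx (y - w)); last first.
    by rewrite -cplxB opprD opprK addrACA subrr add0r addrC.
  have := cplx_neq0 wr yr; have := cplx_neq0 zr yr.
  move: (cplx (y - z)) (cplx (y - w)) => a b a0 b0.
  by field; apply/andP; split.
have -> : cauchy_kernel m c w y - cauchy_kernel m c z y -
    cauchy_kernel m.+1 (fun y => m%:R * cplx (w - z) * c y) z y =
    Re (c y * (X ^+ m - Y ^+ m - m%:R * cplx (w - z) * Y ^+ m.+1)).
  rewrite /cauchy_kernel -/X -/Y -!raddfB /=; congr (complex.Re _); ring.
rewrite (taylor_restP m XY) (le_trans (normr_Re_le _))//.
rewrite normcM normcM normcX normc_cplx sqr_sqrtr ?sqmod_ge0//.
rewrite mulrCA [leLHS]mulrC ler_wpM2r ?sqmod_ge0// ler_pM ?normc_ge0 ?cK//.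
apply: restB; first exact: le_trans (normc_inv_le wr yr) wq'.
exact: le_trans (normc_inv_le zr yr) zq'.
Qed.

Lemma cauchy_integral_continuous m c z : admissible c -> disk r z ->
  {for z, continuous (cauchy_integral m c)}.
Proof.
move=> ac zr; have [e e0 [C C0 T]] := cauchy_integral_taylor m ac zr.
have [K K0 bK] := cauchy_integral_bound m.+1 ac zr.
apply/cvgrPdist_le => eps eps0.
have [N N0 NE] : exists2 N : R, 0 < N & N = m%:R * K + C * e + 1.
  by exists (m%:R * K + C * e + 1) => //; rewrite ltr_wpDl// addr_ge0//
    mulr_ge0// ltW.
near=> w.
have we : normc (cplx (w - z)) < e by near: w; exact: normc_near_lt.
have wN : normc (cplx (w - z)) < eps / N.
  by near: w; apply: normc_near_lt; rewrite divr_gt0.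
have bb : `|cauchy_integral m.+1 (fun y => m%:R * cplx (w - z) * c y) z| <=
    m%:R * normc (cplx (w - z)) * K.
  by rewrite (le_trans (bK _))// normcM normc_nat.
move: (T _ we) bb; move: (cauchy_integral m c w) (cauchy_integral m c z)
  (cauchy_integral m.+1 _ z) => A B b ab bb.
rewrite distrC -[A - B](subrK b) (le_trans (ler_normD _ _))//.
rewrite (le_trans (lerD ab bb))//.
have -> : sqmod (w - z) = normc (cplx (w - z)) * normc (cplx (w - z)).
  by rewrite normc_cplx -expr2 sqr_sqrtr// sqmod_ge0.
set t := normc _ in we wN *.
have t0 : 0 <= t by exact: normc_ge0.
have : t * N <= eps by move: wN; rewrite ltr_pdivlMr// => /ltW.
apply: le_trans; rewrite NE.
have : C * t * t <= C * e * t by rewrite ler_wpM2r// ler_wpM2l// ltW.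
lra.
Unshelve. all: by end_near. Qed.

(** Differentiating 1 / (y - z) ^ m along v multiplies the density by m v and
    raises the exponent: the Cauchy integrals are closed under derivatives. *)
Lemma is_derive_cauchy_integral m c z v : admissible c -> disk r z ->
  is_derive z v (cauchy_integral m c)
    (cauchy_integral m.+1 (fun y => m%:R * cplx v * c y) z).
Proof.
move=> ac zr; have [e e0 [C C0 T]] := cauchy_integral_taylor m ac zr.
have V0 : 0 < normc (cplx v) + 1 by rewrite ltr_wpDl ?normc_ge0.
apply: (@is_derive_quadratic _ _ _ _ _ (C * sqmod v) (e / (normc
  (cplx v) + 1))).
- by rewrite divr_gt0.
- by rewrite mulr_ge0// sqmod_ge0.
move=> h he.
have hv : h *: v + z - z = h *: v by rewrite addrK.
have /T : normc (cplx (h *: v + z - z)) < e.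
  rewrite hv cplxZ normcM normc_real.
  move: he; rewrite ltr_pdivlMr// => he; rewrite (le_lt_trans _ he)//.
  by rewrite ler_wpM2l// lerDl.
rewrite hv sqmodZ (_ : C * sqmod v * h ^+ 2 = C * (h ^+ 2 * sqmod v));
  last by ring.
suff -> : cauchy_integral m.+1 (fun y => m%:R * cplx (h *: v) * c y) z =
  h * cauchy_integral m.+1 (fun y => m%:R * cplx v * c y) z by [].
rewrite /cauchy_integral -RintegralZl; last 2 first.
- exact: measurable_circle.
- by apply: integrable_cauchy_kernel => //; exact: admissibleM.
apply: eq_Rintegral => y yr; rewrite /cauchy_kernel cplxZ.
rewrite (_ : _ * _ = (h%:C)%C * (m%:R * cplx v * c y * (cplx
  (y - z))^-1 ^+ m.+1)); last by ring.
by move: (_ * _ ^+ m.+1) => -[a b] /=; rewrite mul0r subr0.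
Qed.

(** Deriving twice along the axis v multiplies the density by 2 v ^ 2; the
    contributions of v = 1 and of v = i cancel. *)
Lemma harmonic_cauchy_integral c : admissible c ->
  harmonic_on (disk r) (cauchy_integral 1 c).
Proof.
move=> ac.
have D1 m c' i : admissible c' -> forall z, disk r z ->
    cauchy_integral m.+1 (fun y => m%:R * cplx (axis i) * c' y) z =
    'D_(axis i) (cauchy_integral m c') z.
  by move=> ac' z zr; have [_ ->] := is_derive_cauchy_integral m
    (axis i) ac' zr.
have C1 m c' : admissible c' -> C1_on (disk r) (cauchy_integral m c').
  move=> ac'; split => [z zr|i z zr]; first exact: cauchy_integral_continuous.
  split; first by have [] := is_derive_cauchy_integral m (axis i) ac' zr.
  have ac2 := admissibleM (m%:R * cplx (axis i)) ac'.
  have cont := @cauchy_integral_continuous m.+1 _ z ac2 zr.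
  exact: (continuous_eq_on (@open_disk _ r) (D1 m c' i ac') zr cont).
split; first split; first exact: C1.
  move=> i; apply: (C1_eq_on (@open_disk _ r) (D1 1%N c i ac)).
  exact/C1/admissibleM.
move=> z zr; rewrite /laplacian.
pose g i := fun y => 2%:R * cplx (axis i) * (1%:R * cplx (axis i) * c y).
have ag i : admissible (g i) by do 2 apply: admissibleM.
have ig i := @integrable_cauchy_kernel 3 (g i) z (ag i) zr.
have L i : 'D_(axis i) ('D_(axis i) (cauchy_integral 1 c)) z =
    \int[mu]_(y in circle r) (cauchy_kernel 3 (g i) z y).
  rewrite -(derive_eq_on (axis i) (@open_disk _ r) (D1 1%N c i ac) zr).
  by rewrite -D1//; exact: admissibleM.
have mC := measurable_circle r.
apply: (etrans (congr2 +%R (L false) (L true))).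
apply: (etrans (esym (RintegralD mC (ig false) (ig true)))).
apply: (etrans (@eq_Rintegral _ _ _ mu (circle r) (fun=> 0) _ _)); last first.
  by rewrite Rintegral_cst ?mul0r.
move=> y yr; rewrite /cauchy_kernel -raddfD /= -mulrDl.
have i2 : cplx (axis true) * cplx (axis true) = -1 :> R[i].
  by apply/eqP; rewrite eq_complex /= /axis /=; apply/andP; split; apply/eqP;
    ring.
have i1 : cplx (axis false) = 1 :> R[i] by [].
suff -> : g false y + g true y = 0 by rewrite mul0r.
rewrite /g i1 (_ : 2%:R * cplx (axis true) * _ =
  2%:R * (cplx (axis true) * cplx (axis true)) * c y); last by ring.
by rewrite i2; ring.
Qed.

End cauchy_integrals.

(** * The Poisson kernel on the circle, as a function of the angle *)

Section poisson_antiderivative.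
Context {R : realType}.
Variables p q : R.
Hypothesis pq1 : p ^+ 2 + q ^+ 2 < 1.

Let A (t : R) : R := p * cos t + q * sin t.
Let B (t : R) : R := q * cos t - p * sin t.

(** Let w = (p + iq) e^(-it), so that w = A t + i B t.  The density is the real
    part of (1 + w) / (1 - w), and t + 2 arg (1 - w) is a primitive of it; as
    1 - w has a positive real part, this argument is an arctangent that is
    smooth over the whole period. *)
Definition poisson_primitive (t : R) : R := t - 2 * atan (B t * (1 - A t)^-1).

Definition poisson_density (t : R) : R :=
  (1 - p ^+ 2 - q ^+ 2) * ((1 - A t) ^+ 2 + B t ^+ 2)^-1.

Let ABpq t : A t ^+ 2 + B t ^+ 2 = p ^+ 2 + q ^+ 2.
Proof.
rewrite /A /B -[RHS]mulr1 -(cos2Dsin2 t); ring.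
Qed.

Let A_lt1 t : 0 < 1 - A t.
Proof.
rewrite subr_gt0 ltNge; apply/negP => A1.
have : 1 <= A t ^+ 2 by rewrite exprn_ege1.
have := ABpq t; have := sqr_ge0 (B t); move: pq1; clear pq1.
by move: (A t ^+ 2) (B t ^+ 2) (p ^+ 2) (q ^+ 2) => a b c e; lra.
Qed.

Lemma poisson_density_gt0 t : 0 < poisson_density t.
Proof.
rewrite /poisson_density mulr_gt0 ?invr_gt0//; first by move: pq1; lra.
by rewrite ltr_pwDl ?sqr_ge0// exprn_gt0.
Qed.

Lemma is_derive_poisson_primitive (t : R) :
  is_derive t 1 poisson_primitive (poisson_density t).
Proof.
have n0 : 1 - A t != 0 by rewrite gt_eqF.
have dA : is_derive t 1 A (B t).
  rewrite /A /B; apply: is_derive_eq.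
  by rewrite /GRing.scale/=; ring.
have dB : is_derive t 1 B (- A t).
  rewrite /A /B; apply: is_derive_eq.
  by rewrite /GRing.scale/=; ring.
have d1A : is_derive t 1 (fun u => 1 - A u) (- B t).
  by apply: is_derive_eq; rewrite /A /B /GRing.scale/=; ring.
have dV := @is_deriveV R (fun u : R => 1 - A u) t (- B t) 1 n0 d1A.
have dQ : is_derive t 1 (fun u => B u * (1 - A u)^-1)
    (B t * ((1 - A t) ^- 2 * B t) - (1 - A t)^-1 * A t).
  apply: is_derive_eq.
  by rewrite /GRing.scale/=; ring.
have datan := @is_derive1_comp R atan (fun u =>
  B u * (1 - A u)^-1) t _ _ (is_derive1_atan _) dQ.
have -> : poisson_primitive = (fun u => u - 2 * (atan \o (fun u =>
  B u * (1 - A u)^-1)) u) by [].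
apply: is_derive_eq.
rewrite /GRing.scale/= /poisson_density.
have D0 : (1 - A t) ^+ 2 + B t ^+ 2 != 0.
  by rewrite gt_eqF// ltr_pwDl ?sqr_ge0// exprn_gt0.
rewrite -addrA -opprD -(ABpq t).
by field; apply/andP; split; rewrite // addrC.
Qed.

Lemma poisson_primitive_derivable (t : R) : derivable poisson_primitive t 1.
Proof. by have [] := is_derive_poisson_primitive t. Qed.

Lemma poisson_primitive_derive1 : poisson_primitive^`()%classic =
  poisson_density.
Proof.
by apply/funext => t; rewrite derive1E; have [_ ->] :=
  is_derive_poisson_primitive t.
Qed.

Lemma poisson_primitive_continuous (t : R) : {for t,
  continuous poisson_primitive}.
Proof.
exact/differentiable_continuous/derivable1_diffP/poisson_primitive_derivable.
Qed.

Lemma poisson_density_continuous (t : R) : {for t, continuous poisson_density}.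
Proof.
apply: cvgM; first exact: cvg_cst.
have cA : {for t, continuous A}.
  by apply: cvgD; apply: cvgM; try exact: cvg_cst;
    [exact: continuous_cos|exact: continuous_sin].
have cB : {for t, continuous B}.
  by apply: cvgB; apply: cvgM; try exact: cvg_cst;
    [exact: continuous_cos|exact: continuous_sin].
apply: cvgV; first by rewrite gt_eqF// ltr_pwDl ?sqr_ge0// exprn_gt0.
rewrite expr2 [X in _ + X]expr2.
apply: cvgD; apply: cvgM => //; apply: cvgB => //; exact: cvg_cst.
Qed.

Lemma poisson_primitive_LR (a b : R) : derivable_oo_LRcontinuous
  poisson_primitive a b.
Proof.
split=> [x _||]; first exact: poisson_primitive_derivable.
- by apply: cvg_at_right_filter; exact: poisson_primitive_continuous.
- by apply: cvg_at_left_filter; exact: poisson_primitive_continuous.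
Qed.

Lemma poisson_primitive_pi : poisson_primitive pi - poisson_primitive (- pi) =
  pi *+ 2.
Proof.
rewrite /poisson_primitive /A /B cosN sinN cospi sinpi oppr0 !mulr0.
by rewrite mulr2n; ring.
Qed.

Lemma integral_poisson_density :
  (\int[lebesgue_measure]_(t in [set` `[- pi, pi]%R]) (poisson_density t)%:E =
    (pi *+ 2)%:E)%E.
Proof.
rewrite (@continuous_FTC2 _ _ poisson_primitive)//.
- by rewrite -EFinB poisson_primitive_pi.
- exact: Npi_lt_pi.
- by apply: continuous_subspaceT => t; exact: poisson_density_continuous.
- exact: poisson_primitive_LR.
- by move=> t _; rewrite poisson_primitive_derive1.
Qed.

End poisson_antiderivative.

(** * The Poisson kernel and Poisson integrals *)

Section poisson_kernel.
Context {R : realType}.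
Variables (r : R) (r0 : 0 < r).
Implicit Types (z y : plane R) (f : plane R -> R).

Lemma poisson_gt0 z y : disk r z -> circle r y -> 0 < poisson r z y.
Proof.
move=> zr yr; rewrite divr_gt0 ?subr_gt0// sqmod_gt0.
exact: disk_circle_neq zr yr.
Qed.

Lemma poisson_circ z t : poisson r z (circ r t) =
  poisson_density (z.1 / r) (z.2 / r) t.
Proof.
rewrite /poisson /poisson_density /sqmod /circ /=.
have -> : (r * cos t - z.1) ^+ 2 + (r * sin t - z.2) ^+ 2 = r ^+ 2 *
  ((1 - (z.1 / r * cos t + z.2 / r * sin t)) ^+ 2 +
    (z.2 / r * cos t - z.1 / r * sin t) ^+ 2).
  have r1 : r != 0 by rewrite gt_eqF.
  set a := z.1 / r; set b := z.2 / r.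
  have -> : z.1 = r * a by rewrite /a; field.
  have -> : z.2 = r * b by rewrite /b; field.
  apply/eqP; rewrite -subr_eq0.
  rewrite [X in X == 0](_ : _ =
    r ^+ 2 * (cos t ^+ 2 + sin t ^+ 2 - 1) * (1 - a ^+ 2 - b ^+ 2));
      last by ring.
  by rewrite cos2Dsin2 subrr mulr0 mul0r.
rewrite invfM mulrA; congr (_ * _).
by field; rewrite gt_eqF.
Qed.

Lemma disk_scaled z : disk r z -> (z.1 / r) ^+ 2 + (z.2 / r) ^+ 2 < 1.
Proof.
rewrite /disk/= /sqmod => zr; rewrite !exprMn -mulrDl exprVn.
by rewrite ltr_pdivrMr ?mul1r// exprn_gt0.
Qed.

Lemma continuous_poisson z y : y - z != 0 -> {for y, continuous (poisson r z)}.
Proof.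
move=> yz; apply: cvgM; first exact: cvg_cst.
apply: cvgV; first by rewrite gt_eqF// sqmod_gt0.
have wz : w - z @[w --> y] --> y - z by apply: cvgB;
  [exact: cvg_id|exact: cvg_cst].
apply: (cvg_comp (fun w : plane R => w - z) (@sqmod R) wz).
exact: continuous_sqmod.
Qed.

Lemma measurable_poisson z : disk r z -> measurable_fun (circle r)
  (poisson r z).
Proof.
move=> zr; apply: within_continuous_measurable_plane;
  first exact: measurable_circle.
apply: continuous_in_subspaceT => y /[!inE] yr.
exact/continuous_poisson/(disk_circle_neq zr yr).
Qed.

Lemma poisson_bound z y : disk r z -> circle r y ->
  poisson r z y <= r ^+ 2 / (r - Num.sqrt (sqmod z)) ^+ 2.
Proof.
move=> zr yr; have d0 := disk_sqrt r0 zr.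
rewrite ler_pM//.
- by rewrite subr_ge0 ltW.
- by rewrite invr_ge0 sqmod_ge0.
- by rewrite gerBl sqmod_ge0.
- by rewrite lef_pV2 ?posrE ?exprn_gt0 ?sqmod_gt0 ?(disk_circle_neq zr yr)//
    sqmod_dist.
Qed.

Lemma integral_poisson z : disk r z ->
  (\int[sigma r]_(y in circle r) (poisson r z y)%:E = 1)%E.
Proof.
move=> zr; rewrite integral_sigma; last 2 first.
- exact: measurable_circle.
- exact: measurable_poisson.
rewrite (_ : _ `&` _ = [set` `[- pi, pi]%R]); last first.
  by apply/seteqP; split => [t []//|t tpi]; split => //; exact: circ_circle.
under eq_integral do rewrite poisson_circ mulrC EFinM.
rewrite ge0_integralZl//.
- rewrite integral_poisson_density; last exact: disk_scaled.
  by rewrite -EFinM mulVf// mulrn_eq0/= gt_eqF// pi_gt0.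
- apply/measurable_EFinP; apply: measurable_funTS.
  apply: continuous_measurable_fun => t.
  by apply: poisson_density_continuous; exact: disk_scaled.
- by move=> t _; rewrite lee_fin ltW// poisson_density_gt0// disk_scaled.
- by rewrite lee_fin invr_ge0 mulrn_wge0// pi_ge0.
Qed.

Lemma Rintegral_poisson z : disk r z -> \int[sigma r]_(y in circle r)
  poisson r z y = 1.
Proof. by move=> zr; rewrite /Rintegral integral_poisson. Qed.

(** Uses that [y] lies on the circle: r ^ 2 is the square modulus of [y]. *)
Lemma poisson_cauchyE z y : disk r z -> circle r y ->
  poisson r z y = Re (2%:R * cplx y * (cplx (y - z))^-1) - 1.
Proof.
move=> zr yr; have yz := disk_circle_neq zr yr.
have : sqmod (y - z) != 0 by rewrite gt_eqF// sqmod_gt0.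
rewrite /poisson -yr /sqmod /cplx /=.
case: z zr yz => z1 z2 zr yz; case: y yr yz => y1 y2 yr yz /= n0.
by field.
Qed.

Definition poisson_integral f z := \int[sigma r]_(y in circle r)
  (f y * poisson r z y).

Lemma harmonic_cst U (k : R) : harmonic_on U (fun=> k).
Proof.
have D i : 'D_(axis i) (fun=> k) = (fun=> 0) :> (plane R -> R).
  by apply/funext => z; rewrite derive_cst.
have C1 (a : R) : C1_on U (fun=> a).
  split=> [z _|i z _]; first exact: cvg_cst.
  split; first exact: derivable_cst.
  rewrite (_ : 'D_(axis i) (fun=> a) = (fun=> 0)); first exact: cvg_cst.
  by apply/funext => w; rewrite derive_cst.
split; first by split => // i; rewrite D.
by move=> z _; rewrite /laplacian !D !derive_cst addr0.
Qed.

(** The Poisson kernel itself is the Cauchy integral of the Dirac mass at its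
    pole. *)
Lemma harmonic_poisson y : circle r y -> harmonic_on (disk r) (fun z =>
  poisson r z y).
Proof.
move=> yr.
have ac : admissible r (fun y : plane R => 2%:R * cplx y).
  split.
    apply: cmeasurableM; first exact: cmeasurable_cst.
    by split; apply: measurable_funTS; [exact: measurable_fst|exact:
      measurable_snd].
  exists (2 * r); first by rewrite mulr_ge0// ltW.
  move=> w wr; rewrite normcM (normc_nat 2) normc_cplx wr sqrtr_sqr.
  by rewrite gtr0_norm.
have H := harmonic_cauchy_integral (\d_y : probability (plane R) R) r0 ac.
have H1 := harmonic_sub (@open_disk _ r) H (harmonic_cst (disk r) 1).
apply: harmonic_eq_on H1; first exact: open_disk.
move=> z zr; rewrite poisson_cauchyE//; congr (_ - _).
rewrite /cauchy_integral /Rintegral integral_dirac; last 2 first.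
- exact: measurable_circle.
- by apply/measurable_EFinP; exact: measurable_cauchy_kernel.
by rewrite diracE mem_set// mul1e /cauchy_kernel expr1.
Qed.

Lemma harmonic_poisson_integral f (M : R) : measurable_fun (circle r) f ->
  (forall y, circle r y -> `|f y| <= M) -> harmonic_on (disk r)
    (poisson_integral f).
Proof.
move=> mf fM.
have [M0|M0] := leP 0 M; last first.
  suff -> : poisson_integral f = (fun=> 0) by exact: harmonic_cst.
  apply/funext => z; rewrite /poisson_integral (@eq_Rintegral _ _ _ _ _
    (fun=> 0)).
    by rewrite Rintegral_cst ?mul0r//; exact: measurable_circle.
  move=> y /[!inE] yr; have := le_lt_trans (fM _ yr) M0.
  by rewrite ltNge normr_ge0.
pose c y : R[i] := ((f y)%:C)%C * (2%:R * cplx y).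
have ac : admissible r c.
  split.
    apply: cmeasurableM; first by split; [exact: mf|exact: measurable_cst].
    apply: cmeasurableM; first exact: cmeasurable_cst.
    by split; apply: measurable_funTS; [exact: measurable_fst|exact:
      measurable_snd].
  exists (M * (2 * r)); first by rewrite mulr_ge0// mulr_ge0// ltW.
  move=> w wr; rewrite normcM normc_real ler_pM ?normc_ge0 ?fM//.
  by rewrite normcM (normc_nat 2) normc_cplx wr sqrtr_sqr gtr0_norm.
have H := harmonic_cauchy_integral (sigma r) r0 ac.
have H1 := harmonic_sub (@open_disk _ r) H
  (harmonic_cst (disk r) (\int[sigma r]_(y in circle r) f y)).
apply: harmonic_eq_on H1; first exact: open_disk.
move=> z zr; rewrite /poisson_integral /cauchy_integral.
have mC := measurable_circle r.
have ik := integrable_cauchy_kernel (sigma r) r0 1 ac zr.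
have ifc := bounded_integrable (sigma r) mC mf fM.
rewrite -(RintegralB mC ik ifc); apply: eq_Rintegral => y /[!inE] yr.
rewrite poisson_cauchyE// /cauchy_kernel /c expr1 mulrBr mulr1; congr (_ - _).
rewrite -mulrA; move: (_ * cplx y * _) => -[a b] /=; by rewrite mul0r subr0.
Qed.

End poisson_kernel.

(** * Boundary limits of Poisson integrals *)

Section boundary_limit.
Context {R : realType}.
Variables (r : R) (r0 : 0 < r).
Implicit Types (z y zeta : plane R) (f : plane R -> R).

Lemma nbhs_sqmod zeta (V : set (plane R)) : nbhs zeta V ->
  exists2 d : R, 0 < d & forall y, sqmod (y - zeta) < d -> V y.
Proof.
move=> /nbhs_ballP[e /= e0 eV]; exists (e ^+ 2); first by rewrite exprn_gt0.
move=> y ye; apply: eV; split; rewrite /ball/= distrC -(ltr_pXn2r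
  (n := 2)) ?nnegrE ?(ltW e0)//;
  rewrite real_normK ?num_real// (le_lt_trans _ ye)// /sqmod/= ?lerDl ?lerDr
    sqr_ge0//.
Qed.

Lemma sqmod_triangle z y zeta :
  sqmod (y - zeta) <= 2 * sqmod (y - z) + 2 * sqmod (z - zeta).
Proof.
rewrite /sqmod/= -subr_ge0.
set a := y.1; set b := y.2; set c := z.1; set d := z.2; set u := zeta.1;
  set v := zeta.2.
rewrite [X in 0 <= X](_ : _ = (a - 2 * c + u) ^+ 2 + (b - 2 * d + v) ^+ 2).
  by rewrite addr_ge0 ?sqr_ge0.
by ring.
Qed.

(** The kernels [poisson r x] have mass 1, and on the part of the circle at
    square distance at least [d] from [zeta] they are at most
    (r ^ 2 - |x| ^ 2) (4 / d), which tends to 0 as [x] tends to [zeta]. *)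
Lemma poisson_integral_cvg f (M : R) zeta : measurable_fun (circle r) f ->
  (forall y, circle r y -> `|f y| <= M) -> circle r zeta ->
  f @ within (circle r) (nbhs zeta) --> f zeta ->
  poisson_integral r f x @[x --> within (disk r) (nbhs zeta)] --> f zeta.
Proof.
move=> mf fM rz fz; apply/cvgrPdist_le => e e0.
have e20 : 0 < e / 2 by rewrite divr_gt0.
have [d d0 dN] : exists2 d, 0 < d &
    forall y, sqmod (y - zeta) < d -> circle r y -> `|f zeta - f y| <= e / 2.
  by move/cvgrPdist_le : fz => /(_ _ e20) /nbhs_sqmod.
have M0 : 0 <= M by rewrite (le_trans _ (fM _ rz)).
(* K bounds |f - f zeta|; the 1 makes it positive *)
pose K := M + `|f zeta| + 1.
have K0 : 0 < K by rewrite ltr_wpDl// addr_ge0.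
have near1 : \forall x \near zeta, sqmod (x - zeta) < d / 4.
  by apply: sqmod_near_lt; rewrite divr_gt0.
have near2 : \forall x \near zeta, r ^+ 2 - sqmod x < e * d / (8 * K).
  have := @continuous_sqmod R zeta => /cvgr_gt/(_ (r ^+ 2 - e * d / (8 * K))).
  rewrite rz gtrBl divr_gt0 ?mulr_gt0// => /(_ isT).
  by apply: filterS => x; rewrite ltrBlDr addrC -ltrBlDr.
rewrite near_withinE; near=> x => xr.
have xd : sqmod (x - zeta) < d / 4 by near: x.
have xe : r ^+ 2 - sqmod x < e * d / (8 * K) by near: x.
rewrite distrC.
pose eta := (r ^+ 2 - sqmod x) * (4 / d).
have eta0 : 0 <= eta by rewrite mulr_ge0 ?divr_ge0 ?(ltW d0)// subr_ge0 ltW.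
have mC := measurable_circle r.
have := @approximate_identity _ _ R (sigma r) (circle r)
  [set y | sqmod (y - zeta) < d] f (poisson r x) (f zeta) (e / 2) eta K
  (r ^+ 2 / (r - Num.sqrt (sqmod x)) ^+ 2) mC mf (measurable_poisson xr)
  (ltW e20) eta0 (ltW K0).
rewrite Rintegral_poisson// !mulr1 => H.
apply: (le_trans (H _ _ _ _)).
- by move=> y yr; rewrite ltW ?poisson_gt0//= poisson_bound.
- move=> y yr; rewrite (le_trans (ler_normB _ _))// /K (le_trans (lerD
    (fM _ yr) (lexx _)))//.
  by rewrite lerDl.
- by move=> y yr /dN /(_ yr); rewrite distrC.
- move=> y yr /negP; rewrite -leNgt => dy.
  rewrite /poisson /eta ler_wpM2l ?subr_ge0 ?(ltW xr)//.
  have yx : 0 < sqmod (y - x) by rewrite sqmod_gt0 (disk_circle_neq xr yr).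
  rewrite -[4 / d]invrK lef_pV2 ?posrE ?invr_gt0 ?divr_gt0//.
  rewrite invf_div.
  have := sqmod_triangle x y zeta; move: dy xd; lra.
rewrite [leRHS](splitr e) lerD2l /eta.
rewrite (le_trans (ler_wpM2l (ltW K0) (ler_wpM2r _ (ltW xe))))//.
  by rewrite divr_ge0// ltW.
rewrite le_eqVlt; apply/orP; left; apply/eqP; field.
by apply/andP; split; rewrite gt_eqF.
Unshelve. all: by end_near. Qed.

End boundary_limit.

(** * The maximum principle *)

Section maximum_principle.
Context {R : realType}.

(** If [L] were positive, the derivative [g], which vanishes at 0, would be
    positive to the right of 0, and [phi] would increase there. *)
Lemma second_derivative_test (phi g : R -> R) (L e : R) : 0 < e ->
  (forall t : R, `|t| < e -> is_derive t 1 phi (g t)) ->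
    is_derive (0 : R) 1 g L ->
  (forall t : R, `|t| < e -> phi t <= phi 0) -> L <= 0.
Proof.
move=> e0 dphi dg maxphi; rewrite leNgt; apply/negP => L0.
have in_e (t : R) : t \in `](- e), e[ -> `|t| < e.
  by rewrite in_itv/= ltr_norml.
have g0 : g 0 = 0.
  have d0 : is_derive (0 : R) 1 phi 0.
    apply: (@derive1_at_max _ phi (- e) e 0).
    - by rewrite ge0_cp// ltW.
    - by move=> t /in_e te; have [] := dphi t te.
    - by rewrite in_itv/= oppr_lt0 e0.
    - by move=> t /in_e; exact: maxphi.
  have e00 : `|0 : R| < e by rewrite normr0.
  by have [_ <-] := dphi 0 e00; have [_ ->] := d0.
have [dg0 dgE] := dg.
have cg : h^-1 *: ((g \o shift 0) (h *: 1) - g 0) @[h --> 0^'] --> L.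
  by move/cvg_ex : dg0 => [l gl]; rewrite -dgE /derive (cvg_lim _ gl).
move: (cg) => /cvgr_gt/(_ _ L0).
rewrite near_withinE => /nbhs_ballP[d /= d0 dP].
pose h0 := Num.min (d / 2) (e / 2).
have h00 : 0 < h0 by rewrite lt_min !divr_gt0.
have h0d : h0 < d by rewrite (@le_lt_trans _ _ (d / 2)) ?ge_min ?lexx//; lra.
have h0e : h0 < e by rewrite (@le_lt_trans _ _ (e / 2)) ?ge_min ?lexx ?orbT//;
  lra.
have gpos h : 0 < h -> h < d -> 0 < g h.
  move=> hp hd; have := dP h.
  rewrite /ball/= sub0r normrN gtr0_norm// => /(_ hd).
  rewrite gt_eqF// => /(_ isT).
  by rewrite g0 subr0 addr0 /GRing.scale/= mulr1 pmulr_rgt0// invr_gt0.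
have inh (t : R) : 0 <= t -> t <= h0 -> `|t| < e.
  by move=> t0 th; rewrite ger0_norm// (le_lt_trans th).
have dphi' x : x \in `]0, h0[ -> is_derive x 1 phi (g x).
  by rewrite in_itv/= => /andP[/ltW x0 /ltW xh]; exact: dphi (inh x x0 xh).
have cphi : {within `[0, h0], continuous phi}.
  apply: continuous_in_subspaceT => x /[!inE];
    rewrite /= in_itv/= => /andP[x0 xh].
  have [dx _] := dphi x (inh x x0 xh).
  exact/differentiable_continuous/derivable1_diffP.
have [c] := MVT h00 dphi' cphi.
rewrite in_itv/= => /andP[c0 ch]; rewrite subr0 => E.
have := maxphi h0 (inh h0 (ltW h00) (lexx _)).
rewrite leNgt => /negP; apply; rewrite -subr_gt0 E mulr_gt0// gpos//.
exact: lt_trans ch h0d.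
Qed.

Lemma is_derive_line (v : plane R -> R) (e p : plane R) (t : R) : derivable v
  (t *: e + p) e ->
  is_derive t 1 (fun s : R => v (s *: e + p)) ('D_e v (t *: e + p)).
Proof.
move=> dv.
have E : (fun h : R => h^-1 *: (((fun s : R =>
  v (s *: e + p)) \o shift t) (h *: 1) - v (t *: e + p)))
  = (fun h : R => h^-1 *: ((v \o shift (t *: e + p)) (h *: e) - v
    (t *: e + p))).
  apply/funext => h /=; congr (_ *: (v _ - _)).
  by rewrite (_ : h%:A = h) ?scalerDl ?addrA//; exact: mulr1.
apply: DeriveDef; first by rewrite /derivable E.
by rewrite /derive E.
Qed.

Variables (r : R) (r0 : 0 < r).

(** At a maximum the two second derivatives along the axes are nonpositive, which
    a vanishing Laplacian does not exclude; adding a small multiple of |z| ^ 2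
    makes the Laplacian positive and does. *)
Lemma max_principle (v : plane R -> R) :
  {within closure (disk r), continuous v} -> harmonic_on (disk r) v ->
  (forall y, circle r y -> v y <= 0) -> forall z, disk r z -> v z <= 0.
Proof.
move=> cv hv vb z0 z0r; rewrite leNgt; apply/negP => m0.
(* on the circle eps |z| ^ 2 is v z0 / 2, too small to create a maximum there *)
pose eps := v z0 / (2 * r ^+ 2).
have r20 : 0 < r ^+ 2 by rewrite exprn_gt0.
have eps0 : 0 < eps by rewrite divr_gt0// mulr_gt0.
pose w z := v z + eps * sqmod z.
have cw : {within closure (disk r), continuous w}.
  move=> x; apply: cvgD; first exact: cv.
  apply: cvgM; first exact: cvg_cst.
  by apply: continuous_subspaceT => y; exact: continuous_sqmod.
have cl0 : closure (disk r : set (plane R)) !=set0.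
  by exists z0; exact: subset_closure.
have [p] := compact_EVT_max cl0 (compact_closure_disk r0) cw.
rewrite inE => pr maxp.
have wz0 : v z0 <= w p.
  apply: (@le_trans _ _ (w z0)); last by apply: maxp; rewrite inE;
    exact: subset_closure.
  by rewrite lerDl mulr_ge0 ?sqmod_ge0// ltW.
have {}pr : disk r p.
  move: pr; rewrite closure_disk//= le_eqVlt => /orP[/eqP pr|//].
  have := vb p pr; move: wz0; rewrite /w pr.
  have -> : eps * r ^+ 2 = v z0 / 2 by rewrite /eps; field; rewrite gt_eqF.
  lra.
pose pi_ (i : bool) : R := if i then p.2 else p.1.
have sqE i t : sqmod (t *: axis i + p) = sqmod p + (2 * pi_ i * t + t ^+ 2).
  by rewrite /sqmod /axis /pi_; case: i => /=; rewrite /GRing.scale/=; ring.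
have test i : 'D_(axis i) ('D_(axis i) v) p + 2 * eps <= 0.
  have [e e0 eD] : exists2 e : R, 0 < e & forall t : R,
    `|t| < e -> disk r (t *: axis i + p).
    have ct : t *: axis i + p @[t --> (0 : R)] --> p.
      rewrite -[X in _ --> X]add0r -(scale0r (axis i)).
      by apply: cvgD; [apply: cvgZ; [exact: cvg_id|exact: cvg_cst]|exact:
        cvg_cst].
    have /nbhs_ballP[e /= e0 eP] := ct _ (open_nbhs_nbhs (conj
      (@open_disk _ r) pr)).
    by exists e => // t te; apply: eP; rewrite /ball/= sub0r normrN.
  apply: (@second_derivative_test (fun t : R => w (t *: axis i + p))
    (fun t : R => 'D_(axis i) v (t *: axis i + p) + eps *
      (2 * pi_ i + 2 * t)) _ _ e0).
  - move=> t te; have [[[_ dv] _] _] := hv.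
    have [dvt _] := dv i _ (eD t te).
    have dl := is_derive_line dvt.
    have -> : (fun s : R => w (s *: axis i + p)) =
        (fun s : R => v (s *: axis i + p) + eps * (sqmod p +
          (2 * pi_ i * s + s ^+ 2))).
      by apply/funext => s; rewrite /w sqE.
    apply: is_derive_eq; rewrite /GRing.scale/=; ring.
  - have [[_ /(_ i)[_ dv]] _] := hv.
    have zp : 0 *: axis i + p = p by rewrite scale0r add0r.
    have [dvt _] := dv i p pr; rewrite -zp in dvt.
    have dl := is_derive_line dvt; rewrite zp in dl.
    by apply: is_derive_eq; rewrite /GRing.scale/=; ring.
  - move=> t te; rewrite scale0r add0r; apply: maxp; rewrite inE.
    exact/subset_closure/eD.
have [_ /(_ p pr) lap0] := hv.
have sum0 : forall a b c : R, 0 < c -> a + b = 0 -> a + 2 * c <= 0 ->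
  b + 2 * c <= 0 -> False.
  by clear; move=> a b c; lra.
exact: sum0 eps0 lap0 (test false) (test true).
Qed.

End maximum_principle.

(** * The Dirichlet problem on a disk *)

Section dirichlet.
Context {R : realType}.
Variables (r : R) (r0 : 0 < r).
Implicit Types (z y zeta : plane R) (f u : plane R -> R).

Definition dirichlet_solution f z :=
  if sqmod z < r ^+ 2 then poisson_integral r f z else f z.

Lemma within_continuous_circle u : {within closure (disk r), continuous u} ->
  {within circle r, continuous u}.
Proof.
by apply: continuous_subspaceW => y yr; rewrite closure_disk//= yr.
Qed.

Lemma compact_circle : compact (circle r : set (plane R)).
Proof.
apply: (subclosed_compact _ (compact_closure_disk r0)).
  rewrite (_ : circle r = @sqmod R @^-1` [set x | x = r ^+ 2])//.
  apply: preimage_closed; last exact: closed_eq.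
  by move=> z _; exact: continuous_sqmod.
by move=> y yr; rewrite closure_disk//= yr.
Qed.

Lemma circle_bounded f : {within circle r, continuous f} ->
  exists M : R, forall y, circle r y -> `|f y| <= M.
Proof.
move=> cf; have cnf : {within circle r, continuous (fun y => `|f y|)}.
  by move=> y; apply: cvg_norm; exact: cf.
have c0 : circle r !=set0 by exists (circ r 0); exact: circ_circle.
have [c _ cM] := compact_EVT_max c0 compact_circle cnf.
by exists `|f c| => y yr; apply: cM; rewrite inE.
Qed.

Lemma measurable_within_circle f : {within circle r, continuous f} ->
  measurable_fun (circle r) f.
Proof.
by apply: within_continuous_measurable_plane; exact: measurable_circle.
Qed.

Lemma harmonic_dirichlet f : {within circle r, continuous f} ->
  harmonic_on (disk r) (dirichlet_solution f).
Proof.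
move=> cf; have [M fM] := circle_bounded cf.
apply: (harmonic_eq_on (@open_disk _ r) _
  (harmonic_poisson_integral r0 (measurable_within_circle cf) fM)).
by move=> z zr; rewrite /dirichlet_solution zr.
Qed.

(** At a boundary point the values on the circle are continuous by hypothesis,
    and the values inside converge by [poisson_integral_cvg]. *)
Lemma continuous_dirichlet f : {within circle r, continuous f} ->
  {within closure (disk r), continuous (dirichlet_solution f)}.
Proof.
move=> cf; have [M fM] := circle_bounded cf.
apply/subspace_continuousP => z; rewrite closure_disk//= le_eqVlt =>
  /orP[/eqP zr|zr].
  have fz : f @ within (circle r) (nbhs z) --> f z.
    by move/subspace_continuousP : cf; exact.
  have Pz := poisson_integral_cvg r0 (measurable_within_circle cf) fM zr fz.
  have dz : dirichlet_solution f z = f z by rewrite /dirichlet_solution zr ltxx.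
  suff : dirichlet_solution f x @[x --> within [set z | sqmod z <=
    r ^+ 2] (nbhs z)] --> f z.
    by rewrite -dz.
  apply/cvgrPdist_le => e e0.
  move/cvgrPdist_le : fz => /(_ _ e0); rewrite near_withinE => n1.
  move/cvgrPdist_le : Pz => /(_ _ e0); rewrite near_withinE => n2.
  rewrite near_withinE; near=> x => xr; rewrite /dirichlet_solution.
  case: ifPn => [xlt|]; first by move: xlt; near: x.
  rewrite -leNgt => rx; have : circle r x by apply/eqP; rewrite eq_le xr rx.
  by near: x.
have [[[cu _] _] _] := harmonic_dirichlet cf.
apply: cvg_within_filter; exact: cu.
Unshelve. all: by end_near. Qed.

(** The function and the Dirichlet solution with its boundary values differ by a
    harmonic function that vanishes on the circle; the maximum principle applies
    to this difference and to its opposite. *)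
Lemma poisson_representation u : {within closure (disk r), continuous u} ->
  harmonic_on (disk r) u -> forall z, disk r z -> u z = poisson_integral r u z.
Proof.
move=> cu hu z zr.
have cC := within_continuous_circle cu.
have hd := harmonic_dirichlet cC; have cd := continuous_dirichlet cC.
have dz : dirichlet_solution u z = poisson_integral r u z.
  by rewrite /dirichlet_solution zr.
have eqC y : circle r y -> dirichlet_solution u y = u y.
  by rewrite /dirichlet_solution => ->; rewrite ltxx.
have c1 : {within closure (disk r), continuous (fun z =>
  u z - dirichlet_solution u z)}.
  by move=> x; exact: cvgB (cu x) (cd x).
have c2 : {within closure (disk r), continuous (fun z =>
  dirichlet_solution u z - u z)}.
  by move=> x; exact: cvgB (cd x) (cu x).
have h1 := harmonic_sub (@open_disk _ r) hu hd.
have h2 := harmonic_sub (@open_disk _ r) hd hu.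
have b1 y : circle r y -> u y - dirichlet_solution u y <= 0.
  by move=> yr; rewrite eqC// subrr.
have b2 y : circle r y -> dirichlet_solution u y - u y <= 0.
  by move=> yr; rewrite eqC// subrr.
have := max_principle r0 c1 h1 b1 zr; have := max_principle r0 c2 h2 b2 zr.
by rewrite -dz !subr_le0 => ? ?; apply/eqP; rewrite eq_le; apply/andP.
Qed.

End dirichlet.

(** * Measures on the plane are determined by continuous functions *)

Section measures_agree.
Context {R : realType}.

Definition quadrants : set (set (plane R)) :=
  [set A | exists a b : R, A = (`]-oo, a[ `*` `]-oo, b[)%classic].

Lemma bigcup_rays : \bigcup_n `]-oo, n%:R[%classic = [set: R].
Proof.
apply/seteqP; split=> // x _; exists (Num.truncn `|x|).+1 => //=.
rewrite in_itv/= (le_lt_trans (ler_norm x))//.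
by have /andP[_] := truncn_itv (normr_ge0 x).
Qed.

Lemma bigcup_quadrants :
  \bigcup_n (`]-oo, n%:R[ `*` `]-oo, n%:R[)%classic = [set: plane R].
Proof.
apply/seteqP; split=> // z _.
pose m := (Num.truncn (Num.max `|z.1| `|z.2|)).+1; exists m => //.
have zm : Num.max `|z.1| `|z.2| < m%:R.
  have m0 : 0 <= Num.max `|z.1| `|z.2| by rewrite le_max normr_ge0.
  by have /andP[_] := truncn_itv m0.
move: zm; rewrite gt_max => /andP[z1 z2].
by split; rewrite /= in_itv/=; [exact: le_lt_trans
  (ler_norm _) z1|exact: le_lt_trans (ler_norm _) z2].
Qed.

(** Quadrants generate the vertical and the horizontal open half-planes, as
    increasing unions, hence all the cylinders. *)
Lemma measurable_quadrants : @measurable _ (plane R) = <<s quadrants >>.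
Proof.
rewrite measurable_prod_measurableType eqEsubset; split; last first.
  apply: smallest_sub; first exact: smallest_sigma_algebra.
  move=> _ [a [b ->]]; apply: sub_sigma_algebra.
  by exists `]-oo, a[%classic; [exact: measurable_itv|exists `]-oo,
    b[%classic => //; exact: measurable_itv].
have sQ : sigma_algebra setT <<s quadrants >> by exact: smallest_sigma_algebra.
apply: smallest_sub => // _ [A mA] [B mB <-].
have mray (i : plane R -> R) A' : measurable A' ->
    (forall a, <<s quadrants >> (i @^-1` `]-oo,
      a[%classic)) -> <<s quadrants >> (i @^-1` A').
  move=> mA' ia.
  have : preimage_set_system setT i ((@RGenInftyO.G R).-sigma.-measurable)
    (i @^-1` A').
    by exists A'; [rewrite -RGenInftyO.measurableE|rewrite setTI].
  rewrite -g_sigma_preimageE; apply: smallest_sub => //.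
  by move=> _ [_ [a ->] <-]; rewrite setTI; exact: ia.
have -> : A `*` B = fst @^-1` A `&` snd @^-1` B by [].
have [_ _ bigQ] := sQ.
have IQ : setI_closed <<s quadrants >>.
  move=> X Y XQ YQ.
  exact: (@measurableI _ (g_sigma_algebraType quadrants) X Y XQ YQ).
apply: IQ.
  apply: mray => // a.
  rewrite (_ : _ @^-1` _ = \bigcup_n (`]-oo, a[ `*` `]-oo, n%:R[)%classic).
    by apply: bigQ => n; apply: sub_sigma_algebra; exists a, n%:R.
  apply/seteqP; split => [z za|z [n _ []]//].
  have : [set: R] z.2 by [].
  by rewrite -bigcup_rays => -[n _ zn]; exists n.
apply: mray => // a.
rewrite (_ : _ @^-1` _ = \bigcup_n (`]-oo, n%:R[ `*` `]-oo, a[)%classic).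
  by apply: bigQ => n; apply: sub_sigma_algebra; exists n%:R, a.
apply/seteqP; split => [z za|z [n _ []]//].
have : [set: R] z.1 by [].
by rewrite -bigcup_rays => -[n _ zn]; exists n.
Qed.

(** Continuous functions that increase to the indicator of ]-oo, a[. *)
Definition ramp (a : R) (n : nat) (x : R) : R := Num.max 0 (Num.min 1 (n%:R *
  (a - x))).

Lemma continuous_ramp a n : continuous (ramp a n).
Proof.
apply: (@max_fun_continuous _ R R (fun=> 0) (fun x =>
  Num.min 1 (n%:R * (a - x)))).
  by move=> x; exact: cvg_cst.
apply: (@min_fun_continuous _ R R (fun=> 1) (fun x => n%:R * (a - x))).
  by move=> x; exact: cvg_cst.
move=> x; apply: cvgM; first exact: cvg_cst.
by apply: cvgB; [exact: cvg_cst|exact: cvg_id].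
Qed.

Lemma ramp_itv a n x : 0 <= ramp a n x <= 1.
Proof.
by rewrite /ramp le_max lexx/= ge_max ler01 ge_min lexx.
Qed.

Lemma cvg_ramp a x : ramp a n x @[n --> \oo] --> ((x < a)%R%:R : R).
Proof.
have [xa|ax] := ltP x a; last first.
  rewrite (_ : (fun n => _) = (fun=> 0)); first exact: cvg_cst.
  apply/funext => n; rewrite /ramp; apply/max_idPl.
  by rewrite ge_min; apply/orP; right; rewrite mulr_ge0_le0// subr_le0.
apply: cvg_near_cst; near=> n.
rewrite /ramp min_l ?max_r//= -ler_pdivrMr ?subr_gt0// div1r.
near: n; exact: nbhs_infty_ger.
Unshelve. all: by end_near. Qed.

Lemma measure_restrict d (T : measurableType d) (mu : {measure set T -> \bar R})
    (C A : set T) :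
  measurable C -> measurable A -> mu (~` C) = 0%E -> mu A = mu (A `&` C).
Proof.
move=> mC mA muC.
have mAC : mu (A `\` C) = 0%E.
  apply: (@subset_measure0 _ _ _ mu _ (~` C)) muC;
    by [exact: measurableD|exact: measurableC|move=> x []].
by apply: (etrans (measureDI mu mA mC)); rewrite [X in (X + _)%E]mAC add0e.
Qed.

(** Products of two ramps approximate the indicators of the quadrants, which form
    a pi-system generating the sigma-algebra. *)
Lemma measure_eq_continuous (mu mu' : probability (plane R) R) (C : set
  (plane R)) :
  measurable C -> mu (~` C) = 0%E -> mu' (~` C) = 0%E ->
  (forall f : plane R -> R, continuous f ->
    (\int[mu]_(y in C) (f y)%:E = \int[mu']_(y in C) (f y)%:E)%E) ->
  forall A, measurable A -> mu A = mu' A.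
Proof.
move=> mC muC mu'C E A mA.
apply: (measure_unique quadrants (fun n => `]-oo, n%:R[ `*` `]-oo,
  n%:R[)%classic) => //.
- exact: measurable_quadrants.
- move=> _ _ [a [b ->]] [a' [b' ->]]; exists (Num.min a a'), (Num.min b b').
  apply/seteqP; split => -[x y] /=; rewrite /= !in_itv/= !lt_min.
    by move=> [[-> ->] [-> ->]].
  by move=> [/andP[-> ->] /andP[-> ->]].
- by move=> n; exists n%:R, n%:R.
- exact: bigcup_quadrants.
- move=> _ [a [b ->]]; set Q := (_ `*` _)%classic.
  have mQ : measurable Q by apply: measurableX; exact: measurable_itv.
  pose f n (z : plane R) := ramp a n z.1 * ramp b n z.2.
  have cf n : continuous (f n).
    move=> z; apply: cvgM.
      apply: (@cvg_comp _ _ _ fst (ramp a n) _ (nbhs z.1));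
        first exact: cvg_fst.
      exact: continuous_ramp.
    apply: (@cvg_comp _ _ _ snd (ramp b n) _ (nbhs z.2)); first exact: cvg_snd.
    exact: continuous_ramp.
  have lim (m : probability (plane R) R) : m (~` C) = 0%E ->
      (\int[m]_(y in C) (f n y)%:E)%E @[n --> \oo] --> m Q.
    move=> m0; rewrite (measure_restrict mC mQ m0) -integral_indic//.
    apply: (@dominated_cvg _ _ _ m C mC (fun n y =>
      (f n y)%:E) _ (cst 1%E)) => //.
    + move=> n; apply/measurable_EFinP; apply:
        within_continuous_measurable_plane => //.
      exact/continuous_subspaceT/cf.
    + move=> z Cz; apply: cvg_EFin; first exact: nearW.
      rewrite indicE (_ : (z \in Q)%:R = (z.1 < a)%R%:R * (z.2 < b)%R%:R :> R).
        by apply: cvgM; exact: cvg_ramp.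
      rewrite -natrM mulnb; congr (_%:R); congr nat_of_bool.
      apply/idP/idP; rewrite inE /Q/= !in_itv/=; first by case=> -> ->.
      by move=> /andP[-> ->].
    + have -> : cst 1%E = EFin \o (fun=> 1) :> (plane R -> _) by [].
      by apply: (@bounded_integrable _ _ _ _ _ _ 1) => // y _; rewrite normr1.
    + move=> n y Cy; rewrite /= lee_fin /f.
      have /andP[u0 u1] := ramp_itv a n y.1; have /andP[v0 v1] := ramp_itv b n
        y.2.
      by rewrite ger0_norm ?mulr_ge0// mulr_ile1.
  have := lim mu muC; under eq_fun do rewrite E//.
  by move=> /cvg_unique; apply => //; exact: lim.
- by move=> n; rewrite (le_lt_trans (probability_le1 _ _))// ?ltry//;
    apply: measurableX; exact: measurable_itv.
Qed.

End measures_agree.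

(** * Harmonic measure of a disk *)

Section poisson_measure.
Context {R : realType}.
Variables (r : R) (r0 : 0 < r) (z : plane R) (zr : disk r z).

Definition poisson_measure of disk r z : set (plane R) -> \bar R :=
  fun A => (\int[sigma r]_(y in A `&` circle r) (poisson r z y)%:E)%E.

Local Notation P := (poisson_measure zr).

Let P0 : P set0 = 0%E.
Proof. by rewrite /P /poisson_measure set0I integral_set0. Qed.

Let P_ge0 A : (0 <= P A)%E.
Proof.
by apply: integral_ge0 => y [_ yr]; rewrite lee_fin ltW// poisson_gt0.
Qed.

Let P_sigma_additive : semi_sigma_additive P.
Proof.
move=> /= A mA tA mUA; rewrite /poisson_measure; apply: cvg_toP.
  apply: ereal_nondecreasing_is_cvgn => m n mn.
  apply: lee_sum_nneg_natr => // k _ _; exact: P_ge0.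
have mC := measurable_circle r.
rewrite setI_bigcupl ge0_integral_bigcup//=.
- by move=> k; exact: measurableI.
- apply/measurable_EFinP; apply: measurable_funS (measurable_poisson zr) => //.
  by move=> y [k _ []].
- by move=> y [k _ [_ yr]]; rewrite lee_fin ltW// poisson_gt0.
- exact: trivIset_setIr.
Qed.

HB.instance Definition _ := isMeasure.Build _ _ _ P P0 P_ge0 P_sigma_additive.

Let PT : P setT = 1%E.
Proof. by rewrite /poisson_measure setTI integral_poisson. Qed.

HB.instance Definition _ := Measure_isProbability.Build _ _ _ P PT.

Lemma poisson_measure_circleC : P (~` circle r) = 0%E.
Proof. by rewrite /poisson_measure setICl integral_set0. Qed.

Lemma integral_poisson_law (mu : {measure set (plane R) ->
  \bar R}) (f : plane R -> R) :
  (forall A, measurable A -> mu A = P A) -> measurable_fun (circle r) f ->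
  (\int[mu]_(y in circle r) (f y)%:E =
   \int[sigma r]_(y in circle r) (f y * poisson r z y)%:E)%E.
Proof.
move=> muP mf; have mC := measurable_circle r.
rewrite (@integral_transfer _ _ _ _ _ (sigma r) mu id (circle r)
  (poisson r z))//.
- by rewrite /= setIid.
- exact: measurable_poisson.
- by move=> y yr; rewrite ltW// poisson_gt0.
Qed.

Lemma poisson_integralE (f : plane R -> R) (M : R) : measurable_fun
  (circle r) f ->
  (forall y, circle r y -> `|f y| <= M) ->
  (\int[sigma r]_(y in circle r) (f y * poisson r z y)%:E =
   (poisson_integral r f z)%:E)%E.
Proof.
move=> mf fM; rewrite /poisson_integral /Rintegral fineK//.
apply: integrable_fin_num; first exact: measurable_circle.
apply: (@bounded_integrable _ _ _ _ _ _ (M * (r ^+ 2 / (r - Num.sqrt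
  (sqmod z)) ^+ 2))).
- exact: measurable_circle.
- by apply: measurable_funM => //; exact: measurable_poisson.
- move=> y yr; rewrite normrM ler_pM ?fM//.
  by rewrite ger0_norm ?poisson_bound// ltW// poisson_gt0.
Qed.

Lemma is_harmonic_poisson_measure : is_harmonic_measure (disk r) z P.
Proof.
split; first by rewrite boundary_disk//; exact: poisson_measure_circleC.
move=> u cu hu; rewrite boundary_disk//.
have cC := within_continuous_circle r0 cu.
have mu := measurable_within_circle cC.
have [M uM] := circle_bounded r0 cC.
by rewrite integral_poisson_law// (poisson_integralE mu uM)
  -poisson_representation.
Qed.

(** Both measures integrate every continuous function on the circle to the value
    at [z] of the Dirichlet solution with these boundary values. *)
Lemma harmonic_measure_unique (mu : probability (plane R) R) :
  is_harmonic_measure (disk r) z mu ->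
  forall A, measurable A -> mu A = P A.
Proof.
rewrite /is_harmonic_measure boundary_disk// => -[mu0 muu].
apply: (measure_eq_continuous (measurable_circle r)
  mu0 poisson_measure_circleC).
move=> f cf.
have cC : {within circle r, continuous f} by exact: continuous_subspaceT.
have eqC y : circle r y -> dirichlet_solution r f y = f y.
  by rewrite /dirichlet_solution => ->; rewrite ltxx.
have hd := harmonic_dirichlet r0 cC; have cd := continuous_dirichlet r0 cC.
have [_] := is_harmonic_poisson_measure; rewrite boundary_disk// =>
  /(_ _ cd hd) PE.
have muE := muu _ cd hd.
transitivity (\int[mu]_(y in circle r) (dirichlet_solution r f y)%:E)%E.
  by apply: eq_integral => y /[!inE] /eqC ->.
rewrite muE -PE; apply: eq_integral => y /[!inE] /eqC ->//.
Qed.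

Lemma exists_harmonic_measure : exists mu, is_harmonic_measure (disk r) z mu.
Proof.
pose Q : probability (plane R) R := P.
by exists Q; exact: is_harmonic_poisson_measure.
Qed.

Lemma harmonic_measureE A : measurable A -> harmonic_measure (disk r) z A = P A.
Proof.
apply: harmonic_measure_unique.
exact: (@getPex _ (is_harmonic_measure (disk r) z)) exists_harmonic_measure.
Qed.

End poisson_measure.

Section harmonic_measure_origin.
Context {R : realType}.
Variables (r : R) (r0 : 0 < r).

Lemma poisson_origin y : circle r y -> poisson r (@origin R) y = 1.
Proof.
move=> yr; rewrite /poisson.
have -> : y - origin = y by rewrite /origin -[(0, 0)]/(0 : plane R) subr0.
rewrite yr /sqmod/= expr0n/= addr0 subr0 divff//.
by rewrite gt_eqF// exprn_gt0.
Qed.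

Lemma harmonic_measure_origin A : measurable A ->
  harmonic_measure (disk r) origin A = sigma r A.
Proof.
move=> mA; have mC := measurable_circle r.
rewrite (harmonic_measureE r0 (origin_disk r0))// /poisson_measure.
rewrite (measure_restrict mC mA (sigma_circleC r)).
transitivity (\int[sigma r]_(y in A `&` circle r) (1%R)%:E)%E.
  by apply: eq_integral => y /[!inE] -[_ yr]; rewrite poisson_origin.
by rewrite integral_cst ?mul1e//; exact: measurableI.
Qed.

End harmonic_measure_origin.

(** * Regularity and the relative kernel *)

Section disks_are_regular.
Context {R : realType}.
Implicit Types (z y : plane R).

Lemma regular_disk (r : R) : 0 < r -> regular_domain (disk r : set (plane R)).
Proof.
move=> r0; split.
- exact: open_disk.
- exact: connected_disk.
- by exists origin; exact: origin_disk.
- by move=> z; exact: exists_harmonic_measure.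
move=> om omH zeta f; rewrite boundary_disk// => zetar mf [M fM] fz.
suff om_eq x : disk r x ->
    (\int[om x]_(y in circle r) (f y)%:E)%E = (poisson_integral r f x)%:E.
  have := poisson_integral_cvg r0 mf fM zetar fz.
  move=> H; have : (poisson_integral r f x)%:E @[x --> within (disk r)
    (nbhs zeta)] --> (f zeta)%:E.
    by apply: cvg_EFin => //; exact: nearW.
  apply: cvg_trans.
  apply: near_eq_cvg; rewrite near_withinE; apply: nearW => x xr.
  by rewrite /= om_eq.
move=> xr; rewrite (integral_poisson_law (zr := xr))//.
  by rewrite (poisson_integralE r0 xr mf fM).
exact/harmonic_measure_unique/omH.
Qed.

Lemma closure_disk_subset (r s : R) : 0 < r -> r < s ->
  closure (disk r) `<=` (disk s : set (plane R)).
Proof.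
move=> r0 rs z; rewrite closure_disk//= => zr.
by rewrite /disk/= (le_lt_trans zr)// ltrXn2r ?nnegrE ?(ltW r0)//.
Qed.

Lemma relative_kernel_disk (r : R) : 0 < r ->
  is_relative_kernel (disk r) origin (@poisson R r).
Proof.
move=> r0 z zr; rewrite boundary_disk//; split; first exact: measurable_poisson.
move=> A mA; rewrite (harmonic_measureE r0 zr mA).
by apply: eq_measure_integral => B mB _; exact/esym/harmonic_measure_origin.
Qed.

Lemma continuous_poisson_joint (s : R) z y : y - z != 0 ->
  {for (s, z, y), continuous (fun szy : R * plane R * plane R =>
    poisson szy.1.1 szy.1.2 szy.2)}.
Proof.
move=> yz.
have c1 : szy.1.1 @[szy --> (s, z, y)] --> s by apply:
  (cvg_comp fst fst cvg_fst); exact: cvg_fst.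
have c2 : szy.1.2 @[szy --> (s, z, y)] --> z by apply:
  (cvg_comp fst snd cvg_fst); exact: cvg_snd.
have c3 : szy.2 @[szy --> (s, z, y)] --> y by exact: cvg_snd.
apply: cvgM.
  apply: cvgB; first by rewrite !expr2; apply: cvgM.
  exact: (cvg_comp _ _ c2 (@continuous_sqmod R z)).
apply: cvgV; first by rewrite gt_eqF// sqmod_gt0.
have c4 : szy.2 - szy.1.2 @[szy --> (s, z, y)] --> y - z by exact: cvgB.
exact: (cvg_comp _ _ c4 (@continuous_sqmod R (y - z))).
Qed.

Lemma poisson_joint_disk (r : R) : 0 < r ->
  {within disk r `*` boundary (disk r),
    continuous (fun zy : plane R * plane R => poisson r zy.1 zy.2)}.
Proof.
move=> r0; rewrite boundary_disk//; apply: continuous_in_subspaceT => -[z y].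
rewrite inE => -[/= zr yr].
have H := continuous_poisson_joint (s := r) (disk_circle_neq zr yr).
have inj : (r, zy.1, zy.2) @[zy --> (z, y)] --> (r, z, y).
  have a0 : r @[_ --> (z, y)] --> r by exact: cvg_cst.
  have a1 : zy.1 @[zy --> (z, y)] --> z by exact: cvg_fst.
  have a2 : zy.2 @[zy --> (z, y)] --> y by exact: cvg_snd.
  exact: (cvg_pair (cvg_pair a0 a1) a2).
exact: (cvg_comp _ _ inj H).
Qed.

End disks_are_regular.

(** * Minimality of the Poisson kernel *)

Section minimality.
Context {R : realType}.
Variables (r : R) (r0 : 0 < r) (y0 : plane R) (y0r : circle r y0).
Implicit Types (z y : plane R) (v : plane R -> R).

Section representation_on_smaller_disk.
Variables (v : plane R -> R) (hv : harmonic_on (disk r) v).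
Hypothesis v_le : forall z, disk r z -> 0 <= v z <= poisson r z y0.
Variables (s : R) (s0 : 0 < s) (sr : s < r).

Let sub : closure (disk s) `<=` (disk r : set (plane R)).
Proof. exact: closure_disk_subset. Qed.

Let cv : {within closure (disk s), continuous v}.
Proof.
apply: continuous_in_subspaceT => z /[!inE] /sub zr.
by have [[[cv _] _] _] := hv; exact: cv.
Qed.

Let hvs : harmonic_on (disk s) v.
Proof. by apply: harmonic_subset hv => z /subset_closure /sub. Qed.

Let circle_sub y : circle s y -> disk r y.
Proof. by move=> ys; apply: sub; rewrite closure_disk//= ys. Qed.

(** Quantitative form of the concentration at [y0]: on the circle of radius [s]
    the function [v] is dominated by the Poisson kernel with pole [y0], hence is
    at most (r ^ 2 - s ^ 2) / d at square distance at least [d] from [y0]. *)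
Lemma poisson_representation_smaller z (M e d : R) : disk s z ->
  0 <= e -> 0 < d -> 0 <= M ->
  (forall y, circle s y -> `|poisson s z y - poisson r z y0| <= M) ->
  (forall y, circle s y -> sqmod (y0 - y) < d ->
    `|poisson s z y - poisson r z y0| <= e) ->
  `|v z - poisson r z y0 * v origin| <= e * v origin + M *
    ((r ^+ 2 - s ^+ 2) / d).
Proof.
move=> zs e0 d0 M0 PM Pe.
have rep := poisson_representation s0 cv hvs.
have mC := measurable_circle s.
have cC := within_continuous_circle s0 cv.
have mv := measurable_within_circle cC.
have [W vW] := circle_bounded s0 cC.
have v0 : v origin = \int[sigma s]_(y in circle s) v y.
  rewrite rep; last exact: origin_disk.
  by apply: eq_Rintegral => y /[!inE] ys; rewrite poisson_origin// mulr1.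
have vz : v z = \int[sigma s]_(y in circle s) (poisson s z y * v y).
  by rewrite rep//; apply: eq_Rintegral => y _; rewrite mulrC.
have eta0 : 0 <= (r ^+ 2 - s ^+ 2) / d.
  by rewrite divr_ge0 ?(ltW d0)// subr_ge0 lerXn2r ?nnegrE ?ltW.
rewrite vz v0.
apply: (@approximate_identity _ _ R (sigma s) (circle s)
  [set y | sqmod (y0 - y) < d] (poisson s z) v (poisson r z y0) e _ M W) => //.
- exact: measurable_poisson.
- move=> y ys; have /andP[-> _] := v_le (circle_sub ys).
  by rewrite (le_trans (ler_norm _))// vW.
- move=> y ys /negP; rewrite -leNgt => dy.
  have /andP[_ vy] := v_le (circle_sub ys); rewrite (le_trans vy)// /poisson ys.
  rewrite ler_wpM2l//; first by rewrite subr_ge0 lerXn2r ?nnegrE ?ltW.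
  by rewrite lef_pV2 ?posrE// (lt_le_trans d0).
Qed.

End representation_on_smaller_disk.

(** In the Poisson representation of [v] on the disk of radius [s], the measure
    with density [v] has mass [v origin] and concentrates at [y0] as [s] tends
    to [r]; the kernel in front of it can be replaced by its value there. *)
Lemma minimal_representation v : harmonic_on (disk r) v ->
  (forall z, disk r z -> 0 <= v z <= poisson r z y0) ->
  forall z, disk r z -> v z = v origin * poisson r z y0.
Proof.
move=> hv v_le z zr.
have /andP[v0 _] := v_le _ (origin_disk r0).
set c := poisson r z y0; set q := Num.sqrt (sqmod z).
have qr : q < r by rewrite -subr_gt0; exact: disk_sqrt.
have q0 : 0 <= q by exact: sqrtr_ge0.
have c0 : 0 <= c by rewrite ltW// poisson_gt0.
suff H e : 0 < e -> `|v z - c * v origin| <= e * (v origin + 1).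
  rewrite [RHS]mulrC; apply/eqP; rewrite -subr_eq0 -normr_le0.
  apply/ler_addgt0Pr => e e0; rewrite add0r.
  have V1 : 0 < v origin + 1 by rewrite ltr_wpDl.
  rewrite (le_trans (H (e / (v origin + 1)) _)) ?divr_gt0//.
  by rewrite divfK// gt_eqF.
move=> e0.
have yz := disk_circle_neq zr y0r.
have : {for (r, y0), continuous (fun sy : R * plane R => poisson sy.1 z sy.2)}.
  have inj : (sy.1, z, sy.2) @[sy --> (r, y0)] --> (r, z, y0).
    have a0 : sy.1 @[sy --> (r, y0)] --> r by exact: cvg_fst.
    have a1 : z @[_ --> (r, y0)] --> z by exact: cvg_cst.
    have a2 : sy.2 @[sy --> (r, y0)] --> y0 by exact: cvg_snd.
    exact: (cvg_pair (cvg_pair a0 a1) a2).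
  exact: (cvg_comp _ _ inj (continuous_poisson_joint (s := r) yz)).
move=> /cvgrPdist_le/(_ e e0)[[Q1 Q2] /= [Q1r /nbhs_sqmod[d d0 dQ2]] QQ].
(* radii above s1 keep away from [z], so that the kernels stay below M *)
pose s1 := (r + q) / 2.
have s1r : s1 < r by rewrite /s1; lra.
have qs1 : q < s1 by rewrite /s1; lra.
pose M := r ^+ 2 / (s1 - q) ^+ 2 + c.
have M0 : 0 < M.
  by rewrite ltr_pwDl// divr_gt0// exprn_gt0// subr_gt0.
have [s [s1s sr Qs seta]] : exists s, [/\ s1 < s, s < r, Q1 s &
    M * ((r ^+ 2 - s ^+ 2) / d) <= e].
  have cs : r ^+ 2 - s ^+ 2 @[s --> r] --> 0.
    rewrite -(subrr (r ^+ 2)); apply: cvgB; first exact: cvg_cst.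
    by rewrite !expr2; apply: cvgM; exact: cvg_id.
  have ed : 0 < e * d / M by rewrite divr_gt0// mulr_gt0.
  have n1 : \forall s \near r^'-, s < r by exact: nbhs_left_lt.
  have n2 : \forall s \near r^'-, s1 < s by exact: nbhs_left_gt.
  have n3 : \forall s \near r^'-, Q1 s by apply: cvg_within.
  have n4 : \forall s \near r^'-, r ^+ 2 - s ^+ 2 < e * d / M.
    by apply: cvg_within; exact: (cvgr_lt _ cs).
  near r^'- => s; exists s; split; [by near: s..|].
  rewrite mulrA ler_pdivrMr// mulrC -ler_pdivlMr// ltW//.
  by near: s.
have s0 : 0 < s by rewrite (le_lt_trans q0)// (lt_trans qs1).
have zs : disk s z.
  rewrite /disk/= -(sqr_sqrtr (sqmod_ge0 z)) ltrXn2r ?nnegrE ?(ltW s0)//.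
  by rewrite -/q (lt_trans qs1).
have PM y : circle s y -> `|poisson s z y - c| <= M.
  move=> ys; rewrite (le_trans (ler_normB _ _))// /M lerD ?(ger0_norm c0)//.
  rewrite ger0_norm; last by rewrite ltW// poisson_gt0.
  rewrite (le_trans (poisson_bound s0 zs ys))// -/q ler_pM//.
  - by rewrite exprn_ge0// ltW.
  - by rewrite invr_ge0 exprn_ge0// subr_ge0 ltW// (lt_trans qs1).
  - by apply: lerXn2r; rewrite ?nnegrE; apply: ltW.
  - rewrite lef_pV2 ?posrE ?exprn_gt0 ?subr_gt0// ?(lt_trans qs1)//.
    apply: lerXn2r; rewrite ?nnegrE ?subr_ge0 ?lerD2r; apply: ltW => //.
    exact: lt_trans qs1 s1s.
have Pe y : circle s y -> sqmod (y0 - y) < d -> `|poisson s z y - c| <= e.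
  move=> ys yd; rewrite distrC; apply: (QQ (s, y)); split => //=.
  apply: dQ2; move: yd; rewrite /sqmod/= -sqrrN opprB -[X in _ + X < _]sqrrN
    opprB//.
rewrite (le_trans (poisson_representation_smaller hv v_le s0 sr zs
  (ltW e0) d0 (ltW M0) PM Pe))//.
by rewrite mulrDr mulr1 lerD2l.
Unshelve. all: by end_near. Qed.

Lemma minimal_poisson :
  minimal_positive_harmonic (disk r) (fun z => poisson r z y0).
Proof.
split.
- exact: harmonic_poisson.
- by move=> z zr; exact: poisson_gt0.
- move=> v hv v_le; exists (v origin); last exact: minimal_representation.
  by have := v_le _ (origin_disk r0); rewrite poisson_origin.
Qed.

End minimality.

(** * A parametrization of the circle adapted to h *)

Section mobius_curve.
Context {R : realType}.
Implicit Types (s q u t : R).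

(** The automorphism of the unit disk that fixes 1 and -1 and sends 0 to [s]
    multiplies the tangent of half the angle by this factor. *)
Definition moebius_ratio s : R := (1 - s) / (1 + s).

(** The point [s e^(it)] with tan (t / 2) = moebius_ratio s * tan u, written
    without tangents so that it is smooth for all [u]. *)
Definition moebius_curve s u : plane R :=
  (s * ((cos u ^+ 2 - (moebius_ratio s * sin u) ^+ 2) / (cos u ^+ 2 +
    (moebius_ratio s * sin u) ^+ 2)),
   s * (2 * moebius_ratio s * sin u * cos u / (cos u ^+ 2 +
     (moebius_ratio s * sin u) ^+ 2))).

(** The same point in terms of q = tan u. *)
Definition slope_point s q : plane R :=
  (s * ((1 - (moebius_ratio s * q) ^+ 2) / (1 + (moebius_ratio s * q) ^+ 2)),
   s * (2 * (moebius_ratio s * q) / (1 + (moebius_ratio s * q) ^+ 2))).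

Lemma moebius_ratio_gt0 s : 0 < s < 1 -> 0 < moebius_ratio s.
Proof. by move=> /andP[s0 s1]; rewrite divr_gt0// ?subr_gt0// addr_gt0. Qed.

Lemma moebius_curve_den_gt0 s u : 0 < s < 1 ->
  0 < cos u ^+ 2 + (moebius_ratio s * sin u) ^+ 2.
Proof.
move=> s01; have k0 := moebius_ratio_gt0 s01.
have [c0|c0] := eqVneq (cos u) 0.
  have s2 : sin u ^+ 2 = 1 by rewrite -(cos2Dsin2 u) c0 expr0n add0r.
  by rewrite c0 expr0n add0r exprMn s2 mulr1 exprn_gt0.
by rewrite ltr_pwDl ?sqr_ge0// exprn_even_gt0.
Qed.

Lemma moebius_curve_slope s u : cos u != 0 -> moebius_curve s u =
  slope_point s (tan u).
Proof.
move=> c0; rewrite /moebius_curve /slope_point /tan.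
have D0 : cos u ^+ 2 + (moebius_ratio s * sin u) ^+ 2 != 0.
  by rewrite gt_eqF// ltr_pwDl ?sqr_ge0// exprn_even_gt0.
by congr (_, _); field; rewrite c0 D0.
Qed.

Lemma slope_point_circle s q : circle s (slope_point s q).
Proof.
rewrite /circle/=/slope_point/sqmod/=; field.
by rewrite gt_eqF// ltr_pwDl ?sqr_ge0.
Qed.

Lemma moebius_curve_circle s u : 0 < s < 1 -> circle s (moebius_curve s u).
Proof.
move=> s01; have := moebius_curve_den_gt0 u s01;
  rewrite /circle/=/moebius_curve/sqmod/= => D0.
by field; rewrite gt_eqF.
Qed.

Lemma circle_disk1 s y : 0 < s < 1 -> circle s y -> disk 1 y.
Proof.
by move=> /andP[s0 s1]; rewrite /circle/disk/= => ->;
  rewrite ltrXn2r ?nnegrE ?(ltW s0).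
Qed.

Lemma jmap_slope s q : 0 < s < 1 -> jmap (slope_point s q) =
  (slope_point s q, atan (2 * s / (1 + s) * (q /
    (1 + moebius_ratio s * q ^+ 2)))).
Proof.
move=> s01; have k0 := moebius_ratio_gt0 s01; have /andP[s0 s1] := s01.
rewrite /jmap; congr (_, atan _) => /=.
have D1 : 1 + (moebius_ratio s * q) ^+ 2 != 0 by rewrite gt_eqF// ltr_pwDl
  ?sqr_ge0.
have D2 : 1 + moebius_ratio s * q ^+ 2 != 0 by rewrite gt_eqF// ltr_pwDl//
  mulr_ge0 ?sqr_ge0// ltW.
have s11 : 1 + s != 0 by rewrite gt_eqF// addr_gt0.
have s12 : 1 - s != 0 by rewrite gt_eqF// subr_gt0.
have kE : moebius_ratio s * (1 + s) = 1 - s by rewrite /moebius_ratio divfK.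
have -> : 1 - s * ((1 - (moebius_ratio s * q) ^+ 2) / (1 +
  (moebius_ratio s * q) ^+ 2)) =
    (1 - s) * (1 + moebius_ratio s * q ^+ 2) / (1 + (moebius_ratio s * q) ^+ 2).
  transitivity ((1 - s + moebius_ratio s * (moebius_ratio s *
    (1 + s)) * q ^+ 2) / (1 + (moebius_ratio s * q) ^+ 2)).
    by field.
  by rewrite kE; field.
rewrite -kE; have kn0 : moebius_ratio s != 0 by rewrite gt_eqF.
move: D1 D2 kn0; move: (moebius_ratio s) => k D1 D2 kn0.
by field; rewrite D1 D2 kn0 s11.
Qed.

(** By the formula for [poisson_primitive], this is t / 2 plus the second
    coordinate of [jmap (circ s t)]. *)
Definition half_h_primitive s t : R := poisson_primitive s 0 t / 2.

Lemma half_h_primitive_pi s : half_h_primitive s pi = pi / 2.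
Proof. by rewrite /half_h_primitive /poisson_primitive sinpi !(mulr0, mul0r,
  subr0, atan0). Qed.

Lemma half_h_primitive_Npi s : half_h_primitive s (- pi) = - (pi / 2).
Proof.
by rewrite /half_h_primitive /poisson_primitive sinN sinpi oppr0 !(mulr0,
  mul0r, subr0, atan0) mulNr.
Qed.

(** Up to a common positive factor, the cosine and the sine of
    [half_h_primitive s t] are (1 - s) cos (t / 2) and (1 + s) sin (t / 2), and
    [moebius_curve] is homogeneous of degree 0 in the cosine and the sine. *)
Lemma moebius_curve_half_h_primitive s t : 0 < s < 1 ->
  moebius_curve s (half_h_primitive s t) = circ s t.
Proof.
move=> s01; have /andP[s0 s1] := s01.
(* everything is expressed through the half angle *)
pose C := cos (t / 2); pose S := sin (t / 2).
have CS : C ^+ 2 + S ^+ 2 = 1 by rewrite cos2Dsin2.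
have t2 : t = t / 2 *+ 2 by rewrite -mulr_natr divfK.
have cost : cos t = C ^+ 2 - S ^+ 2.
  by rewrite {1}t2 cos_mulr2n -/C -CS mulr2n; ring.
have sint : sin t = 2 * S * C by rewrite {1}t2 sin_mulr2n -/C -/S mulr2n; ring.
have d0 : 0 < 1 - s * cos t.
  rewrite subr_gt0 (le_lt_trans _ s1)// -[leRHS]mulr1.
  by apply: ler_wpM2l; [exact: ltW|exact: cos_le1].
pose x := s * sin t / (1 - s * cos t).
have primitiveE : half_h_primitive s t = t / 2 + atan x.
  rewrite /half_h_primitive /poisson_primitive !mul0r addr0 sub0r mulNr atanN
    -/x.
  by field.
(* the common factor of the cosine and the sine *)
pose g := (cos (atan x)) / (1 - s * cos t).
have ca0 : cos (atan x) != 0.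
  by rewrite gt_eqF// cos_gt0_pihalf// atan_gtNpi2 atan_ltpi2.
have g0 : g != 0 by rewrite /g mulf_neq0// invr_neq0// gt_eqF.
have sa : sin (atan x) = x * cos (atan x).
  by rewrite -{2}(atanK x) /tan divfK.
have dn0 : 1 - s * cos t != 0 by rewrite gt_eqF.
have cP : cos (half_h_primitive s t) = g * ((1 - s) * C).
  rewrite primitiveE cosD sa -/C -/S.
  transitivity (g * (C * (1 - s * cos t) - S * (s * sin t))).
    by rewrite /g /x; field.
  congr (_ * _); rewrite cost sint.
  transitivity (C - s * C * (C ^+ 2 + S ^+ 2)); first by ring.
  by rewrite CS; ring.
have sP : sin (half_h_primitive s t) = g * ((1 + s) * S).
  rewrite primitiveE sinD sa -/C -/S.
  transitivity (g * (S * (1 - s * cos t) + C * (s * sin t))).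
    by rewrite /g /x; field.
  congr (_ * _); rewrite cost sint.
  transitivity (S + s * S * (C ^+ 2 + S ^+ 2)); first by ring.
  by rewrite CS; ring.
have ksP : moebius_ratio s * sin (half_h_primitive s t) = g * ((1 - s) * S).
  by rewrite sP /moebius_ratio; field; rewrite gt_eqF// addr_gt0.
have DP : cos (half_h_primitive s t) ^+ 2 + (moebius_ratio s * sin
  (half_h_primitive s t)) ^+ 2 = (g * (1 - s)) ^+ 2.
  by rewrite cP ksP -[RHS]mulr1 -CS; ring.
have s1n : 1 - s != 0 by rewrite gt_eqF// subr_gt0.
rewrite /moebius_curve DP -[2 * moebius_ratio s * _ * _](_ : 2 *
  (moebius_ratio s * sin (half_h_primitive s t)) * cos
    (half_h_primitive s t) = _); last by ring.
rewrite ksP cP /circ; congr (_ * _, _ * _).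
- by rewrite cost; field; rewrite s1n g0.
- by rewrite sint; field; rewrite s1n g0.
Qed.

Lemma continuous_moebius_curve s : 0 < s < 1 -> continuous (moebius_curve s).
Proof.
move=> s01 u; have D0 := moebius_curve_den_gt0 u s01.
have cc : cos v @[v --> u] --> cos u by exact: continuous_cos.
have cs : sin v @[v --> u] --> sin u by exact: continuous_sin.
have c1 : cos v ^+ 2 @[v --> u] --> cos u ^+ 2.
  by under eq_fun do rewrite expr2; rewrite expr2; exact: cvgM.
have c2 : (moebius_ratio s * sin v) ^+ 2 @[v --> u] -->
  (moebius_ratio s * sin u) ^+ 2.
  under eq_fun do rewrite expr2.
  by rewrite expr2; apply: cvgM; apply: cvgM => //; exact: cvg_cst.
have c3 : (cos v ^+ 2 + (moebius_ratio s * sin v) ^+ 2)^-1 @[v --> u] -->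
    (cos u ^+ 2 + (moebius_ratio s * sin u) ^+ 2)^-1.
  by apply: cvgV; [rewrite gt_eqF|exact: cvgD].
have A : (moebius_curve s v).1 @[v --> u] --> (moebius_curve s u).1.
  by apply: cvgM; [exact: cvg_cst|apply: cvgM => //; exact: cvgB].
have B : (moebius_curve s v).2 @[v --> u] --> (moebius_curve s u).2.
  apply: cvgM; first exact: cvg_cst.
  by apply: cvgM => //; apply: cvgM => //; apply: cvgM => //; exact: cvg_cst.
exact: (cvg_pair A B).
Qed.

Lemma hfun_circ s t : hfun (circ s t) = poisson_density s 0 t.
Proof.
rewrite /hfun /poisson_density circ_circle; congr (_ / _);
  first by rewrite expr0n/= subr0.
by rewrite /sqmod /circ /pt1/= !mul0r addr0 sub0r.
Qed.

Lemma half_h_primitive_homo s : 0 < s < 1 -> {homo half_h_primitive s : x y /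
  x < y}.
Proof.
move=> /andP[s0 s1] x y xy; rewrite /half_h_primitive ltr_pM2r ?invr_gt0//.
have s21 : s ^+ 2 + 0 ^+ 2 < 1 by rewrite expr0n/= addr0 expr_lt1// ltW.
have dP z : z \in `]x, y[ -> is_derive z 1 (poisson_primitive s 0)
  (poisson_density s 0 z).
  by move=> _; exact: is_derive_poisson_primitive.
have cP : {within `[x, y], continuous (poisson_primitive s 0)}.
  by apply: continuous_subspaceT => z; exact: poisson_primitive_continuous.
have [c _ E] := MVT xy dP cP.
by rewrite -subr_gt0 E mulr_gt0 ?subr_gt0// poisson_density_gt0.
Qed.

End mobius_curve.

Section substitution.
Context {R : realType}.
Variables (s : R) (s01 : 0 < s < 1).

Let s21 : s ^+ 2 + 0 ^+ 2 < 1.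
Proof. by have /andP[s0 s1] := s01; rewrite expr0n/= addr0 expr_lt1// ltW. Qed.

Lemma is_derive_half_h_primitive (t : R) : is_derive t 1 (half_h_primitive s)
  (poisson_density s 0 t / 2).
Proof.
have d := is_derive_poisson_primitive s21 t.
have -> : half_h_primitive s = (fun t => poisson_primitive s 0 t * 2^-1) by [].
by apply: is_derive_eq; rewrite /GRing.scale/=; ring.
Qed.

Lemma derive1_half_h_primitive : (half_h_primitive s)^`()%classic = (fun t =>
  poisson_density s 0 t / 2).
Proof. by apply/funext => t; rewrite derive1E;
  have [_ ->] := is_derive_half_h_primitive t. Qed.

Lemma continuous_half_h_primitive : continuous (half_h_primitive s).
Proof.
move=> t; have [dt _] := is_derive_half_h_primitive t.
exact/differentiable_continuous/derivable1_diffP.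
Qed.

(** The substitution u = half_h_primitive s t. *)
Lemma substitution_half_h_primitive (G : R -> R) : continuous G ->
  (\int[lebesgue_measure]_(u in [set` `[- (pi / 2), pi / 2]%R]) (G u)%:E =
   \int[lebesgue_measure]_(t in [set` `[- pi, pi]%R])
     (G (half_h_primitive s t) * (poisson_density s 0 t / 2))%:E)%E.
Proof.
move=> cG.
have cd (t : R) : poisson_density s 0 v / 2 @[v --> t] --> poisson_density s 0
  t / 2.
  by apply: cvgM; [exact: poisson_density_continuous|exact: cvg_cst].
rewrite -(half_h_primitive_Npi s) -(half_h_primitive_pi s)
  (@integration_by_substitution_increasing _ (half_h_primitive s) G).
- by apply: eq_integral => t _; rewrite derive1_half_h_primitive.
- by rewrite ge0_cp// pi_ge0.
- by move=> x y _ _; exact: half_h_primitive_homo.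
- by move=> t _; rewrite derive1_half_h_primitive; exact: cd.
- by rewrite derive1_half_h_primitive; apply/cvg_ex;
    exists (poisson_density s 0 (- pi) / 2); exact/cvg_at_right_filter/cd.
- by rewrite derive1_half_h_primitive; apply/cvg_ex;
    exists (poisson_density s 0 pi / 2); exact/cvg_at_left_filter/cd.
- split.
  + by move=> t _; have [] := is_derive_half_h_primitive t.
  + by apply: cvg_at_right_filter; exact: continuous_half_h_primitive.
  + by apply: cvg_at_left_filter; exact: continuous_half_h_primitive.
- exact: continuous_subspaceT.
Qed.

End substitution.

(** * The compactification of the disk *)

Section compactification_facts.
Context {R : realType}.
Implicit Types (z y : plane R).

Lemma jmap_Dhat z : disk 1 z -> Dhat (jmap z).
Proof. by move=> zd; apply: subset_closure; exists z. Qed.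

Lemma closed_Dhat : closed (@Dhat R).
Proof. exact: closed_closure. Qed.

Lemma measurable_Dhat : measurable (@Dhat R).
Proof. exact: closed_measurable_planeR closed_Dhat. Qed.

(** The image of [jmap] lies in the product of the square and of the range of
    the arctangent. *)
Lemma compact_Dhat : compact (@Dhat R).
Proof.
have cpt : compact ((`[-1, 1] `*` `[-1, 1] `*` `[- (pi / 2),
  pi / 2])%classic : set (plane R * R)).
  by apply: compact_setX; [apply: compact_setX|]; exact: segment_compact.
apply: (subclosed_compact closed_Dhat cpt).
have cl := compact_closed (@norm_hausdorff _ _) cpt.
rewrite [X in _ `<=` X](closure_id _).1//; apply: closure_subset => _ [z zd <-].
have b (a c : R) : a ^+ 2 + c ^+ 2 < 1 ^+ 2 -> -1 <= a <= 1.
  move=> ac; rewrite -ler_norml -(@ler_pXn2r _ 2)// ?nnegrE// real_normK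
    ?num_real//.
  by rewrite (le_trans _ (ltW ac))// lerDl sqr_ge0.
split; first split => /=; rewrite /= in_itv/=.
- exact: b zd.
- by apply: (b _ z.1); rewrite addrC; exact: zd.
- by rewrite !ltW// ?atan_gtNpi2 ?atan_ltpi2.
Qed.

Lemma Dhat_bounded (phi : plane R * R -> R) : {within @Dhat R,
  continuous phi} ->
  exists2 M : R, 0 <= M & forall eta, Dhat eta -> `|phi eta| <= M.
Proof.
move=> cphi; have cn : {within @Dhat R, continuous (fun eta => `|phi eta|)}.
  by move=> eta; apply: cvg_norm; exact: cphi.
have D0 : @Dhat R !=set0.
  by exists (jmap origin); apply: jmap_Dhat; exact: origin_disk.
have [c _ cM] := compact_EVT_max D0 compact_Dhat cn.
by exists `|phi c| => // eta Deta; apply: cM; rewrite inE.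
Qed.

Lemma within_continuous_comp (X T : topologicalType) (A : set X) (D : set T)
    (g : X -> T) (phi : T -> R) :
  (forall x, A x -> g @ x --> g x) -> (forall x, A x -> D (g x)) ->
  {within D, continuous phi} -> {within A, continuous (phi \o g)}.
Proof.
move=> cg AD /subspace_continuousP cphi; apply/subspace_continuousP => x Ax.
have H : g w @[w --> within A (nbhs x)] `=>` within D (nbhs (g x)).
  move=> V DV; have H0 : nbhs x (fun w => D (g w) ->
    V (g w)) by exact: (cg x Ax _ DV).
  suff : nbhs x (fun w => A w -> V (g w)) by [].
  by apply: filterS H0 => w gV Aw; exact: gV (AD w Aw).
exact: (cvg_comp _ _ H (cphi _ (AD x Ax))).
Qed.

Lemma continuous_jmap z : disk 1 z -> {for z, continuous (@jmap R)}.
Proof.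
move=> zd.
have z1 : 1 - z.1 != 0.
  rewrite subr_eq0; apply/eqP => z1; move: zd;
    rewrite /disk/=/sqmod -z1 !expr1n.
  by rewrite gtrDl ltNge sqr_ge0.
have c1 : w.1 @[w --> z] --> z.1 by exact: cvg_fst.
have c2 : w.2 @[w --> z] --> z.2 by exact: cvg_snd.
have c3 : w.2 / (1 - w.1) @[w --> z] --> z.2 / (1 - z.1).
  apply: cvgM => //; apply: cvgV => //.
  by apply: cvgB => //; exact: cvg_cst.
have c4 := cvg_comp _ _ c3 (@continuous_atan R _).
exact: (cvg_pair cvg_id c4).
Qed.

End compactification_facts.

(** * Limits in the fibre over 1 *)

Section approach.
Context {R : realType}.
Variables (s_ : nat -> R) (s01 : forall n, 0 < s_ n < 1).
Hypothesis s_cvg : s_ n @[n --> \oo] --> (1 : R).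

Lemma cvg_moebius_ratio : moebius_ratio (s_ n) @[n --> \oo] --> (0 : R).
Proof.
rewrite (_ : 0 = (1 - 1) * (1 + 1)^-1); last by rewrite subrr mul0r.
apply: cvgM; first by apply: cvgB => //; exact: cvg_cst.
by apply: cvgV => //; apply: cvgD => //; exact: cvg_cst.
Qed.

(** A slope that grows slower than 1 / (1 - s) does not prevent the point from
    tending to 1. *)
Lemma cvg_slope_point (q_ : nat -> R) :
  moebius_ratio (s_ n) * q_ n @[n --> \oo] --> (0 : R) ->
  slope_point (s_ n) (q_ n) @[n --> \oo] --> (pt1 : plane R).
Proof.
move=> e0.
have e2 : (moebius_ratio (s_ n) * q_ n) ^+ 2 @[n --> \oo] --> (0 : R).
  by under eq_fun do rewrite expr2; rewrite -(mulr0 0); exact: cvgM.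
have e3 : (1 + (moebius_ratio (s_ n) * q_ n) ^+ 2)^-1 @[n --> \oo] --> (1 : R).
  rewrite -[X in _ --> X]invr1; apply: cvgV => //.
  by rewrite -[X in _ --> X]addr0; apply: cvgD => //; exact: cvg_cst.
have A : s_ n * ((1 - (moebius_ratio (s_ n) * q_ n) ^+ 2) / (1 +
  (moebius_ratio (s_ n) * q_ n) ^+ 2))
    @[n --> \oo] --> (1 * ((1 - 0) * 1) : R).
  by apply: cvgM => //; apply: cvgM => //; apply: cvgB => //; exact: cvg_cst.
have B : s_ n * (2 * (moebius_ratio (s_ n) * q_ n) / (1 + (moebius_ratio
  (s_ n) * q_ n) ^+ 2))
    @[n --> \oo] --> (1 * (2 * 0 * 1) : R).
  by apply: cvgM => //; apply: cvgM => //; apply: cvgM => //; exact: cvg_cst.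
have -> : (pt1 : plane R) = (1 * ((1 - 0) * 1), 1 * (2 * 0 * 1)).
  by rewrite /pt1; congr (_, _); ring.
exact: (cvg_pair A B).
Qed.

Lemma cvg_slope_factor : 2 * s_ n / (1 + s_ n) @[n --> \oo] --> (1 : R).
Proof.
have H : 2 * s_ n / (1 + s_ n) @[n --> \oo] --> (2 * 1 / (1 + 1) : R).
  apply: cvgM; first by apply: cvgM => //; exact: cvg_cst.
  by apply: cvgV => //; apply: cvgD => //; exact: cvg_cst.
by move: H; rewrite mulr1 divff.
Qed.

Lemma cvg_jmap_slope (q alpha : R) : alpha = atan q ->
  jmap (slope_point (s_ n) q) @[n --> \oo] --> xi alpha.
Proof.
move=> ->; under eq_fun do rewrite jmap_slope//.
have kq : moebius_ratio (s_ n) * q @[n --> \oo] --> (0 : R).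
  by rewrite -(mul0r q); apply: cvgM; [exact: cvg_moebius_ratio|exact: cvg_cst].
have A := cvg_slope_point (q_ := fun=> q) kq.
have C : 2 * s_ n / (1 + s_ n) * (q / (1 + moebius_ratio
  (s_ n) * q ^+ 2)) @[n --> \oo] --> q.
  rewrite -[X in _ --> X]mul1r; apply: cvgM; first exact: cvg_slope_factor.
  rewrite -[X in _ --> X]mulr1; apply: cvgM; first exact: cvg_cst.
  rewrite -[X in _ --> X]invr1; apply: cvgV => //.
  rewrite -[X in _ --> X]addr0; apply: cvgD; first exact: cvg_cst.
  by rewrite -(mul0r (q ^+ 2)); apply: cvgM; [exact: cvg_moebius_ratio|exact:
    cvg_cst].
exact: (cvg_pair A (cvg_comp _ _ C (@continuous_atan R q))).
Qed.

Lemma cvg_jmap_moebius_curve (u : R) : - (pi / 2) < u < pi / 2 ->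
  jmap (moebius_curve (s_ n) u) @[n --> \oo] --> xi u.
Proof.
move=> u2; have cu : cos u != 0 by rewrite gt_eqF// cos_gt0_pihalf.
under eq_fun do rewrite moebius_curve_slope//.
by apply: cvg_jmap_slope; rewrite tanK// in_itv.
Qed.

End approach.

Section fibre.
Context {R : realType}.

(** The end points of the fibre are limits of its interior points. *)
Lemma xi_Dhat_interior (u : R) : - (pi / 2) < u < pi / 2 -> Dhat (xi u).
Proof.
(* radii in ]0, 1[ tending to 1 *)
move=> u2; pose s_ (n : nat) : R := 1 - n.+2%:R^-1.
have s01 n : 0 < s_ n < 1.
  by rewrite subr_gt0 gtrBl invr_gt0 ltr0Sn andbT invf_lt1// ltr1n.
have s_cvg : s_ n @[n --> \oo] --> (1 : R).
  rewrite -[X in _ --> X]subr0; apply: cvgB; first exact: cvg_cst.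
  have := @cvg_harmonic R; rewrite -(cvg_shiftS (@harmonic R)); exact.
have nD : \forall n \near \oo, Dhat (jmap (moebius_curve (s_ n) u)).
  apply: nearW => n; apply: jmap_Dhat; apply: (circle_disk1 (s01 n)).
  exact: moebius_curve_circle.
exact: (@closed_cvg _ _ _ _ _ Dhat closed_Dhat nD _
  (cvg_jmap_moebius_curve s01 s_cvg u2)).
Qed.

Lemma xi_Dhat (u : R) : - (pi / 2) <= u <= pi / 2 -> Dhat (xi u).
Proof.
move=> /andP[u1 u2].
have p0 : 0 < pi / 2 :> R by rewrite divr_gt0// pi_gt0.
have c : xi (t * u) @[t --> (1 : R)^'-] --> xi u.
  have c1 : t * u @[t --> (1 : R)^'-] --> u.
    apply: cvg_at_left_filter; rewrite -[X in _ --> X]mul1r.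
    by apply: cvgM; [exact: cvg_id|exact: cvg_cst].
  have c0 : (pt1 : plane R) @[_ --> (1 : R)^'-] -->
    (pt1 : plane R) by exact: cvg_cst.
  exact: (cvg_pair c0 c1).
suff nD : \forall t \near (1 : R)^'-, Dhat (xi (t * u)).
  exact: (@closed_cvg _ _ _ _ _ Dhat closed_Dhat nD _ c).
near=> t; apply: xi_Dhat_interior.
have t1 : t < 1 by near: t; exact: nbhs_left_lt.
have t0 : 0 < t by near: t; exact: nbhs_left_gt.
have : `|t * u| < pi / 2.
  rewrite normrM gtr0_norm//.
  have u3 : `|u| <= pi / 2 by rewrite ler_norml u1.
  by rewrite (le_lt_trans (ler_wpM2l (ltW t0) u3))// gtr_pMl.
by rewrite ltr_norml.
Unshelve. all: by end_near. Qed.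

Lemma xi_Ffib (u : R) : - (pi / 2) <= u <= pi / 2 -> Ffib (xi u).
Proof. by move=> u2; split; [exact: xi_Dhat|]. Qed.

Lemma measurable_Ffib : measurable (@Ffib R).
Proof.
apply: measurableI; first exact: measurable_Dhat.
have m1 : measurable ([set pt1] : set (plane R)).
  rewrite (_ : [set pt1] = [set 1] `*` [set 0]); last first.
    by apply/seteqP; split => [_ ->|[a b] [/= -> ->]].
  by apply: measurableX; exact: measurable_set1.
rewrite -[X in measurable X]setTI.
exact: (@measurable_fst _ _ (plane R) R measurableT _ m1).
Qed.

End fibre.

(** * The weak limit *)

Section weak_limit.
Context {R : realType}.
Local Notation leb := (@lebesgue_measure R).
Local Notation I := ([set` `](- (pi / 2)), (pi / 2)[%R] : set R).

Lemma continuous_comp_moebius_curve (phi : plane R * R -> R) (s : R) :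
  {within @Dhat R, continuous phi} -> 0 < s < 1 ->
  continuous (fun u => phi (jmap (moebius_curve s u))).
Proof.
move=> cphi s01.
have H : {within setT, continuous (phi \o (fun u => jmap (moebius_curve s u)))}.
  apply: within_continuous_comp cphi => u _.
    have cd : disk 1 (moebius_curve s u) by exact/(circle_disk1
      s01)/moebius_curve_circle.
    have cc : moebius_curve s v @[v --> u] --> moebius_curve s u by exact:
      continuous_moebius_curve.
    exact: (cvg_comp _ _ cc (continuous_jmap cd)).
  by apply: jmap_Dhat; exact/(circle_disk1 s01)/moebius_curve_circle.
move=> u V Vu; move/subspace_continuousP : H => /(_ u Logic.I V Vu) H.
have {}H : nbhs u (fun w => setT w -> V (phi (jmap
  (moebius_curve s w)))) by exact: H.
suff : nbhs u (fun w => V (phi (jmap (moebius_curve s w)))) by [].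
by apply: filterS H => w; exact.
Qed.

(** In the variable u = half_h_primitive s t, the density of h times normalized
    arclength is the constant 1 / pi. *)
Lemma integral_j_push_h (om : probability (plane R) R) (s : R)
  (phi : plane R * R -> R) :
  0 < s < 1 -> (forall A, measurable A -> om A = sigma s A) ->
  {within @Dhat R, continuous phi} ->
  (\int[j_push_h om]_(eta in Dhat) (phi eta)%:E =
   \int[leb]_(u in I) (phi (jmap (moebius_curve s u)) * pi^-1)%:E)%E.
Proof.
move=> s01 omE cphi.
have mphi := within_continuous_measurable_planeR measurable_Dhat cphi.
have mD := @measurable_disk R 1.
have subD : @disk R 1 `<=` @jmap R @^-1` Dhat by move=> z; exact: jmap_Dhat.
rewrite (@integral_transfer _ _ _ _ _ om (j_push_h om) (@jmap R) (disk 1)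
  (@hfun R))//; first last.
- exact: measurable_Dhat.
- by move=> z zd; have := hfun_ge0 zd; rewrite lee_fin.
- by apply: measurable_funTS; exact: measurable_hfun.
- exact: measurable_jmap.
rewrite (setIidr subD).
rewrite (eq_measure_integral (sigma s)); last by move=> A mA _; exact: omE.
rewrite integral_sigma//; last first.
  apply: measurable_funM; last by apply: measurable_funTS;
    exact: measurable_hfun.
  apply: (@measurable_comp _ _ _ _ _ _ Dhat) => //.
  - exact: measurable_Dhat.
  - by move=> _ [z zd <-]; exact: subD.
  - by apply: measurable_funTS; exact: measurable_jmap.
rewrite (_ : _ `&` _ = [set` `[- pi, pi]%R]); last first.
  apply/seteqP; split => [t []//|t tpi]; split => //.
  by apply: (circle_disk1 s01); exact: circ_circle.
pose G u := phi (jmap (moebius_curve s u)) * pi^-1.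
have cG : continuous G.
  move=> u; apply: cvgM; last exact: cvg_cst.
  exact: continuous_comp_moebius_curve.
transitivity (\int[leb]_(u in [set` `[(- (pi / 2)), (pi / 2)]%R]) (G u)%:E)%E;
  last first.
  rewrite integral_itv_bndoo//.
  by apply/measurable_EFinP; apply: measurable_funTS;
    exact: continuous_measurable_fun.
rewrite (substitution_half_h_primitive s01 cG); apply: eq_integral => t _.
rewrite /G moebius_curve_half_h_primitive// hfun_circ; congr (_%:E).
have -> : (pi *+ 2)^-1 = pi^-1 * 2^-1 :> R by rewrite -invfM mulr_natr.
exact: mulrACA.
Qed.

Lemma integral_lambdaF (phi : plane R * R -> R) : {within @Dhat R,
  continuous phi} ->
  measurable_fun I (fun u => phi (xi u)) /\
  (\int[@lambdaF R]_(eta in Dhat) (phi eta)%:E =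
   \int[leb]_(u in I) (phi (xi u) * pi^-1)%:E)%E.
Proof.
move=> cphi.
have mphi := within_continuous_measurable_planeR measurable_Dhat cphi.
have mI : measurable_fun I (fun u => phi (xi u)).
  apply: (@measurable_comp _ _ _ _ _ _ Dhat) => //.
  - exact: measurable_Dhat.
  - by move=> _ [u /= + <-]; rewrite in_itv/= => u2; exact: xi_Dhat_interior.
  - by apply: measurable_funTS; exact: measurable_xi.
split=> //.
have w : (pi / 2 - - (pi / 2))^-1 = pi^-1 :> R by rewrite opprK -splitr.
rewrite (@integral_transfer _ _ _ _ _ leb (@lambdaF R) (@xi R)
  [set` `[(- (pi / 2)), (pi / 2)]%R] (fun=> pi^-1))//; first last.
- exact: measurable_Dhat.
- move=> A mA; rewrite -[LHS]/(uniform_prob (@Npi2_lt_pi2 R) (@xi R @^-1` A)).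
  rewrite uniform_probE ?w//.
  by rewrite -[X in measurable X]setTI; exact: measurable_xi.
- by move=> u _; rewrite invr_ge0 pi_ge0.
- exact: measurable_xi.
rewrite (_ : _ `&` _ = [set` `[(- (pi / 2)), (pi / 2)]%R]); last first.
  apply/seteqP; split => [t []//|t]; split => //.
  by apply: xi_Dhat; move: H; rewrite /= in_itv.
rewrite integral_itv_bndoo//.
by apply/measurable_EFinP; apply: measurable_funM.
Qed.

(** After the change of variables the measure no longer depends on [n], and the
    integrands converge for every u strictly between - pi / 2 and pi / 2. *)
Lemma j_push_h_weak_limit (om : nat -> probability (plane R) R) (s_ : nat ->
  R) :
  (forall n, 0 < s_ n < 1) -> s_ n @[n --> \oo] --> (1 : R) ->
  (forall n A, measurable A -> om n A = sigma (s_ n) A) ->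
  weakly_converges_on Dhat (fun n => j_push_h (om n)) (@lambdaF R).
Proof.
move=> s01 s_cvg omE phi cphi.
have [mxi ->] := integral_lambdaF cphi.
under eq_fun do rewrite (integral_j_push_h (s01 _) (omE _) cphi).
have [M M0 phiM] := Dhat_bounded cphi.
apply: (@dominated_cvg _ _ _ leb I _
  (fun n u => (phi (jmap (moebius_curve (s_ n) u)) * pi^-1)%:E) _ (cst
    (M * pi^-1)%:E)) => //.
- move=> n; apply/measurable_EFinP; apply: measurable_funM => //.
  apply: measurable_funTS; apply: continuous_measurable_fun.
  exact: continuous_comp_moebius_curve.
- move=> u; rewrite /= in_itv/= => u2; apply: cvg_EFin; first exact: nearW.
  apply: cvgM; last exact: cvg_cst.
  have H1 : jmap (moebius_curve (s_ n) u) @[n --> \oo] `=>` within Dhat (nbhs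
    (xi u)).
    move=> V DV; have DV' : nbhs (xi u) (fun eta => Dhat eta -> V eta) by [].
    have H0 := cvg_jmap_moebius_curve s01 s_cvg u2 DV'.
    suff : \forall n \near \oo, V (jmap (moebius_curve (s_ n) u)) by [].
    have H3 : \forall n \near \oo, Dhat (jmap (moebius_curve (s_ n) u)) ->
      V (jmap (moebius_curve (s_ n) u)).
      exact: H0.
    apply: filterS H3 => n; apply; apply: jmap_Dhat.
    exact/(circle_disk1 (s01 n))/moebius_curve_circle.
  move/subspace_continuousP : cphi => /(_ _ (xi_Dhat_interior u2)) H2.
  exact: (cvg_comp _ _ H1 H2).
- have : leb.-integrable [set` `[(- (pi / 2)),
    (pi / 2)]%R] (EFin \o (fun=> M * pi^-1)).
    apply: continuous_compact_integrable; first exact: segment_compact.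
    by apply: continuous_subspaceT => x; exact: cvg_cst.
  by apply: integrableS => //; exact: subset_itv_oo_cc.
- move=> n u _; rewrite /= lee_fin normrM (ger0_norm
    (x := pi^-1)) ?invr_ge0 ?pi_ge0//.
  rewrite ler_wpM2r ?invr_ge0 ?pi_ge0//; apply: phiM; apply: jmap_Dhat.
  exact/(circle_disk1 (s01 n))/moebius_curve_circle.
Qed.

End weak_limit.

(** * Convergence of Poisson kernels with poles tending to 1 *)

Section locally_uniform.
Context {R : realType}.
Implicit Types (z w y : plane R).

(** Reducing to a common denominator, the numerator is, up to sign,
    (rho - 1) Z + (1 - S) (Z - Y), where Z and Y are the square distances from
    [w] to 1 and to [y], and S is the square modulus of [w].  The bound is
    uniform in [w] at a given distance from 1. *)
Lemma hfun_poisson_dist (rho c : R) w y : 0 < c -> disk 1 w ->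
  c < sqmod (pt1 - w) -> `|1 - y.1| + `|y.2| <= c / 10 ->
    `|1 - y.1| + `|y.2| <= 1 ->
  `|hfun w - (rho - sqmod w) / sqmod (y - w)| <=
    (4 * `|rho - 1| + 5 * (`|1 - y.1| + `|y.2|)) / (c * (c / 2)).
Proof.
move=> c0 w1 cw yc y1.
pose Z := sqmod (pt1 - w); pose Y := sqmod (y - w); pose S := sqmod w.
pose a := 1 - y.1; pose b := y.2; pose eta := `|a| + `|b|.
have S1 : S < 1 by move: w1; rewrite /disk/= expr1n.
have S0 : 0 <= S by exact: sqmod_ge0.
have w1le : `|w.1| <= 1.
  rewrite -(@ler_pXn2r _ 2)// ?nnegrE// expr1n real_normK ?num_real//.
  by rewrite (le_trans _ (ltW S1))// /S /sqmod lerDl sqr_ge0.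
have w2le : `|w.2| <= 1.
  rewrite -(@ler_pXn2r _ 2)// ?nnegrE// expr1n real_normK ?num_real//.
  by rewrite (le_trans _ (ltW S1))// /S /sqmod lerDr sqr_ge0.
have Z4 : Z <= 4.
  rewrite (_ : Z = 1 + S - 2 * w.1); last by rewrite /Z /S /sqmod/=; ring.
  by move: w1le; rewrite ler_norml => /andP[]; move: S1; clear; lra.
have ZY : `|Z - Y| <= 5 * eta.
  have -> : Z - Y = 2 * (a - w.1 * a + w.2 * b) - a * a - b * b.
    by rewrite /Z /Y /sqmod /a /b /=; ring.
  have n1 : `|w.1 * a| <= `|a| by rewrite normrM ler_piMl.
  have n2 : `|w.2 * b| <= `|b| by rewrite normrM ler_piMl.
  have aeta : `|a| <= 1 by rewrite (le_trans _ y1)// /a lerDl.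
  have beta : `|b| <= 1 by rewrite (le_trans _ y1)// /b lerDr.
  have n3 : `|a * a| <= `|a| by rewrite normrM ler_piMl.
  have n4 : `|b * b| <= `|b| by rewrite normrM ler_piMl.
  rewrite (le_trans (ler_normB _ _))// (le_trans (lerD (ler_normB _ _)
    (lexx _)))//.
  rewrite normrM ger0_norm//.
  have n5 : `|a - w.1 * a + w.2 * b| <= `|a| + `|w.1 * a| + `|w.2 * b|.
    by rewrite (le_trans (ler_normD _ _))// lerD2r ler_normB.
  rewrite /eta; move: n1 n2 n3 n4 n5.
  have := normr_ge0 a; have := normr_ge0 b.
  move: `|a| `|b| `|w.1 * a| `|w.2 * b| `|a * a| `|b * b| `|a - _ + _|.
  by clear; move=> A B C D E F G; lra.
have etac : 5 * eta <= c / 2 by move: yc; rewrite -/a -/b -/eta; clear; lra.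
have Y0 : c / 2 <= Y.
  by move: ZY etac cw; rewrite -/Z ler_norml => /andP[_]; clear; lra.
have Yp : 0 < Y by apply: lt_le_trans Y0; rewrite divr_gt0.
have Zp : 0 < Z by exact: lt_trans cw.
have -> : hfun w - (rho - S) / Y = - ((rho - 1) * Z + (1 - S) * (Z - Y)) /
  (Z * Y).
  rewrite /hfun -/S -/Z; field.
  by rewrite !gt_eqF.
rewrite normrM normrN ler_pM//.
- rewrite (le_trans (ler_normD _ _))// lerD//.
    by rewrite normrM mulrC ler_pM// ger0_norm ?(ltW Zp).
  rewrite normrM (le_trans _ ZY)// ler_piMl//.
  by rewrite ger0_norm ?subr_ge0 ?(ltW S1)// gerBl.
- rewrite normfV lef_pV2 ?posrE ?mulr_gt0 ?divr_gt0 ?normr_gt0 ?gt_eqF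
    ?mulr_gt0//.
  rewrite ger0_norm ?mulr_ge0 ?(ltW Zp) ?(ltW Yp)//.
  by rewrite ler_pM ?divr_ge0 ?(ltW c0)// ltW.
Qed.

Lemma locally_uniform_poisson (r_ : nat -> R) (y_ : nat -> plane R) :
  r_ n @[n --> \oo] --> (1 : R) -> y_ n @[n --> \oo] --> (pt1 : plane R) ->
  locally_uniformly_on (disk 1) (fun n z => poisson (r_ n) z (y_ n)) (@hfun R).
Proof.
move=> r1 y1 z z1.
pose c := sqmod (pt1 - z) / 2.
have pz : pt1 - z != 0.
  have p1 : circle 1 (pt1 : plane R) by rewrite /circle/=/sqmod/= expr0n addr0.
  exact: disk_circle_neq z1 p1.
have c0 : 0 < c by rewrite divr_gt0// sqmod_gt0.
exists [set w | disk 1 w /\ c < sqmod (pt1 - w)].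
  apply: filterI; first exact: open_nbhs_nbhs (conj (@open_disk _ 1) z1).
  have wz : pt1 - w @[w --> z] --> pt1 - z.
    by apply: cvgB; [exact: cvg_cst|exact: cvg_id].
  have H := cvg_comp _ _ wz (@continuous_sqmod R _).
  apply: (cvgr_gt _ H); rewrite /c ltr_pdivrMr// mulr_natr mulr2n.
  by rewrite ltrDl sqmod_gt0.
move=> P /uniform_nbhs[E [entE EP]].
have [e /= e0 eE] : exists2 e : R, 0 < e & [set xy : R * R | ball xy.1 e xy.2]
  `<=` E.
  by move: entE; rewrite -entourage_ballE.
pose eta n := `|1 - (y_ n).1| + `|(y_ n).2|.
have eta0 : eta n @[n --> \oo] --> (0 : R).
  have a1 : (y_ n).1 @[n --> \oo] --> (1 : R).
    exact: (cvg_comp _ _ y1 cvg_fst).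
  have a2 : (y_ n).2 @[n --> \oo] --> (0 : R).
    exact: (cvg_comp _ _ y1 cvg_snd).
  have -> : 0 = `|(1 - 1 : R)| + `|(0 : R)| by rewrite subrr normr0 addr0.
  apply: cvgD; last by apply: cvg_norm.
  by apply: cvg_norm; apply: cvgB => //; exact: cvg_cst.
have rho1 : r_ n ^+ 2 @[n --> \oo] --> (1 : R).
  rewrite -(expr1n _ 2); under eq_fun do rewrite expr2.
  by rewrite expr2; exact: cvgM.
have rho0 : `|r_ n ^+ 2 - 1| @[n --> \oo] --> (0 : R).
  have -> : 0 = `|(1 - 1 : R)| by rewrite subrr normr0.
  by apply: cvg_norm; apply: cvgB => //; exact: cvg_cst.
have b0 : 4 * `|r_ n ^+ 2 - 1| + 5 * eta n @[n --> \oo] --> (0 : R).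
  have -> : 0 = 4 * 0 + 5 * 0 :> R by rewrite !mulr0 addr0.
  by apply: cvgD; apply: cvgM => //; exact: cvg_cst.
have c10 : 0 < c / 10 by rewrite divr_gt0.
have ec : 0 < e * (c * (c / 2)) by rewrite mulr_gt0// mulr_gt0// divr_gt0.
near=> n; apply: EP => w [w1 cw] /=; apply: eE => /=.
rewrite /ball/=.
apply: (le_lt_trans (hfun_poisson_dist _ c0 w1 cw _ _)).
- by near: n; exact: (cvgr_le _ eta0).
- by near: n; exact: (cvgr_le _ eta0).
rewrite ltr_pdivrMr; last by rewrite mulr_gt0// divr_gt0.
by near: n; exact: (cvgr_lt _ b0).
Unshelve. all: by end_near. Qed.

End locally_uniform.

(** * Reaching every point of the fibre *)

Section endpoints.
Context {R : realType}.
Variables (s_ : nat -> R) (s01 : forall n, 0 < s_ n < 1).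
Hypothesis s_cvg : s_ n @[n --> \oo] --> (1 : R).

Let q_ n := (Num.sqrt (moebius_ratio (s_ n)))^-1.

Let sqrt_gt0 n : 0 < Num.sqrt (moebius_ratio (s_ n)).
Proof. by rewrite sqrtr_gt0 moebius_ratio_gt0. Qed.

Let ratioE n : moebius_ratio (s_ n) = Num.sqrt (moebius_ratio (s_ n)) ^+ 2.
Proof. by rewrite sqr_sqrtr// ltW// moebius_ratio_gt0. Qed.

Let cvg_sqrt : Num.sqrt (moebius_ratio (s_ n)) @[n --> \oo] --> (0 : R).
Proof.
apply/cvgrPdist_lt => e e0.
have e20 : 0 < e ^+ 2 by rewrite exprn_gt0.
move: (cvg_moebius_ratio s_cvg) => /cvgr_lt/(_ _ e20); apply: filterS => n re.
rewrite sub0r normrN gtr0_norm// -(ltr_pXn2r (n := 2)) ?nnegrE ?(ltW e0)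
  ?(ltW (sqrt_gt0 n))//.
by rewrite -ratioE.
Qed.

Let ratio_q n : moebius_ratio (s_ n) * q_ n = Num.sqrt (moebius_ratio (s_ n)).
Proof. by rewrite {1}ratioE /q_ expr2 mulfK// gt_eqF. Qed.

Let ratio_q2 n : moebius_ratio (s_ n) * q_ n ^+ 2 = 1.
Proof. by rewrite expr2 mulrA ratio_q /q_ divff// gt_eqF. Qed.

Let cvg_slope_y : 2 * s_ n / (1 + s_ n) * (q_ n / (1 + moebius_ratio
  (s_ n) * q_ n ^+ 2)) @[n --> \oo] --> +oo.
Proof.
apply/cvgryPge => A.
have A0 : 0 < (4 * (`|A| + 1))^-1 by rewrite invr_gt0 mulr_gt0// ltr_wpDl.
near=> n.
rewrite ratio_q2.
have f12 : 1 / 2 <= 2 * s_ n / (1 + s_ n).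
  by near: n; apply: (cvgr_ge _ (cvg_slope_factor s_cvg)); lra.
have kA : Num.sqrt (moebius_ratio (s_ n)) < (4 * (`|A| + 1))^-1.
  by near: n; exact: (cvgr_lt _ cvg_sqrt).
have qA : 4 * (`|A| + 1) <= q_ n.
  by rewrite /q_ -[leLHS]invrK lef_pV2 ?posrE ?invr_gt0// ltW.
have q0 : 0 <= q_ n / (1 + 1) by rewrite divr_ge0 ?invr_ge0 ?ltW.
have := ler_wpM2r q0 f12; apply: le_trans.
move: qA (ler_norm A); move: (q_ n) `|A| => q B => qA AB.
by have -> : 1 + 1 = 2 :> R by []; lra.
Unshelve. all: by end_near. Qed.

(** With the slope 1 / sqrt (moebius_ratio s) the point still tends to 1, while
    its second coordinate is the arctangent of a quantity of the order of this
    slope. *)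
Lemma cvg_jmap_endpoint (b : bool) :
  slope_point (s_ n) (if b then q_ n else - q_ n) @[n --> \oo] -->
    (pt1 : plane R) /\
  jmap (slope_point (s_ n) (if b then q_ n else - q_ n)) @[n --> \oo] -->
    xi (if b then pi / 2 else - (pi / 2)).
Proof.
have P : slope_point (s_ n) (if b then q_ n else - q_ n) @[n --> \oo] -->
  (pt1 : plane R).
  apply: cvg_slope_point => //; case: b.
    by under eq_fun do rewrite ratio_q.
  under eq_fun do rewrite mulrN ratio_q.
  by rewrite -oppr0; exact: cvgN.
split=> //; under eq_fun do rewrite jmap_slope//.
have T := cvg_comp _ _ cvg_slope_y (@cvgy_atan R).
case: b P => P; first exact: (cvg_pair P T).
have E n : atan (2 * s_ n / (1 + s_ n) * (- q_ n / (1 + moebius_ratio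
  (s_ n) * (- q_ n) ^+ 2))) =
    - atan (2 * s_ n / (1 + s_ n) * (q_ n / (1 + moebius_ratio
        (s_ n) * q_ n ^+ 2))).
  by rewrite sqrrN mulNr mulrN atanN.
under eq_fun do rewrite E.
exact: (cvg_pair P (cvgN T)).
Qed.

(** A fixed slope tan alpha reaches the interior points of the fibre; the slopes
    of [cvg_jmap_endpoint] reach the two end points. *)
Lemma approach_fibre (alpha : R) : - (pi / 2) <= alpha <= pi / 2 ->
  exists y : nat -> plane R, [/\ forall n, circle (s_ n) (y n),
    y n @[n --> \oo] --> (pt1 : plane R) & jmap
      (y n) @[n --> \oo] --> xi alpha].
Proof.
move=> /andP[a1 a2].
have [->|ra] := eqVneq alpha (pi / 2).
  have [P J] := cvg_jmap_endpoint true.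
  by exists (fun n => slope_point (s_ n) (q_ n)); split=> // n;
    exact: slope_point_circle.
have [->|la] := eqVneq alpha (- (pi / 2)).
  have [P J] := cvg_jmap_endpoint false.
  by exists (fun n => slope_point (s_ n) (- q_ n)); split=> // n;
    exact: slope_point_circle.
have ia : alpha \in `](- (pi / 2)), (pi / 2)[ by rewrite in_itv/= !lt_neqAle
  a1 a2 !andbT ra andbT eq_sym la.
exists (fun n => slope_point (s_ n) (tan alpha)); split.
- by move=> n; exact: slope_point_circle.
- apply: cvg_slope_point => //.
  by rewrite -(mul0r (tan alpha)); apply: cvgM;
    [exact: cvg_moebius_ratio|exact: cvg_cst].
- by apply: cvg_jmap_slope => //; rewrite tanK.
Qed.

End endpoints.

(** * Measures on the fibre *)

Section fibre_measures.
Context {R : realType}.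
Implicit Types (mu : {measure set (plane R * R) -> \bar R}).

Lemma lambdaF_Ffib : @lambdaF R Ffib = 1%E.
Proof.
rewrite -[LHS]/(uniform_prob (@Npi2_lt_pi2 R) (@xi R @^-1` Ffib)).
apply: (integral_uniform_pdf1 (@Npi2_lt_pi2 R)) => u; rewrite /= in_itv/=.
exact: xi_Ffib.
Qed.

Lemma lambdaF_FfibC : @lambdaF R (~` Ffib) = 0%E.
Proof.
rewrite -[LHS]/(uniform_prob (@Npi2_lt_pi2 R) (@xi R @^-1` (~` Ffib))).
rewrite /uniform_prob integral_uniform_pdf (_ : _ `&` _ =
  set0) ?integral_set0//.
apply/seteqP; split => // u /= [+ +]; rewrite in_itv/= => nF u2.
by apply: nF; exact: xi_Ffib.
Qed.

Lemma lambdaF_point (alpha : R) : @lambdaF R [set xi alpha] = 0%E.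
Proof.
rewrite -[LHS]/(uniform_prob (@Npi2_lt_pi2 R) (@xi R @^-1` [set xi alpha])).
rewrite (_ : _ @^-1` _ = [set alpha]); last first.
  by apply/seteqP; split => u /= => [[]|->].
have /null_content_dominatesP := dominates_uniform_prob (@Npi2_lt_pi2 R).
by apply => //; exact: lebesgue_measure_set1.
Qed.

Lemma measurable_xi_point (alpha : R) : measurable ([set xi alpha] : set
  (plane R * R)).
Proof.
rewrite (_ : [set xi alpha] = ([set 1] `*` [set 0]) `*` [set alpha]);
  last first.
  by apply/seteqP; split => [_ -> //|[[a b] c] [[/= -> ->] ->]].
by apply: measurableX; [apply: measurableX|]; exact: measurable_set1.
Qed.

Lemma lambdaF_not_dirac (alpha : R) :
  exists2 A, measurable A & @lambdaF R A <> \d_(xi alpha) A.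
Proof.
exists [set xi alpha]; first exact: measurable_xi_point.
rewrite lambdaF_point diracE mem_set//= => /eqP.
by rewrite eqe eq_sym oner_eq0.
Qed.

(** The kernel only depends on the projection, which is 1 all along the fibre. *)
Lemma integral_Khat mu z : (\int[mu]_(eta in Ffib) (Khat z eta)%:E =
  (hfun z)%:E * mu Ffib)%E.
Proof.
rewrite -integral_cst; last exact: measurable_Ffib.
apply: eq_integral => eta /[!inE] -[_ /= p].
by rewrite /Khat p.
Qed.

Lemma represents_h_of_mass mu : mu (~` Ffib) = 0%E -> mu Ffib = 1%E ->
  represents_h mu.
Proof. by move=> mu0 mu1; split => // z _; rewrite integral_Khat mu1 mule1. Qed.

Lemma dirac_represents : represents_h (\d_(xi (0 : R)) : {measure set
  (plane R * R) -> \bar R}).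
Proof.
have F0 : Ffib (xi (0 : R)).
  by apply: xi_Ffib; rewrite oppr_le0 divr_ge0// pi_ge0.
apply: represents_h_of_mass.
- by rewrite /= /dirac indicE memNset//= => /(_ F0).
- by rewrite /= /dirac indicE mem_set.
Qed.

(** Evaluate the representation at the origin, where h is 1. *)
Lemma represents_h_mass mu : represents_h mu -> mu Ffib = 1%E.
Proof.
move=> [_ /(_ origin (origin_disk ltr01))]; rewrite integral_Khat.
rewrite (_ : hfun origin = 1) ?mul1e//.
by rewrite /hfun /sqmod/= !subr0 !expr0n/= !addr0 !subr0 expr1n divr1.
Qed.

Lemma represents_h_pushforward mu : represents_h mu ->
  forall A : set (plane R), measurable A -> pushforward mu (@pproj R) A =
    \d_pt1 A.
Proof.
move=> rmu A mA; have mu1 := represents_h_mass rmu; have [mu0 _] := rmu.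
have mpA : measurable (@pproj R @^-1` A).
  rewrite -[X in measurable X]setTI.
  exact: (@measurable_fst _ _ (plane R) R measurableT _ mA).
rewrite /pushforward (measure_restrict measurable_Ffib mpA mu0) diracE.
have [Ap|nAp] := pselect (A pt1).
  rewrite mem_set// -mu1; congr (mu _); apply/seteqP;
    split => [eta []//|eta Feta].
  by split => //; have [_ /= p] := Feta; rewrite /preimage/= p.
rewrite memNset// (_ : _ `&` _ = set0) ?measure0//.
apply/seteqP; split => // eta [/= Ap [_ /= p]].
by apply: nAp; rewrite -p.
Qed.

End fibre_measures.

(** * The mass of neighbourhoods of points of the fibre *)

Section liminf.
Context {R : realType}.

Lemma limn_einf_gt0_of_cvg_minorant (u v : nat -> \bar R) (L : \bar R) :
  (forall n, v n <= u n)%E -> v n @[n --> \oo] --> L -> (0 < L)%E ->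
  (0 < limn_einf u)%E.
Proof.
move=> vu vL L0; apply: (lt_le_trans L0).
have [<- _] := cvg_limn_einf_sup vL.
rewrite !limn_einf_lim; apply: lee_lim; [exact: is_cvg_einfs|exact:
  is_cvg_einfs|].
apply: nearW => n; apply: le_ereal_inf_tmp => _ [k /= nk <-].
by apply: le_trans (vu k); apply: ereal_inf_lbound; exists k.
Qed.

Definition bump (alpha e : R) (eta : plane R * R) : R :=
  Num.max 0 (1 - `|eta - xi alpha| / e).

Lemma continuous_bump alpha e : continuous (bump alpha e).
Proof.
apply: (@max_fun_continuous _ (plane R * R)%type R (fun=> 0) (fun eta =>
  1 - `|eta - xi alpha| / e)).
  by move=> x; exact: cvg_cst.
move=> x; apply: cvgB; first exact: cvg_cst.
apply: cvgM; last exact: cvg_cst.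
by apply: cvg_norm; apply: cvgB; [exact: cvg_id|exact: cvg_cst].
Qed.

Lemma bump_ge0 alpha e eta : 0 <= bump alpha e eta.
Proof. by rewrite /bump le_max lexx. Qed.

Lemma bump_indic alpha e (W : set (plane R * R)) eta : 0 < e ->
  (forall x, `|x - xi alpha| < e -> W x) -> bump alpha e eta <= \1_W eta.
Proof.
move=> e0 eW; rewrite indicE; have [We|nWe] := pselect (W eta).
  by rewrite mem_set// /bump ge_max ler01 gerBl divr_ge0// ltW.
rewrite memNset// /bump ge_max lexx subr_le0 ler_pdivlMr// mul1r leNgt.
by apply/negP => /eW.
Qed.

Lemma bump_xi alpha e u : bump alpha e (xi u) =
  Num.max 0 (1 - `|u - alpha| / e).
Proof.
rewrite /bump; congr (Num.max 0 (1 - _ / e)).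
have -> : xi u - xi alpha = (0, u - alpha) by rewrite /xi; congr (_, _);
  rewrite -[RHS](subrr pt1).
by rewrite prod_normE/= normr0; apply/max_idPr.
Qed.

(** The bump is at least 1 / 2 on the interval of radius e / 2 around [alpha],
    which meets ]- pi / 2, pi / 2[ in an interval of positive length even when
    [alpha] is an end point. *)
Lemma lambdaF_bump_gt0 (alpha e : R) : - (pi / 2) <= alpha <= pi / 2 -> 0 < e ->
  (0 < \int[@lambdaF R]_(eta in Dhat) (bump alpha e eta)%:E)%E.
Proof.
move=> /andP[a1 a2] e0.
have cb : {within @Dhat R, continuous (bump alpha e)}.
  by apply: continuous_subspaceT; exact: continuous_bump.
have [mb ->] := integral_lambdaF cb.
pose p : R := pi / 2; have p0 : 0 < p by rewrite divr_gt0// pi_gt0.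
pose a := Num.max (- p) (alpha - e / 2); pose b := Num.min p (alpha + e / 2).
have ab : a < b by rewrite /a /b gt_max !lt_min; apply/andP; split;
  apply/andP; split; rewrite /p in a1 a2 p0 *; lra.
have pi0 : 0 < pi^-1 :> R by rewrite invr_gt0 pi_gt0.
have subI : [set` `]a, b[%R] `<=` [set` `](- (pi / 2)), (pi / 2)[%R].
  move=> u; rewrite /= !in_itv/= /a /b gt_max lt_min.
  by move=> /andP[/andP[-> _] /andP[-> _]].
apply: (@lt_le_trans _ _ (\int[lebesgue_measure]_(u in [set` `]a,
  b[%R]) ((1 / 2) * pi^-1)%:E)%E).
  rewrite integral_cst//= lebesgue_measure_itv/= lte_fin ab -EFinD -EFinM
    lte_fin.
  by rewrite mulr_gt0// ?subr_gt0// mulr_gt0.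
apply: (@le_trans _ _ (\int[lebesgue_measure]_(u in [set` `]a,
  b[%R]) (bump alpha e (xi u) * pi^-1)%:E)%E).
  apply: ge0_le_integral => //.
  - by move=> u _; rewrite lee_fin mulr_ge0// ltW.
  - apply/measurable_EFinP; apply: measurable_funM => //.
    exact: measurable_funS mb.
  - move=> u; rewrite /= in_itv/= /a /b gt_max lt_min =>
      /andP[/andP[_ u1] /andP[_ u2]].
    rewrite lee_fin ler_wpM2r ?(ltW pi0)// bump_xi le_max; apply/orP; right.
    have : `|u - alpha| / e <= 1 / 2.
      rewrite ler_pdivrMr//; apply: ltW; rewrite ltr_norml.
      by apply/andP; split; lra.
    lra.
apply: ge0_subset_integral => //.
- by apply/measurable_EFinP; apply: measurable_funM.
- by move=> u _; rewrite lee_fin mulr_ge0 ?bump_ge0// ltW.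
Qed.

(** The mass of a neighbourhood dominates the integral of a bump supported in
    it, which has a positive limit. *)
Lemma liminf_j_push_h_gt0 (om : nat -> probability (plane R) R) (s_ : nat ->
  R) (alpha : R)
    (W : set (plane R * R)) :
  (forall n, 0 < s_ n < 1) -> s_ n @[n --> \oo] --> (1 : R) ->
  (forall n A, measurable A -> om n A = sigma (s_ n) A) ->
  - (pi / 2) <= alpha <= pi / 2 -> open W -> W (xi alpha) ->
  (0 < limn_einf (fun n => j_push_h (om n) (W `&` Dhat)))%E.
Proof.
move=> s01 s_cvg omE a2 oW Wa.
have [e /= e0 eW] : exists2 e : R, 0 < e & forall x, `|x - xi alpha| < e -> W x.
  have /nbhs_normP[e /= e0 eW] := open_nbhs_nbhs (conj oW Wa).
  by exists e => // x xe; apply: eW; rewrite /= distrC.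
have cb : {within @Dhat R, continuous (bump alpha e)}.
  by apply: continuous_subspaceT; exact: continuous_bump.
have mW : measurable W by exact: open_measurable_planeR.
have mD := @measurable_Dhat R.
apply: limn_einf_gt0_of_cvg_minorant (j_push_h_weak_limit s01 s_cvg omE cb)
  (lambdaF_bump_gt0 a2 e0) => n.
rewrite -(integral_indic (j_push_h (om n)) mD mW).
apply: ge0_le_integral => //.
- by move=> eta _; rewrite lee_fin bump_ge0.
- by apply/measurable_EFinP; exact: within_continuous_measurable_planeR.
- by apply/measurable_EFinP; exact: measurable_indic.
- by move=> eta _; rewrite lee_fin bump_indic.
Qed.

End liminf.

(** * The theorem *)

Theorem proposition5p5 (R : realType) (r : nat -> R)
    (r_gt0 : forall n, 0 < r n)
    (r_lt : forall n, r n < r n.+1)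
    (r_cvg : r n @[n --> \oo] --> (1 : R)) :
  [/\ [/\ forall n, connected (disk (r n)) /\ regular_domain (disk (r n)),
          disk (r 0%N) origin,
          (forall n, compact (closure (disk (r n))) /\
                     closure (disk (r n)) `<=` disk (r n.+1)),
          \bigcup_n disk (r n) = disk (1 : R) &
          forall n,
            [/\ is_relative_kernel (disk (r n)) origin (poisson (r n)),
                {within disk (r n) `*` boundary (disk (r n)),
                  continuous (fun zy => poisson (r n) zy.1 zy.2)} &
                forall y, boundary (disk (r n)) y ->
                  minimal_positive_harmonic (disk (r n))
                    (fun z => poisson (r n) z y)]],
      (forall alpha : R, - (pi / 2) <= alpha <= pi / 2 ->
        (forall W : set (plane R * R), open W -> W (xi alpha) ->
          (0 < limn_einf (fun n =>
             j_push_h (harmonic_measure (disk (r n)) origin)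
               (W `&` Dhat)))%E) /\
        exists y : nat -> plane R,
          [/\ \forall n \near \oo, boundary (disk (r n)) (y n),
              jmap (y n) @[n --> \oo] --> xi alpha &
              locally_uniformly_on (disk 1)
                (fun n z => poisson (r n) z (y n)) hfun]),
      weakly_converges_on Dhat
        (fun n => j_push_h (harmonic_measure (disk (r n)) origin)) lambdaF /\
      (forall alpha : R, - (pi / 2) <= alpha <= pi / 2 ->
        exists2 A, measurable A & lambdaF A <> \d_(xi alpha) A) &
      (exists mu1 mu2 : {measure set (plane R * R) -> \bar R},
        [/\ represents_h mu1, represents_h mu2 &
            exists2 A, measurable A & mu1 A <> mu2 A]) /\
      (forall mu : {measure set (plane R * R) -> \bar R}, represents_h mu ->
        forall A : set (plane R), measurable A ->
          pushforward mu pproj A = \d_pt1 A)].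
Proof.
have r_le1 n : r n <= 1.
  rewrite -(cvg_lim (@Rhausdorff R) r_cvg).
  apply: nondecreasing_cvgn_le; last by apply/cvg_ex; exists 1.
  by apply/nondecreasing_seqP => m; exact: ltW.
have r01 n : 0 < r n < 1 by rewrite r_gt0 (lt_le_trans (r_lt n)).
have omE n A : measurable A -> harmonic_measure (disk (r n)) origin A =
  sigma (r n) A.
  exact: harmonic_measure_origin.
split.
- split.
  + by move=> n; split; [exact: connected_disk|exact: regular_disk].
  + exact: origin_disk.
  + by move=> n; split; [exact: compact_closure_disk|exact:
      closure_disk_subset].
  + apply/seteqP; split => [z [n _]|z z1].
      rewrite /disk/= => /lt_trans; apply.
      by have /andP[? ?] := r01 n; rewrite expr1n expr_lt1// ltW.
    have r2 : r n ^+ 2 @[n --> \oo] --> (1 ^+ 2 : R).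
      by under eq_fun do rewrite expr2; rewrite expr2; exact: cvgM.
    near \oo => n; exists n => //.
    by near: n; exact: (cvgr_gt _ r2).
  + move=> n; split.
    * exact: relative_kernel_disk.
    * exact: poisson_joint_disk.
    * by move=> y; rewrite boundary_disk// => yr; exact: minimal_poisson.
- move=> alpha a2; split; first by move=> W; exact: liminf_j_push_h_gt0.
  have [y [yr y1 jy]] := approach_fibre r01 r_cvg a2.
  exists y; split=> //; last exact: locally_uniform_poisson.
  by apply: nearW => n; rewrite boundary_disk.
- split; first exact: j_push_h_weak_limit.
  by move=> alpha _; exact: lambdaF_not_dirac.
- split; last by move=> mu; exact: represents_h_pushforward.
  exists (@lambdaF R), (\d_(xi (0 : R))); split.
  + exact: represents_h_of_mass lambdaF_FfibC lambdaF_Ffib.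
  + exact: dirac_represents.
  + exact: lambdaF_not_dirac.
Unshelve. all: by end_near. Qed.
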